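(* Let $G=(V,E,\pi)$ be a vertex-weighted directed graph (with a self-loop at each vertex), $n=|V|$. For any $2\le k\le n$, \[ \vec\lambda_2^{v*}(G)\lesssim\vec\psi(G)\lesssim\frac{k^{3/2}\cdot\log(\Delta\cdot\alpha(G))\cdot\vec\lambda_2^{v*}(G)}{\sqrt{\vec\lambda_k^{v*}(G)}}\lesssim\frac{k^{3/2}\cdot\log(\Delta/\vec\psi(G))\cdot\vec\lambda_2^{v*}(G)}{\sqrt{\vec\lambda_k^{v*}(G)}}. \]
   Context: Notation: $f\lesssim g$ means $f\le c\,g$ for an absolute constant $c$; $\Delta$ is the maximum unweighted total degree of a vertex. For $S\subseteq V$: $\pi(S)=\sum_{v\in S}\pi(v)$, $\partial^+(S)=\{v\notin S:\exists u\in S,uv\in E\}$, $\vec\psi(S)=\frac{\min\{\pi(\partial^+(S)),\pi(\partial^+(\overline S))\}}{\min\{\pi(S),\pi(\overline S)\}}$, $\vec\psi(G)=\min_{\emptyset\ne S\subsetneq V}\vec\psi(S)$. Asymmetric ratio: with $w_\pi(uv)=\min\{\pi(u),\pi(v)\}$ and $\delta^+(S)=\{uv\in E:u\in S,v\notin S\}$, $\alpha(G)=\max_{\emptyset\ne S\subsetneq V}w_\pi(\delta^+(S))/w_\pi(\delta^+(\overline S))$. With $\Pi=\mathrm{diag}(\pi)$, $\vec\lambda_k^{v*}(G)=\max_A\lambda_k(I-\Pi^{-1/2}\frac{A+A^T}2\Pi^{-1/2})$, the max over nonnegative $A$ with $A(u,v)=0$ for $uv\notin E$ and $\sum_vA(u,v)=\sum_vA(v,u)=\pi(u)$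 for all $u$, and $\lambda_k$ is the $k$-th smallest eigenvalue. *)

(* Defs.v *)
From mathcomp Require Import all_boot all_order all_algebra.
From mathcomp Require Import all_classical all_reals all_analysis.

Set Implicit Arguments.
Unset Strict Implicit.
Unset Printing Implicit Defensive.

Import Order.TTheory GRing.Theory Num.Theory.
Local Open Scope ring_scope.

(* The graph is a finite type V, an edge relation E and vertex weights wt. *)

Section Combinatorics.
Context {R : realType} {V : finType} (E : rel V) (wt : V -> R).
Implicit Types S : {set V}.

(* In-degree plus out-degree, so a self-loop counts twice. *)
Definition total_degree (v : V) : nat :=
  (#|[pred u | E u v]| + #|[pred u | E v u]|)%N.

Definition max_degree : nat := \max_(v : V) total_degree v.

Definition weight S : R := \sum_(v in S) wt v.

Definition out_boundary S : {set V} :=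
  [set v | (v \notin S) && [exists u in S, E u v]]%SET.

Definition cut_weight S : R :=
  \sum_(u in S) \sum_(v in ~: S | E u v) Num.min (wt u) (wt v).

Definition proper_cut : set {set V} :=
  [set S | S != finset.set0 /\ S != [set: V]%SET]%classic.

Definition set_expansion S : R :=
  Num.min (weight (out_boundary S)) (weight (out_boundary (~: S)))
  / Num.min (weight S) (weight (~: S)).

(* inf and sup below range over a finite set, which is nonempty when V has at
   least two vertices, so they are a minimum and a maximum. *)
Definition vertex_expansion : R :=
  inf [set set_expansion S | S in proper_cut]%classic.

(* A ratio with zero denominator is 0 here, where it should be infinite. Such a
   ratio occurs only if E is not strongly connected, in which case
   vertex_expansion and reweighted_eigenvalue 2 are both 0, so that any formula
   with reweighted_eigenvalue 2 as a factor ignores this value. *)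
Definition asymmetric_ratio : R :=
  sup [set cut_weight S / cut_weight (~: S) | S in proper_cut]%classic.

End Combinatorics.

Section Spectrum.
Context {R : realType}.

(* The eigenvalues of M with multiplicity, in nondecreasing order; the empty
   sequence if the characteristic polynomial of M does not split over R, which
   never happens for symmetric M. *)
Definition eigenvalues n (M : 'M[R]_n) : seq R :=
  xget [::] (fun s : seq R => sorted <=%R s /\
                              char_poly M = \prod_(a <- s) ('X - a%:P)).

(* k counts from 1. *)
Definition kth_eigenvalue n (k : nat) (M : 'M[R]_n) : R :=
  (eigenvalues M)`_k.-1.

End Spectrum.

Section Reweighting.
Context {R : realType} {V : finType} (E : rel V) (wt : V -> R).

(* Matrices are indexed by 'I_#|V|, identified with V by enum_rank/enum_val. *)
Definition reweighting : set 'M[R]_#|V| :=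
  [set A | [/\ forall i j, 0 <= A i j,
      forall u v, ~~ E u v -> A (enum_rank u) (enum_rank v) = 0,
      forall u, \sum_(v : V) A (enum_rank u) (enum_rank v) = wt u &
      forall u, \sum_(v : V) A (enum_rank v) (enum_rank u) = wt u]]%classic.

Definition inv_sqrt_weight_mx : 'M[R]_#|V| :=
  diag_mx (\row_i (Num.sqrt (wt (enum_val i)))^-1).

Definition normalized_laplacian (A : 'M[R]_#|V|) : 'M[R]_#|V| :=
  1%:M - inv_sqrt_weight_mx *m (2^-1 *: (A + A^T)) *m inv_sqrt_weight_mx.

(* The reweightings form a compact set, nonempty when E is reflexive, on which
   kth_eigenvalue k is continuous, so the supremum is attained. *)
Definition reweighted_eigenvalue (k : nat) : R :=
  sup [set kth_eigenvalue k (normalized_laplacian A) | A in reweighting]%classic.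

End Reweighting.

(* Main.v *)
Require Import Defs.
From mathcomp Require Import all_boot all_order all_algebra.
From mathcomp Require Import all_classical all_reals all_analysis.
From mathcomp Require Import ring lra zify.

(** Write E_a(x) = 1/2 sum a(u,v) (x_u - x_v)^2 for a reweighting a, let
    lambda_k be the k-th reweighted eigenvalue, and let psi, alpha and Delta be
    the vertex expansion, the asymmetric ratio and the maximum degree. Indicators
    of a cut give lambda_2 <= 2 psi. For the third inequality, the cheaper
    endpoints of the edges leaving S form a vertex cover of these edges whose
    removal from S leaves a set with small out-boundary; hence alpha <= 2 Delta / psi.

    For the second inequality, a separation argument between the Laplacians and
    the positive semidefinite cone turns lambda_2 into a vector embedding f with
    E_a(f) <= 2 lambda_2 |f|^2 for all reweightings a simultaneously. A random
    signing projects f to the line. Edges on which the squared length grows by more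
    than a factor of order log (Delta alpha) have expected contribution at most
    1 / (Delta alpha) times sum w |f_u - f_v|^2, where w is the minimum of the two
    vertex weights; this is paid for by a single reweighting dominating
    w / (Delta alpha), which exists by Hoffman's circulation theorem. So some z on
    the line satisfies E_a(z) <= mu |z|^2 with mu = O(log (Delta alpha) lambda_2).

    Thresholds are then placed greedily along z. Either 2k tent functions with
    disjoint supports and equal norm fit between consecutive thresholds, which bounds
    lambda_k, or z is within squared distance O(mu / lambda_k) of at most 2k
    thresholds. In the latter case let F be the antiderivative of the distance to
    the thresholds, composed with z. Linear programming duality over the
    reweightings and a threshold argument give an L1 Poincare inequality
    psi sum pi |F - c| = O(max_a sum a(u,v) |F_u - F_v|), whose left side is at least
    of order psi |z|^2 / k and whose right side is
    O(mu / sqrt lambda_k) |z|^2. *)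

Set Implicit Arguments.
Unset Strict Implicit.
Unset Printing Implicit Defensive.

Import Order.TTheory GRing.Theory Num.Theory.
Import numFieldNormedType.Exports.
Local Open Scope ring_scope.

(** * Minima of continuous functions on finite-dimensional closed sets *)

Section RealContinuity.
Local Open Scope classical_set_scope.
Context {R : realType} {T : topologicalType}.
Implicit Types (f g : T -> R).

Lemma continuous_expf f n : continuous f -> continuous (fun z => f z ^+ n).
Proof.
move=> cf z; apply: (@continuous_comp _ _ _ f (fun x : R => x ^+ n)).
  exact: cf.
exact: exprn_continuous.
Qed.

Lemma continuous_addf f g : continuous f -> continuous g ->
  continuous (fun z => f z + g z).
Proof. by move=> cf cg z; apply: cvgD; [exact: cf|exact: cg]. Qed.

Lemma continuous_subf f g : continuous f -> continuous g ->
  continuous (fun z => f z - g z).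
Proof. by move=> cf cg z; apply: cvgB; [exact: cf|exact: cg]. Qed.

Lemma continuous_mulf f g : continuous f -> continuous g ->
  continuous (fun z => f z * g z).
Proof. by move=> cf cg z; apply: cvgM; [exact: cf|exact: cg]. Qed.

Lemma continuous_cst (x : R) : continuous (fun _ : T => x).
Proof. by move=> z; exact: cvg_cst. Qed.

Lemma continuous_sumf (J : finType) (P : pred J) (F : J -> T -> R) :
  (forall j, P j -> continuous (F j)) ->
  continuous (fun z => \sum_(j | P j) F j z).
Proof. by apply: continuous_big; exact: add_continuous. Qed.

Lemma closed_nonneg f : continuous f -> closed [set z | 0 <= f z].
Proof.
move=> cf; rewrite (_ : [set _ | _] = f @^-1` [set x | 0 <= x]) //.
by apply: preimage_closed; [move=> ? _; exact: cf|exact: closed_ge].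
Qed.

Lemma closed_zero f : continuous f -> closed [set z | f z = 0].
Proof.
move=> cf; rewrite (_ : [set _ | _] = f @^-1` [set x | x = 0]) //.
by apply: preimage_closed; [move=> ? _; exact: cf|exact: closed_eq].
Qed.

Lemma closed_forall (J : Type) (K : J -> set T) :
  (forall j, closed (K j)) -> closed [set z | forall j, K j z].
Proof.
move=> cK; rewrite (_ : [set _ | _] = \bigcap_j K j).
  by apply: closed_bigI => j _; exact: cK.
by apply/seteqP; split => z Kz j; [move=> _|]; exact: Kz.
Qed.

End RealContinuity.

Section Minimisation.
Local Open Scope classical_set_scope.
Variables (R : realType) (I : finType).
Let T : topologicalType := {ptws I -> R}.

Lemma continuous_coord (i : I) : continuous (fun z : T => z i : R).
Proof.
have h := (@proj_continuous I (fun=> R : topologicalType) i).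
exact h.
Qed.

Lemma compact_box (B : R) : compact ([set z | forall i, `[- B, B] (z i)] : set T).
Proof.
have h := (@tychonoff I (fun=> R : topologicalType) (fun=> `[- B, B])).
by apply: h => i; exact: segment_compact.
Qed.

(** The sublevel set of [z0] in [K] lies in a compact box, so a minimiser over the part of [K] in
    that box is global: elsewhere in [K] the value exceeds [f z0]. *)
Lemma coercive_min (f : T -> R) (K : set T) (z0 : T) (B : R) :
  continuous f -> closed K -> K z0 ->
  (forall z, K z -> f z <= f z0 -> forall i, `|z i| <= B) ->
  exists2 z, K z & forall z', K z' -> f z <= f z'.
Proof.
move=> cf cK Kz0 bnd.
have cKb := compact_closedI (@compact_box B) cK.
have Kz0b : ([set z | forall i, `[- B, B] (z i)] `&` K) z0.
  split => // i; rewrite /= in_itv /= -ler_norml; exact: bnd.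
have [||c] := @compact_EVT_min T R f _ _ cKb.
- by exists z0.
- exact/continuous_subspaceT.
rewrite inE => -[_ Kc] cmin; exists c => // z Kz.
have [zz0|zz0] := leP (f z) (f z0).
  apply: cmin; rewrite inE; split => // i.
  by rewrite /= in_itv /= -ler_norml; exact: bnd.
by apply: le_trans (ltW zz0); apply: cmin; rewrite inE.
Qed.
End Minimisation.

(** * Circulations with prescribed bounds *)

(** First-order optimality: the hypothesis is the change of a quadratic objective along a feasible
    direction, and for small t the linear term decides its sign. *)
Lemma first_order (R : realFieldType) (G Q : R) :
  (forall t, 0 < t -> t <= 1 -> 0 <= 2 * t * G + t ^+ 2 * Q) -> 0 <= G.
Proof.
move=> H; rewrite leNgt; apply/negP => G0.
have Q1 : 0 < `|Q| + 1 by rewrite ltr_wpDl.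
pose t := Num.min 1 (- G / (`|Q| + 1)).
have t0 : 0 < t by rewrite lt_min ltr01 divr_gt0 // oppr_gt0.
have tQ : t * (`|Q| + 1) <= - G by rewrite -ler_pdivlMr // ge_min lexx orbT.
have := H t t0; rewrite ge_min lexx => /(_ isT).
have -> : 2 * t * G + t ^+ 2 * Q = t * (2 * G + t * Q) by ring.
rewrite pmulr_rge0 // leNgt; apply/negP; rewrite negbK.
have : t * Q <= t * `|Q| by rewrite ler_pM2l // ler_norm.
by move: tQ; rewrite mulrDr mulr1; lra.
Qed.

Lemma sum_square_line (R : realFieldType) (J : finType) (b e : J -> R) (t : R) :
  \sum_j (b j + t * e j) ^+ 2 = \sum_j b j ^+ 2
    + 2 * t * (\sum_j b j * e j) + t ^+ 2 * \sum_j e j ^+ 2.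
Proof.
by rewrite !mulr_sumr -!big_split; apply: eq_bigr => j _ /=; ring.
Qed.

Lemma sum_square_min (R : realFieldType) (J : finType) (b e : J -> R) :
  (forall t, 0 < t -> t <= 1 ->
    \sum_j b j ^+ 2 <= \sum_j (b j + t * e j) ^+ 2) ->
  0 <= \sum_j b j * e j.
Proof.
move=> H; apply: (@first_order _ _ (\sum_j e j ^+ 2)) => t t0 t1.
by have := H t t0 t1; rewrite sum_square_line; lra.
Qed.

Section Circulation.
Context {R : realType} {V : finType}.
Implicit Types (a w : V -> V -> R) (S : {set V}).

Definition flow a S : R := \sum_(u in S) \sum_(v in ~: S) a u v.

(** Edges with both ends in S cancel, so only those crossing the cut survive. *)
Lemma net_flow a S :
  \sum_(u in S) (\sum_v a u v - \sum_v a v u) = flow a S - flow a (~: S).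
Proof.
rewrite sumrB /flow finset.setCK.
under eq_bigr do rewrite (bigID [in S]) /=.
under [X in _ - X]eq_bigr do rewrite (bigID [in S]) /=.
rewrite !big_split /= [X in _ - (X + _)]exchange_big /=.
rewrite opprD addrACA subrr add0r.
congr (_ - _).
  by apply: eq_bigr => u _; apply: eq_bigl => v; rewrite inE.
by rewrite exchange_big; apply: eq_bigl => v; rewrite inE.
Qed.

(* Minimise the sum of the squared net out-flows b over the box w <= a <= alpha w.
   At a minimiser, edges leaving {b > 0} carry w and edges entering it carry
   alpha w, so by the cut condition b vanishes. *)
Theorem hoffman_circulation w (alpha : R) :
  (forall u v, 0 <= w u v) -> 1 <= alpha ->
  (forall S, S != finset.set0 -> S != [set: V]%SET ->
    flow w S <= alpha * flow w (~: S)) ->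
  exists a, (forall u v, w u v <= a u v <= alpha * w u v)
    /\ forall u, \sum_v a u v = \sum_v a v u.
Proof.
move=> w0 alpha1 cut.
pose net (z : V * V -> R) u := \sum_v z (u, v) - \sum_v z (v, u).
pose Phi (z : {ptws (V * V) -> R}) : R := \sum_u net z u ^+ 2.
have cPhi : continuous Phi.
  apply: continuous_sumf => u _; apply: continuous_expf.
  by apply: continuous_subf; apply: continuous_sumf => v _; exact: continuous_coord.
pose K := [set z : {ptws (V * V) -> R} |
  forall p, 0 <= z p - w p.1 p.2 /\ 0 <= alpha * w p.1 p.2 - z p]%classic.
have cK : closed K.
  apply: closed_forall => p; apply: closedI; apply: closed_nonneg;
    by apply: continuous_subf; first [exact: continuous_coord|exact: continuous_cst].
pose z0 : {ptws (V * V) -> R} := fun p => w p.1 p.2.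
have Kz0 : K z0.
  move=> p; rewrite /z0 subrr; split => //.
  by rewrite subr_ge0 ler_peMl.
have [z Kz zmin] : exists2 z, K z & forall z', K z' -> Phi z <= Phi z'.
  apply: (@coercive_min R (V * V)%type Phi K z0 (\sum_p alpha * w p.1 p.2)) => //.
  move=> z Kz _ p; have [] := Kz p; rewrite !subr_ge0 => z1 z2.
  rewrite ger0_norm ?(le_trans _ z1) // (le_trans z2) //.
  rewrite (bigD1 p) //= lerDl sumr_ge0 // => q _.
  by rewrite mulr_ge0 // (le_trans ler01).
have zK u v : w u v <= z (u, v) <= alpha * w u v.
  by have := Kz (u, v); rewrite !subr_ge0 => -[-> ->].
exists (fun u v => z (u, v)); split => // u0; apply/eqP; rewrite -subr_eq0.
set b := net z; have bE u : \sum_v z (u, v) - \sum_v z (v, u) = b u by [].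
rewrite bE; apply/negPn/negP => bu0.
(* Adding t on (u, v) changes the net out-flow by t at u and by -t at v, hence [Phi] by 2 (t (b u -
   b v) + t^2). *)
have shift u v t : K (fun p => z p + t * (p == (u, v))%:R) -> u != v ->
    0 <= t * (b u - b v) + t ^+ 2.
  move=> Kt uv.
  have := zmin _ Kt.
  have netE x : net (fun p => z p + t * (p == (u, v))%:R) x =
     b x + t * ((x == u)%:R - (x == v)%:R).
    rewrite /net !big_split /= -!mulr_sumr.
    have -> : \sum_i ((x, i) == (u, v))%:R = (x == u)%:R :> R.
      rewrite (bigD1 v) //= xpair_eqE eqxx andbT big1 ?addr0 // => i iv.
      by rewrite xpair_eqE (negbTE iv) andbF.
    have -> : \sum_i ((i, x) == (u, v))%:R = (x == v)%:R :> R.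
      rewrite (bigD1 u) //= xpair_eqE eqxx big1 ?addr0 // => i iv.
      by rewrite xpair_eqE (negbTE iv).
    by rewrite /b /net; ring.
  rewrite /Phi; under [X in _ <= X]eq_bigr do rewrite netE.
  rewrite sum_square_line.
  have -> : \sum_j b j * ((j == u)%:R - (j == v)%:R) = b u - b v.
    under eq_bigr do rewrite mulrBr.
    rewrite sumrB; congr (_ - _).
      rewrite (bigD1 u) //= eqxx mulr1 big1 ?addr0 // => i iv.
      by rewrite (negbTE iv) mulr0.
    rewrite (bigD1 v) //= eqxx mulr1 big1 ?addr0 // => i iv.
    by rewrite (negbTE iv) mulr0.
  have -> : \sum_j ((j == u)%:R - (j == v)%:R) ^+ 2 = 2 :> R.
    have vu : v != u by rewrite eq_sym.
    rewrite (bigD1 u) //= (bigD1 v) //= !eqxx big1 => [|i /andP[iu iv]].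
      rewrite (negbTE uv) (negbTE vu) subr0 sub0r sqrrN !expr1n addr0; ring.
    by rewrite (negbTE iu) (negbTE iv) subrr expr0n.
  by rewrite -/b; lra.
pose S := [set u | 0 < b u]%SET.
have sb : \sum_u b u = 0 by rewrite /b /net sumrB exchange_big subrr.
have S0 : S != finset.set0.
  apply/eqP => S0; have bn u : b u <= 0.
    rewrite leNgt; apply/negP => bu; have : u \in S by rewrite inE.
    by rewrite S0 inE.
  have := sb; rewrite (bigD1 u0) //=.
  have : \sum_(i | i != u0) b i <= 0 by apply: sumr_le0 => *; exact: bn.
  by have := bn u0; move: bu0; rewrite neq_lt => /orP[]; lra.
have ST : S != [set: V]%SET.
  apply/eqP => ST; have bp u : 0 < b u.
    by have : u \in S by [rewrite ST inE]; rewrite inE.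
  have := sb; rewrite (bigD1 u0) //=.
  have : 0 <= \sum_(i | i != u0) b i by apply: sumr_ge0 => *; exact/ltW/bp.
  by have := bp u0; lra.
have low u v : u \in S -> v \notin S -> z (u, v) <= w u v.
  rewrite !inE -leNgt => bu bv; rewrite leNgt; apply/negP => zw.
  have uv : u != v by apply: contraTneq bu => ->; rewrite -leNgt.
  (* The first term keeps the lowered value at least [w u v]; the second gives t^2 < t (b u - b v),
     so that [Phi] would decrease. *)
  pose t := Num.min (z (u, v) - w u v) ((b u - b v) / 2).
  have t0 : 0 < t by rewrite lt_min; apply/andP; split; lra.
  have t1 : t <= z (u, v) - w u v by rewrite ge_min lexx.
  have t2 : t <= (b u - b v) / 2 by rewrite ge_min lexx orbT.
  have := @shift u v (- t); rewrite uv => /(_ _ isT).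
  have KK : K (fun p => z p + - t * (p == (u, v))%:R).
    move=> [x y] /=; have [[-> ->]|nxy] := eqVneq (x, y) (u, v).
      by rewrite mulr1; have /andP[] := zK u v; split; lra.
    by rewrite mulr0 addr0; exact: (Kz (x, y)).
  by move/(_ KK); nra.
have high u v : u \notin S -> v \in S -> alpha * w u v <= z (u, v).
  rewrite !inE -leNgt => bu bv; rewrite leNgt; apply/negP => zw.
  have uv : u != v by apply: contraTneq bv => <-; rewrite -leNgt.
  pose t := Num.min (alpha * w u v - z (u, v)) ((b v - b u) / 2).
  have t0 : 0 < t by rewrite lt_min; apply/andP; split; lra.
  have t1 : t <= alpha * w u v - z (u, v) by rewrite ge_min lexx.
  have t2 : t <= (b v - b u) / 2 by rewrite ge_min lexx orbT.
  have := @shift u v t; rewrite uv => /(_ _ isT).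
  have KK : K (fun p => z p + t * (p == (u, v))%:R).
    move=> [x y] /=; have [[-> ->]|nxy] := eqVneq (x, y) (u, v).
      by rewrite mulr1; have /andP[] := zK u v; split; lra.
    by rewrite mulr0 addr0; exact: (Kz (x, y)).
  by move/(_ KK); nra.
(* The sum of b over S is at most [flow w S - alpha * flow w (~: S)], which the cut condition makes
   nonpositive, although every term is positive. *)
have := net_flow (fun u v => z (u, v)) S.
have : 0 < \sum_(u in S) b u.
  have /set0Pn[x xS] := S0; rewrite (bigD1 x) //= ltr_pwDl //.
    by move: xS; rewrite inE.
  by apply: sumr_ge0 => i /andP[]; rewrite inE => /ltW.
rewrite (eq_bigr b) // => sb0 sbE.
have := cut S S0 ST.
have l1 : flow (fun u v => z (u, v)) S <= flow w S.
  apply: ler_sum => u uS; apply: ler_sum => v; rewrite inE; exact: low.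
have l2 : alpha * flow w (~: S) <= flow (fun u v => z (u, v)) (~: S).
  rewrite mulr_sumr; apply: ler_sum => u; rewrite inE => uS; rewrite mulr_sumr.
  by apply: ler_sum => v; rewrite finset.setCK; exact: high.
lra.
Qed.

End Circulation.

(** * Duality for reweightings *)

Section TransportDuality.
Context {R : realType} {V : finType} (E : rel V) (wt : V -> R).
Hypothesis Erefl : reflexive E.
Hypothesis wt0 : forall v, 0 < wt v.

Definition feasible (a : V -> V -> R) :=
  [/\ forall u v, 0 <= a u v, forall u v, ~~ E u v -> a u v = 0,
      forall u, \sum_v a u v = wt u & forall u, \sum_v a v u = wt u].

Definition pairing (a d : V -> V -> R) : R := \sum_u \sum_v a u v * d u v.

Definition loops u v : R := wt u * (u == v)%:R.

Lemma sum_indicator (f : V -> R) u : \sum_v f v * (v == u)%:R = f u.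
Proof.
rewrite (bigD1 u) //= eqxx mulr1 big1 ?addr0 // => v /negbTE ->.
by rewrite mulr0.
Qed.

Lemma loops_feasible : feasible loops.
Proof.
split=> [u v|u v|u|u]; rewrite /loops.
- by rewrite mulr_ge0 // ltW.
- by have [->|_ _] := eqVneq u v; rewrite ?Erefl ?mulr0.
- under eq_bigr do rewrite eq_sym.
  by rewrite (sum_indicator (fun=> wt u)).
- exact: sum_indicator.
Qed.

(* The potentials are the rescaled marginal residuals of the nonnegative matrix
   which minimises the sum of the squared violations of the unsatisfiable system
   a feasible, pairing a d = M'. *)
Theorem transport_duality (d : V -> V -> R) (M M' : R) :
  (forall u, d u u = 0) -> 0 <= M -> M < M' ->
  (forall a, feasible a -> pairing a d <= M) ->
  exists p q : V -> R,
    (forall u v, E u v -> d u v <= p u + q v) /\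
    \sum_v wt v * (p v + q v) <= M'.
Proof.
move=> d0 M0 MM' bound.
pose P (z : V * V -> R) u := \sum_v z (u, v) - wt u.
pose Q (z : V * V -> R) u := \sum_v z (v, u) - wt u.
pose c (z : V * V -> R) := M' - \sum_p z p * d p.1 p.2.
pose Phi (z : {ptws (V * V) -> R}) : R :=
  \sum_u P z u ^+ 2 + \sum_u Q z u ^+ 2 + c z ^+ 2.
have cPhi : continuous Phi.
  apply: continuous_addf; first apply: continuous_addf.
  - apply: continuous_sumf => u _; apply: continuous_expf.
    apply: continuous_subf; last exact: continuous_cst.
    by apply: continuous_sumf => v _; exact: continuous_coord.
  - apply: continuous_sumf => u _; apply: continuous_expf.
    apply: continuous_subf; last exact: continuous_cst.
    by apply: continuous_sumf => v _; exact: continuous_coord.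
  - apply: continuous_expf; apply: continuous_subf; first exact: continuous_cst.
    apply: continuous_sumf => p _.
    by apply: continuous_mulf; [exact: continuous_coord|exact: continuous_cst].
pose K := [set z : {ptws (V * V) -> R} |
  forall p, 0 <= z p /\ (forall _ : ~~ E p.1 p.2, z p = 0)]%classic.
have cK : closed K.
  apply: closed_forall => p; apply: closedI.
    by apply: closed_nonneg; exact: continuous_coord.
  by apply: closed_forall => _; apply: closed_zero; exact: continuous_coord.
pose z0 : {ptws (V * V) -> R} := fun=> 0.
have Kz0 : K z0 by move=> p; rewrite /z0.
have sq1 (x y : R) : x ^+ 2 <= y -> x <= 1 + y by nra.
have [z Kz zmin] : exists2 z, K z & forall z', K z' -> Phi z <= Phi z'.
  apply: (@coercive_min R (V * V)%type Phi K z0 (\sum_v wt v + 1 + Phi z0)) => //.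
  move=> z Kz zle p; have z1 q : 0 <= z q by have [] := Kz q.
  rewrite ger0_norm //.
  have : P z p.1 ^+ 2 <= Phi z0.
    apply: le_trans zle; rewrite /Phi (bigD1 p.1) //= -!addrA lerDl.
    by rewrite !addr_ge0 ?sqr_ge0 ?sumr_ge0 // => *; exact: sqr_ge0.
  move=> /sq1; rewrite /P; set s := \sum_v z _.
  have : z p <= s.
    by rewrite /s (bigD1 p.2) //= -surjective_pairing lerDl sumr_ge0.
  have : wt p.1 <= \sum_v wt v.
    by rewrite (bigD1 p.1) //= lerDl sumr_ge0 // => v _; exact/ltW.
  lra.
have variation (e : V * V -> R) :
    (forall t, 0 < t -> t <= 1 -> K (fun p => z p + t * e p)) ->
    0 <= \sum_u P z u * (\sum_v e (u, v)) + \sum_u Q z u * (\sum_v e (v, u))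
         - c z * \sum_p e p * d p.1 p.2.
  move=> Ke; apply: (@first_order _ _ (\sum_u (\sum_v e (u, v)) ^+ 2
    + \sum_u (\sum_v e (v, u)) ^+ 2 + (\sum_p e p * d p.1 p.2) ^+ 2)) => t t0 t1.
  have := zmin _ (Ke t t0 t1); rewrite /Phi.
  have -> : c (fun p => z p + t * e p) = c z + t * - \sum_p e p * d p.1 p.2.
    rewrite /c mulrN -addrA -opprD mulr_sumr -big_split; congr (_ - _).
    by apply: eq_bigr => p _ /=; ring.
  have PE u : P (fun p => z p + t * e p) u = P z u + t * \sum_v e (u, v).
    by rewrite /P big_split /= -mulr_sumr; ring.
  have QE u : Q (fun p => z p + t * e p) u = Q z u + t * \sum_v e (v, u).
    by rewrite /Q big_split /= -mulr_sumr; ring.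
  under [X in _ <= X + _ + _]eq_bigr do rewrite PE.
  under [X in _ <= _ + X + _]eq_bigr do rewrite QE.
  rewrite !sum_square_line.
  set A := \sum_u _ * _; set B := \sum_u Q z u * _; set D := \sum_p _ * _.
  set A2 := \sum_j _ ^+ 2; set A3 := \sum_(j : V) (\sum_v _) ^+ 2.
  set A4 := \sum_j Q z j ^+ 2; set A5 := \sum_(j : V) (\sum_v _) ^+ 2.
  by nra.
have pairE (y : V * V -> R) :
    \sum_p y p * d p.1 p.2 = pairing (fun u v => y (u, v)) d.
  rewrite /pairing pair_big /=.
  by apply: eq_bigr => -[u v].
have edge u v : E u v -> c z * d u v <= P z u + Q z v.
  move=> uv; have := @variation (fun p => (p == (u, v))%:R).
  have Kd t : 0 < t -> t <= 1 -> K (fun p => z p + t * (p == (u, v))%:R).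
    move=> t0 _ [x y]; have [z1 z2] := Kz (x, y).
    split; first by rewrite addr_ge0 // mulr_ge0 // ltW.
    have [[-> ->] /=|_ /= xy] := eqVneq (x, y) (u, v); first by rewrite uv.
    by rewrite mulr0 addr0; exact: z2.
  move=> /(_ Kd).
  have rowE x : \sum_y ((x, y) == (u, v))%:R = (x == u)%:R :> R.
    rewrite (bigD1 v) //= xpair_eqE eqxx andbT big1 ?addr0 // => i iv.
    by rewrite xpair_eqE (negbTE iv) andbF.
  have colE x : \sum_y ((y, x) == (u, v))%:R = (x == v)%:R :> R.
    rewrite (bigD1 u) //= xpair_eqE eqxx big1 ?addr0 // => i iv.
    by rewrite xpair_eqE (negbTE iv).
  under eq_bigr do rewrite rowE.
  under [X in _ + X - _]eq_bigr do rewrite colE.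
  rewrite !sum_indicator.
  rewrite (bigD1 (u, v)) //= eqxx mul1r big1 ?addr0 => [|p /negbTE ->].
    by rewrite subr_ge0.
  by rewrite mul0r.
(* Optimality in the direction of the zero matrix. The marginals of z are [P z u + wt u] and
   [Q z u + wt u], so the residuals reappear squared. *)
have scale : \sum_u wt u * (P z u + Q z u) <=
    c z * M' - (\sum_u P z u ^+ 2 + \sum_u Q z u ^+ 2 + c z ^+ 2).
  have := @variation (fun p => - z p).
  have Kd t : 0 < t -> t <= 1 -> K (fun p => z p + t * - z p).
    move=> t0 t1 p; have [z1 z2] := Kz p.
    split=> [|xy]; last by rewrite z2 // oppr0 mulr0 addr0.
    by have -> : z p + t * - z p = (1 - t) * z p by [ring]; rewrite mulr_ge0 // subr_ge0.
  move=> /(_ Kd).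
  have rowE x : \sum_y - z (x, y) = - (P z x + wt x).
    by rewrite sumrN /P subrK.
  have colE x : \sum_y - z (y, x) = - (Q z x + wt x).
    by rewrite sumrN /Q subrK.
  under eq_bigr do rewrite rowE.
  under [X in _ + X - _]eq_bigr do rewrite colE.
  have -> : \sum_p - z p * d p.1 p.2 = c z - M'.
    under eq_bigr do rewrite mulNr.
    by rewrite sumrN /c; ring.
  under eq_bigr do rewrite mulrN mulrDr.
  under [X in _ + X - _]eq_bigr do rewrite mulrN mulrDr.
  under [X in _ -> X <= _]eq_bigr do rewrite mulrDr.
  rewrite !sumrN !big_split /=.
  under [X in - (X + _)]eq_bigr do rewrite -expr2.
  under [X in _ - (X + _) - _]eq_bigr do rewrite -expr2.
  under [X in - (_ + X)]eq_bigr do rewrite mulrC.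
  under [X in _ - (_ + X) - _]eq_bigr do rewrite mulrC.
  lra.
(* Self-loops are edges with [d u u = 0], so [edge] makes each [P z u + Q z u] nonnegative. *)
have PQ0 : 0 <= \sum_u wt u * (P z u + Q z u).
  apply: sumr_ge0 => u _; rewrite mulr_ge0 ?(ltW (wt0 u)) //.
  by have := edge u u (Erefl u); rewrite d0 mulr0.
(* If all residuals vanished, z would be feasible with pairing M' > M. *)
have Phi0 : 0 < \sum_u P z u ^+ 2 + \sum_u Q z u ^+ 2 + c z ^+ 2.
  have s1 : 0 <= \sum_u P z u ^+ 2 by apply: sumr_ge0 => *; exact: sqr_ge0.
  have s2 : 0 <= \sum_u Q z u ^+ 2 by apply: sumr_ge0 => *; exact: sqr_ge0.
  have s3 := sqr_ge0 (c z).
  rewrite lt_neqAle !addr_ge0 // andbT eq_sym; apply/negP.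
  rewrite !paddr_eq0 ?addr_ge0 // => /andP[/andP[]].
  rewrite !psumr_eq0; try by move=> *; exact: sqr_ge0.
  move=> /allP pz /allP qz; rewrite sqrf_eq0 => /eqP cz.
  have za : feasible (fun u v => z (u, v)).
    split=> [u v|u v nuv|u|u].
    - by have [] := Kz (u, v).
    - by have [_] := Kz (u, v); apply.
    - apply/eqP; rewrite -subr_eq0; have := pz u (mem_index_enum u).
      by rewrite sqrf_eq0.
    - apply/eqP; rewrite -subr_eq0; have := qz u (mem_index_enum u).
      by rewrite sqrf_eq0.
  have := bound _ za; rewrite -pairE.
  by move: cz; rewrite /c; lra.
have cz0 : 0 < c z.
  have : 0 < c z * M' by lra.
  by rewrite pmulr_lgt0 //; lra.
exists (fun u => P z u / c z), (fun u => Q z u / c z); split=> [u v uv|].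
  by rewrite -mulrDl ler_pdivlMr // mulrC; exact: edge.
under eq_bigr do rewrite -mulrDl mulrA.
rewrite -mulr_suml ler_pdivrMr // mulrC; lra.
Qed.

End TransportDuality.

(** * An L1 Poincare inequality for vertex expansion *)

Section LayerCake.
Context {R : realType}.

(** The integral of g from t0 to the last point of s, exact when g is constant on each half-open
    interval between consecutive points. *)
Fixpoint step_integral (t0 : R) (s : seq R) (g : R -> R) : R :=
  if s is t1 :: s' then (t1 - t0) * g t0 + step_integral t1 s' g else 0.

Lemma step_integral_ge0 t0 s g :
  path <=%R t0 s -> (forall t, 0 <= g t) -> 0 <= step_integral t0 s g.
Proof.
move=> + g0; elim: s t0 => //= t1 s IH t0 /andP[t01 st].
by rewrite addr_ge0 ?IH // mulr_ge0 // subr_ge0.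
Qed.

Lemma step_integral_sum (J : finType) t0 s (c : J -> R) (g : J -> R -> R) :
  step_integral t0 s (fun t => \sum_j c j * g j t) =
  \sum_j c j * step_integral t0 s (g j).
Proof.
elim: s t0 => [|t1 s IH] t0 /=; first by rewrite big1 // => j _; rewrite mulr0.
by rewrite IH mulr_sumr -big_split; apply: eq_bigr => j _ /=; ring.
Qed.

(** Every end point beyond t0 is a breakpoint, so the indicator is constant on each step; the maxima
    with t0 cut off the part of the interval before t0. *)
Lemma step_integral_interval t0 s x y :
  path <=%R t0 s -> (x <= t0) || (x \in s) -> (y <= t0) || (y \in s) ->
  step_integral t0 s (fun t => (x <= t < y)%R%:R) =
  Num.max 0 (Num.max y t0 - Num.max x t0).
Proof.
elim: s t0 => [|t1 s IH] t0 /=.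
  by rewrite !orbF => _ xt yt; rewrite !max_r // subrr.
move=> /andP[t01 st] xs ys.
have le_t1 z : (z <= t0) || (z \in t1 :: s) -> (z <= t1) || (z \in s).
  move=> /orP[zt|]; first by rewrite (le_trans zt).
  by rewrite inE => /orP[/eqP->|->]; rewrite ?lexx ?orbT.
have ge_t1 z : (z <= t0) || (z \in t1 :: s) -> z <= t0 \/ t1 <= z.
  move=> /orP[|]; first by left.
  rewrite inE => /orP[/eqP->|zs]; first by right.
  by right; move: st; rewrite le_path_sortedE => /andP[/allP] /(_ z zs).
rewrite IH //; [|exact: le_t1|exact: le_t1].
case: (ge_t1 x xs) (ge_t1 y ys) => [xt [yt|yt]|xt [yt|yt]].
- rewrite [t0 < y]ltNge yt andbF mulr0 add0r !max_r //; lra.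
- have [e|ne] := eqVneq t0 y.
    by subst y; rewrite ltxx andbF mulr0 add0r !max_r //; lra.
  have ty : t0 < y by rewrite lt_neqAle ne; lra.
  rewrite xt ty mulr1 (@max_l _ _ y t0) ?(@max_l _ _ y t1) ?(@max_r _ _ x t0) //; try lra.
  by rewrite (@max_r _ _ x t1) ?max_r //; lra.
- rewrite [t0 < y]ltNge yt andbF mulr0 add0r.
  rewrite (@max_r _ _ y t1) ?(@max_r _ _ y t0) ?(@max_l _ _ x t0) ?(@max_l _ _ x t1) //; try lra.
  by rewrite !max_l //; lra.
- rewrite (@max_l _ _ y t1) ?(@max_l _ _ y t0) ?(@max_l _ _ x t0) ?(@max_l _ _ x t1) //; try lra.
  have [e|ne] := eqVneq t0 t1; first by rewrite e subrr mul0r add0r.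
  have -> : (x <= t0) = false.
    by apply/negbTE; rewrite -ltNge (lt_le_trans _ xt) // lt_neqAle ne.
  by rewrite mulr0 add0r.
Qed.

(** Integrate the hypothesis over t, with all end points sorted as breakpoints: each indicator
    becomes the length of its interval. *)
Lemma layer_cake (J : finType) (c a b : J -> R) :
  (forall t, 0 <= \sum_j c j * (a j <= t < b j)%R%:R) ->
  0 <= \sum_j c j * Num.max 0 (b j - a j).
Proof.
move=> H.
pose s := sort <=%R ([seq a j | j <- enum J] ++ [seq b j | j <- enum J]).
have sa j : a j \in s.
  by rewrite mem_sort mem_cat map_f ?mem_enum.
have sb j : b j \in s.
  by rewrite mem_sort mem_cat [X in _ || X]map_f ?mem_enum // orbT.
have ss : sorted <=%R s by apply: sort_sorted; exact: le_total.
case: s ss sa sb => [_ sa _|t0 s pth sa sb].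
  by rewrite big1 // => j; have := sa j.
have mem_ge z : z \in t0 :: s -> t0 <= z.
  rewrite inE => /orP[/eqP-> //|zs].
  by move: pth; rewrite /= le_path_sortedE => /andP[/allP] /(_ z zs).
have key j : step_integral t0 s (fun t => (a j <= t < b j)%R%:R) =
    Num.max 0 (b j - a j).
  have aux z : z \in t0 :: s -> (z <= t0) || (z \in s).
    by rewrite inE => /orP[/eqP->|->]; rewrite ?lexx ?orbT.
  rewrite step_integral_interval ?aux //.
  by rewrite (@max_l _ _ (b j)) ?(@max_l _ _ (a j)) // mem_ge.
under eq_bigr do rewrite -key.
by rewrite -step_integral_sum; apply: step_integral_ge0.
Qed.

End LayerCake.

(** * Level sets, weighted medians and the Poincare inequality *)

Section Poincare.
Context {R : realType} {V : finType} (E : rel V) (wt : V -> R).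
Hypothesis Erefl : reflexive E.
Hypothesis wt0 : forall v, 0 < wt v.
Implicit Types S : {set V}.

Lemma weight_ge0 S : 0 <= weight wt S.
Proof. by apply: sumr_ge0 => v _; exact: ltW. Qed.

Lemma weight_sub S S' : S \subset S' -> weight wt S <= weight wt S'.
Proof.
move=> sub; rewrite /weight [leRHS](big_setID S) /= (finset.setIidPr sub) lerDl.
by apply: sumr_ge0 => v _; exact: ltW.
Qed.

Lemma weight_indicator (P : pred V) :
  weight wt [set v | P v]%SET = \sum_v wt v * (P v)%:R.
Proof.
rewrite /weight big_mkcond; apply: eq_bigr => v _.
by rewrite inE; case: (P v); rewrite ?mulr1 ?mulr0.
Qed.

(** c is the least value of H such that the vertices above it weigh no more than the others. The two
    clauses tell which side of each level is the lighter one. *)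
Lemma weighted_median (H : V -> R) : exists c, forall t,
  (c <= t -> weight wt [set v | t < H v]%SET <= weight wt [set v | H v <= t]%SET) /\
  (t < c -> weight wt [set v | H v <= t]%SET <= weight wt [set v | t < H v]%SET).
Proof.
pose A t := weight wt [set v | t < H v]%SET; pose B t := weight wt [set v | H v <= t]%SET.
have [v0 _|V0] := pickP (@predT V); last first.
  exists 0 => t; rewrite /weight !big1 // => v _; have := V0 v; by [].
have [vM _ vMmax] := @arg_maxP _ _ _ v0 predT H isT.
have PM : A (H vM) <= B (H vM).
  apply: weight_sub; apply/fintype.subsetP => v; rewrite !inE => _.
  exact: vMmax.
have [vm Pm vmin] := @arg_minP _ _ _ vM (fun v => A (H v) <= B (H v)) H PM.
exists (H vm) => t; split=> [ct|tc].
  apply: le_trans (_ : A (H vm) <= _).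
    apply: weight_sub; apply/fintype.subsetP => v; rewrite !inE.
    exact: le_lt_trans.
  apply: le_trans Pm _; apply: weight_sub; apply/fintype.subsetP => v; rewrite !inE => h.
  exact: le_trans ct.
rewrite leNgt; apply/negP => ABt.
have [v1 v1t|none] := pickP (fun v => H v <= t); last first.
  have Be : [set v | H v <= t]%SET = finset.set0.
    by apply/setP => v; rewrite !inE none.
  move: ABt; rewrite Be [X in _ < X]/weight big_set0 ltNge => /negP; apply.
  exact: weight_ge0.
(* The largest value of H not exceeding t defines the same level sets as t, so it would be a
   candidate for the minimum below c. *)
have [v2 v2t v2max] := @arg_maxP _ _ _ v1 (fun v => H v <= t) H v1t.
have BE : [set v | H v <= t]%SET = [set v | H v <= H v2]%SET.
  apply/setP => v; rewrite !inE; apply/idP/idP; first exact: v2max.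
  by move=> h; exact: le_trans h v2t.
have AE : [set v | t < H v]%SET = [set v | H v2 < H v]%SET.
  apply/setP => v; rewrite !inE !ltNge; congr (~~ _).
  by have := congr1 (fun S : {set V} => v \in S) BE; rewrite !inE.
have := vmin v2; rewrite /A /B -BE -AE (ltW ABt) => /(_ isT).
by rewrite leNgt (le_lt_trans v2t tc).
Qed.

(** The out-boundary of the complement is covered by the instance at [~: S], because the left side
    is symmetric in S and [~: S]. *)
Definition expands (psi : R) := forall S,
  psi * Num.min (weight wt S) (weight wt (~: S)) <= weight wt (out_boundary E S).

(* A vertex v lies in the out-boundary of {H > t} only for t in an interval of
   length 2 s v starting at H v. *)
Lemma threshold_poincare (psi : R) (H s : V -> R) :
  expands psi -> (forall v, 0 <= s v) ->
  (forall u v, E u v -> H u <= H v + 2 * s v) ->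
  exists c, psi * (\sum_v wt v * `|H v - c|) <= 2 * \sum_v wt v * s v.
Proof.
move=> ex s0 Hs; have [c med] := weighted_median H; exists c.
pose J := (V + (V + V))%type.
(* Signed intervals for [layer_cake]: those in which v is a boundary vertex, with weight [wt v], and
   those between H v and c, with weight [- psi * wt v]. Of the last two families, one is empty for
   each v. *)
pose k (j : J) := match j with
  | inl v => wt v | inr (inl v) => - psi * wt v | inr (inr v) => - psi * wt v end.
pose a (j : J) := match j with
  | inl v => H v | inr (inl v) => c | inr (inr v) => H v end.
pose b (j : J) := match j with
  | inl v => H v + 2 * s v | inr (inl v) => H v | inr (inr v) => c end.
have := @layer_cake R J k a b.
rewrite !big_sumType /=.
have -> : \sum_i wt i * Num.max 0 (H i + 2 * s i - H i) = 2 * \sum_v wt v * s v.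
  rewrite mulr_sumr; apply: eq_bigr => v _.
  by rewrite (_ : H v + _ - _ = 2 * s v); [rewrite max_r ?mulr_ge0 // mulrCA|ring].
have -> : \sum_i - psi * wt i * Num.max 0 (H i - c)
    + \sum_i - psi * wt i * Num.max 0 (c - H i) =
    - (psi * \sum_v wt v * `|H v - c|).
  rewrite -big_split mulr_sumr -sumrN; apply: eq_bigr => v _ /=.
  have [h|h] := lerP (H v) c.
    by rewrite max_l ?subr_le0 // max_r ?subr_ge0 //; ring.
  by rewrite (@max_r _ _ 0 (H v - c)) ?max_l; [ring|lra|lra].
rewrite subr_ge0; apply=> t; rewrite !big_sumType /=.
set S := [set v | t < H v]%SET.
have SC : ~: S = [set v | H v <= t]%SET.
  by apply/setP => v; rewrite !inE leNgt.
have bd : weight wt (out_boundary E S) <=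
    \sum_v wt v * (H v <= t < H v + 2 * s v)%R%:R.
  rewrite -weight_indicator; apply: weight_sub; apply/fintype.subsetP => v.
  rewrite !inE -leNgt => /andP[-> /existsP[u /andP[]]]; rewrite inE => tu uv.
  by rewrite (lt_le_trans tu) ?Hs.
have := ex S; rewrite SC.
have [m1 m2] := med t.
have [ct|tc] := leP c t.
  rewrite min_l ?m1 //.
  under [X in _ + (X + _)]eq_bigr do rewrite -mulrA.
  rewrite -mulr_sumr -weight_indicator -/S.
  rewrite [X in _ + (_ + X)]big1 => [|v _]; first lra.
  by rewrite andbF mulr0.
rewrite min_r ?m2 //.
rewrite [X in _ + (X + _)]big1 => [|v _]; last by rewrite mulr0.
under [X in _ + (_ + X)]eq_bigr do rewrite andbT -mulrA.
rewrite -mulr_sumr -weight_indicator; lra.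
Qed.

(* For dual potentials p, q put s = (p + q) / 2 and r = (p - q) / 2. Both
   G = F - r - s and G = - F - r - s satisfy the hypothesis of threshold_poincare,
   and their difference is 2 F. *)
Theorem vertex_poincare (psi M M' : R) (F : V -> R) (v : V) :
  0 < psi -> expands psi -> 0 <= M -> M < M' ->
  (forall a, feasible E wt a -> pairing a (fun u v => `|F u - F v|) <= M) ->
  exists v0, psi * (\sum_v wt v * `|F v - F v0|) <= 2 * M'.
Proof.
move=> psi0 ex M0 MM' bound.
have [|p [q [pq pqM]]] := transport_duality Erefl wt0 _ M0 MM' bound.
  by move=> u; rewrite subrr normr0.
pose s u := (p u + q u) / 2; pose r u := (p u - q u) / 2.
have s0 u : 0 <= s u.
  by have := pq u u (Erefl u); rewrite subrr normr0 /s; lra.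
have Gs (G : V -> R) : (forall u v, `|G u - G v| = `|F u - F v|) ->
    exists c, psi * (\sum_v wt v * `|G v - r v - s v - c|) <= 2 * \sum_v wt v * s v.
  move=> GF; apply: threshold_poincare => // u w uw.
  have := pq u w uw; rewrite -GF => /(le_trans (ler_norm _)).
  by rewrite /r /s; lra.
have [c1 h1] := Gs F (fun _ _ => erefl).
have [|c2 h2] := Gs (fun u => - F u).
  by move=> u w; rewrite -normrN; congr (`|_|); ring.
(* The difference of the two functions, shifted by c1 and c2, is 2 F - (c1 - c2). *)
pose c := (c1 - c2) / 2.
have hc : psi * (\sum_v wt v * `|F v - c|) <= M'.
  have -> : M' = (M' + M') / 2 by lra.
  rewrite ler_pdivlMr // -mulrA mulr_suml.
  apply: le_trans (_ : psi * (\sum_v wt v * `|F v - r v - s v - c1| +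
     \sum_v wt v * `|- F v - r v - s v - c2|) <= _).
    rewrite ler_pM2l // -big_split; apply: ler_sum => w _ /=.
    rewrite -mulrA -mulrDr ler_pM2l //.
    have -> : `|F w - c| * 2 = `|(F w - c) * 2| by rewrite normrM (@ger0_norm _ 2).
    apply: le_trans (ler_normB _ _); rewrite le_eqVlt; apply/orP; left.
    by apply/eqP; congr (`|_|); rewrite /c; field.
  rewrite mulrDr; apply: le_trans (lerD h1 h2) _.
  have -> : \sum_v wt v * s v = (\sum_v wt v * (p v + q v)) / 2.
    by rewrite mulr_suml; apply: eq_bigr => w _; rewrite /s mulrA.
  lra.
(* Replacing c by the nearest value of F costs a factor 2. *)
have [v0 _ v0min] := @arg_minP _ _ _ v predT (fun w => `|F w - c|) isT.
exists v0; have -> : 2 * M' = M' + M' by ring.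
apply: le_trans (lerD hc hc); rewrite -mulrDr ler_pM2l // -big_split.
apply: ler_sum => w _ /=; rewrite -mulrDr ler_pM2l //.
have -> : F w - F v0 = (F w - c) - (F v0 - c) by ring.
by apply: le_trans (ler_normB _ _) _; rewrite lerD2l; exact: v0min.
Qed.

End Poincare.

(** * Quadratic forms and eigenvalues of real symmetric matrices *)

Section QuadraticForms.
Context {R : realType}.

Lemma left_kernel_neq0 (m n : nat) (A : 'M[R]_(m, n)) : (n < m)%N ->
  exists2 c : 'rV[R]_m, c != 0 & c *m A = 0.
Proof.
move=> nm; have kn0 : kermx A != 0.
  rewrite kermx_eq0 /row_free neq_ltn; apply/orP; left.
  exact: leq_ltn_trans (rank_leq_col _) nm.
exists (nz_row (kermx A)); first by rewrite nz_row_eq0.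
by apply/sub_kermxP; exact: nz_row_sub.
Qed.

Definition dot n (x y : 'rV[R]_n) : R := \sum_i x 0 i * y 0 i.

Definition quad n (M : 'M[R]_n) (x : 'rV[R]_n) : R := dot (x *m M) x.

Lemma dotE n (x y : 'rV[R]_n) : dot x y = (x *m y^T) 0 0.
Proof. by rewrite mxE; apply: eq_bigr => i _; rewrite mxE. Qed.

Lemma dotC n (x y : 'rV[R]_n) : dot x y = dot y x.
Proof. by apply: eq_bigr => i _; rewrite mulrC. Qed.

Lemma dotDl n (x y z : 'rV[R]_n) : dot (x + y) z = dot x z + dot y z.
Proof. by rewrite /dot -big_split; apply: eq_bigr => i _; rewrite mxE mulrDl. Qed.

Lemma dotZl n c (x y : 'rV[R]_n) : dot (c *: x) y = c * dot x y.
Proof. by rewrite /dot mulr_sumr; apply: eq_bigr => i _; rewrite mxE mulrA. Qed.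

Lemma dotDr n (x y z : 'rV[R]_n) : dot z (x + y) = dot z x + dot z y.
Proof. by rewrite dotC dotDl !(dotC z). Qed.

Lemma dotZr n c (x y : 'rV[R]_n) : dot x (c *: y) = c * dot x y.
Proof. by rewrite dotC dotZl dotC. Qed.

Lemma dot_ge0 n (x : 'rV[R]_n) : 0 <= dot x x.
Proof. by apply: sumr_ge0 => i _; rewrite -expr2 sqr_ge0. Qed.

Lemma dot_eq0 n (x : 'rV[R]_n) : (dot x x == 0) = (x == 0).
Proof.
apply/idP/eqP => [|->]; last first.
  by rewrite /dot big1 // => i _; rewrite mxE mul0r.
rewrite psumr_eq0 => [/allP x0|i _]; last by rewrite -expr2 sqr_ge0.
apply/rowP => i; have := x0 i (mem_index_enum i).
by rewrite mxE mulf_eq0 orbb => /eqP.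
Qed.

Lemma dot_gt0 n (x : 'rV[R]_n) : (0 < dot x x) = (x != 0).
Proof. by rewrite lt_neqAle dot_ge0 andbT eq_sym dot_eq0. Qed.

Lemma dot_mulmx m n (x : 'rV[R]_m) (A : 'M[R]_(m, n)) (y : 'rV[R]_n) :
  dot (x *m A) y = dot x (y *m A^T).
Proof. by rewrite !dotE trmx_mul trmxK mulmxA. Qed.

Lemma quad_line n (M : 'M[R]_n) (x g : 'rV[R]_n) (t : R) : M^T = M ->
  quad M (x + t *: g) = quad M x + 2 * t * dot (x *m M) g + t ^+ 2 * quad M g.
Proof.
move=> sM; rewrite /quad mulmxDl -scalemxAl !(dotDl, dotDr, dotZl, dotZr).
by rewrite (dot_mulmx g) sM (dotC g); ring.
Qed.

(* The new eigenvector minimises the Rayleigh quotient on the orthogonal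
   complement of the rows of P. *)
Lemma extend_eigenbasis n j (M : 'M[R]_n) (P : 'M[R]_(j, n)) (d : 'rV[R]_j) :
  M^T = M -> (j < n)%N -> P *m P^T = 1%:M -> P *m M = diag_mx d *m P ->
  exists x : 'rV[R]_n, exists c : R,
    [/\ dot x x = 1, x *m P^T = 0 & x *m M = c *: x].
Proof.
move=> sM jn PP PM.
pose toR (z : {ptws 'I_n -> R}) : 'rV[R]_n := \row_i z i.
pose q (z : {ptws 'I_n -> R}) := \sum_i (\sum_k z k * M k i) * z i.
have qE z : q z = quad M (toR z).
  rewrite /quad /dot; apply: eq_bigr => i _; rewrite !mxE; congr (_ * _).
  by apply: eq_bigr => k _; rewrite mxE.
pose K := [set z : {ptws 'I_n -> R} | \sum_i z i ^+ 2 - 1 = 0 /\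
  forall l, \sum_i z i * P l i = 0]%classic.
have KE z : K z <-> dot (toR z) (toR z) = 1 /\ toR z *m P^T = 0.
  have -> : dot (toR z) (toR z) = \sum_i z i ^+ 2.
    by apply: eq_bigr => i _; rewrite mxE expr2.
  split=> [[/eqP]|[zz zP]].
    rewrite subr_eq0 => /eqP -> zP; split => //; apply/rowP => l.
    by rewrite mxE [RHS]mxE -[RHS](zP l); apply: eq_bigr => i _; rewrite !mxE.
  split=> [|l]; first by rewrite zz subrr.
  have /rowP/(_ l) := zP; rewrite mxE [RHS]mxE => h; rewrite -[RHS]h.
  by apply: eq_bigr => i _; rewrite !mxE.
have cK : closed K.
  apply: closedI.
    apply: closed_zero; apply: continuous_subf; last exact: continuous_cst.
    apply: continuous_sumf => i _; apply: continuous_expf.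
    exact: continuous_coord.
  apply: closed_forall => l; apply: closed_zero; apply: continuous_sumf => i _.
  by apply: continuous_mulf; [exact: continuous_coord|exact: continuous_cst].
have cq : continuous q.
  apply: continuous_sumf => i _; apply: continuous_mulf; last exact: continuous_coord.
  apply: continuous_sumf => k _.
  by apply: continuous_mulf; [exact: continuous_coord|exact: continuous_cst].
have toRK (x : 'rV[R]_n) : toR (fun i => x 0 i) = x.
  by apply/rowP => i; rewrite mxE.
have normalise (x : 'rV[R]_n) : x != 0 ->
    dot ((Num.sqrt (dot x x))^-1 *: x) ((Num.sqrt (dot x x))^-1 *: x) = 1.
  move=> x0; rewrite dotZl dotZr mulrA -invfM -expr2 sqr_sqrtr ?dot_ge0 //.
  by rewrite mulVf // dot_eq0.
have [x0 x0n x0P] := @left_kernel_neq0 _ _ P^T jn.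
pose z0 : {ptws 'I_n -> R} := fun i => ((Num.sqrt (dot x0 x0))^-1 *: x0) 0 i.
have Kz0 : K z0.
  by apply/KE; rewrite /z0 toRK normalise // -scalemxAl x0P scaler0.
have [z Kz zmin] : exists2 z, K z & forall z', K z' -> q z <= q z'.
  apply: (@coercive_min R 'I_n q K z0 1) => // z [/eqP + _] _ i.
  rewrite subr_eq0 => /eqP z1.
  have : z i ^+ 2 <= 1.
    rewrite -z1 (bigD1 i) //= lerDl sumr_ge0 // => *; exact: sqr_ge0.
  by rewrite -real_normK ?num_real // expr_le1.
set x := toR z; have [xx xP] : dot x x = 1 /\ x *m P^T = 0 by apply/KE.
exists x, (q z); split => //.
have low y : y *m P^T = 0 -> q z * dot y y <= quad M y.
  move=> yP; have [->|y0] := eqVneq y 0.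
    by rewrite /quad mul0mx /dot !big1 ?mulr0 // => i _; rewrite mxE mul0r.
  have yy : 0 < dot y y by rewrite dot_gt0.
  pose y' := (Num.sqrt (dot y y))^-1 *: y.
  have := zmin (fun i => y' 0 i); rewrite (qE (fun i => y' 0 i)) toRK.
  have Ky : K (fun i => y' 0 i).
    by apply/KE; rewrite toRK /y' normalise // -scalemxAl yP scaler0.
  move=> /(_ Ky); rewrite [quad M y']/quad /y' -scalemxAl dotZl dotZr.
  rewrite mulrA -invfM -expr2 sqr_sqrtr ?dot_ge0 // mulrC ler_pdivlMr //.
(* The residual g is orthogonal to the rows of P, and moving x along -g would lower the Rayleigh
   quotient to first order unless g = 0. *)
have [g gE] : exists g, g = x *m M - q z *: x by exists (x *m M - q z *: x).
have xMP : x *m M *m P^T = 0.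
  by rewrite -mulmxA -{1}sM -trmx_mul PM trmx_mul mulmxA xP mul0mx.
have gP : g *m P^T = 0 by rewrite gE mulmxBl -scalemxAl xMP xP scaler0 subrr.
suff /eqP : dot g g == 0 by move/eqP; rewrite dot_eq0 gE subr_eq0 => /eqP.
rewrite eq_le dot_ge0 andbT -oppr_ge0.
apply: (@first_order _ _ (quad M g - q z * dot g g)) => t _ _.
have := low (x + (- t) *: g); rewrite mulmxDl xP -scalemxAl gP scaler0 addr0 => /(_ erefl).
rewrite quad_line // -qE !(dotDl, dotDr, dotZl, dotZr). rewrite (dotC g x) xx.
have -> : dot g g = dot (x *m M) g - q z * dot x g.
  by rewrite {1}gE dotDl -scaleNr dotZl; ring.
lra.
Qed.

Lemma eigenbasis n j (M : 'M[R]_n) : M^T = M -> (j <= n)%N ->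
  exists (P : 'M[R]_(j, n)) (d : 'rV[R]_j),
    P *m P^T = 1%:M /\ P *m M = diag_mx d *m P.
Proof.
move=> sM; elim: j => [|j IH] jn.
  by exists 0, 0; split; apply/matrixP => -[].
have [P [d [PP PM]]] := IH (ltnW jn).
have [x [c [xx xP xM]]] := extend_eigenbasis sM jn PP PM.
rewrite -addn1; exists (col_mx P x), (row_mx d (const_mx c)); split.
  rewrite tr_col_mx mul_col_row PP xP scalar_mx_block.
  have -> : P *m x^T = 0 by rewrite -(trmxK P) -trmx_mul xP trmx0.
  congr block_mx; by rewrite [LHS]mx11_scalar -dotE xx.
rewrite mul_col_mx PM xM diag_mx_row mul_block_col !mul0mx addr0 add0r.
by rewrite diag_const_mx mul_scalar_mx.
Qed.

Theorem spectral_theorem n (M : 'M[R]_n) : M^T = M ->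
  exists (P : 'M[R]_n) (d : 'rV[R]_n),
    P *m P^T = 1%:M /\ M = P^T *m diag_mx d *m P.
Proof.
move=> sM; have [P [d [PP PM]]] := eigenbasis sM (leqnn n).
by exists P, d; split => //; rewrite -mulmxA -PM mulmxA (mulmx1C PP) mul1mx.
Qed.

Lemma quad_diag n (P : 'M[R]_n) (d y : 'rV[R]_n) : P *m P^T = 1%:M ->
  quad (P^T *m diag_mx d *m P) (y *m P) = \sum_i d 0 i * y 0 i ^+ 2.
Proof.
move=> PP; rewrite /quad !mulmxA -(mulmxA y) PP mulmx1 dot_mulmx -mulmxA PP mulmx1.
rewrite /dot; apply: eq_bigr => i _.
by rewrite mul_mx_diag mxE mulrAC -expr2 mulrC.
Qed.

Lemma dot_orthogonal n (P : 'M[R]_n) (y : 'rV[R]_n) : P *m P^T = 1%:M ->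
  dot (y *m P) (y *m P) = \sum_i y 0 i ^+ 2.
Proof.
move=> PP; rewrite dot_mulmx -mulmxA PP mulmx1.
by apply: eq_bigr => i _; rewrite expr2.
Qed.

(** Take square roots of the eigenvalues, which are nonnegative by testing the form on the
    eigenvectors. *)
Lemma psd_gram n (M : 'M[R]_n) : M^T = M -> (forall x, 0 <= quad M x) ->
  exists G : 'M[R]_n, M = G^T *m G.
Proof.
move=> sM psd; have [P [d [PP ME]]] := spectral_theorem sM.
have d0 i : 0 <= d 0 i.
  have := psd (delta_mx 0 i *m P); rewrite ME quad_diag //.
  rewrite (bigD1 i) //= big1 => [|j ij]; last first.
    by rewrite mxE (negbTE ij) andbF expr0n mulr0.
  by rewrite mxE !eqxx expr1n mulr1 addr0.
exists (diag_mx (\row_i Num.sqrt (d 0 i)) *m P).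
rewrite trmx_mul tr_diag_mx mulmxA -(mulmxA P^T) mulmx_diag ME.
congr (_ *m diag_mx _ *m _); apply/rowP => i.
by rewrite !mxE -expr2 sqr_sqrtr.
Qed.

(** Conjugation by the orthogonal P preserves the characteristic polynomial, and unique
    factorisation identifies the roots chosen by [xget] with the entries of d up to order. *)
Lemma eigenvalues_spectral n (M P : 'M[R]_n) (d : 'rV[R]_n) :
  P *m P^T = 1%:M -> M = P^T *m diag_mx d *m P ->
  sorted <=%R (eigenvalues M) /\
  perm_eq (eigenvalues M) [seq d 0 i | i <- enum 'I_n].
Proof.
move=> PP ME.
have cp : char_poly M = \prod_(a <- [seq d 0 i | i <- enum 'I_n]) ('X - a%:P).
  have -> : char_poly M = char_poly (diag_mx d).
    rewrite /char_poly /char_poly_mx ME !map_mxM.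
    have PPX : map_mx polyC P^T *m map_mx polyC P = 1%:M :> 'M[{poly R}]_n.
      by rewrite -map_mxM (mulmx1C PP) map_mx1.
    have XE : 'X%:M = map_mx polyC P^T *m 'X%:M *m map_mx polyC P :> 'M[{poly R}]_n.
      by rewrite scalar_mxC -mulmxA PPX mulmx1.
    rewrite [X in \det (X - _) = _]XE.
    rewrite -mulmxBl -mulmxBr !det_mulmx mulrAC -det_mulmx PPX det1 mul1r.
    by [].
  rewrite char_poly_trig; last first.
    by apply/is_trig_mxP => i j ij; rewrite mxE -val_eqE /= ltn_eqF // mulr0n.
  rewrite big_map big_enum /=; apply: eq_bigr => i _.
  by rewrite mxE eqxx mulr1n.
have [ss se] : sorted <=%R (eigenvalues M) /\
    char_poly M = \prod_(a <- eigenvalues M) ('X - a%:P).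
  apply: (@xgetPex _ [::] (fun s : seq R => sorted <=%R s /\
    char_poly M = \prod_(a <- s) ('X - a%:P))).
  exists (sort <=%R [seq d 0 i | i <- enum 'I_n]); split.
    by apply: sort_sorted; exact: le_total.
  by rewrite cp; apply/esym/perm_big; rewrite perm_sort.
by split => //; apply: prod_XsubC_eq; rewrite -se.
Qed.

Lemma sorted_nth_le (s : seq R) k (theta : R) : sorted <=%R s ->
  (0 < k <= count (<= theta) s)%N -> s`_k.-1 <= theta.
Proof.
move=> ss /andP[k0 kc]; rewrite leNgt; apply/negP => thk.
have ks : (k.-1 < size s)%N.
  by rewrite (leq_trans _ (count_size (<= theta) s)) // prednK.
move: kc; rewrite -(cat_take_drop k.-1 s) count_cat.
have -> : count (<= theta) (drop k.-1 s) = 0%N.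
  apply/eqP; rewrite -leqn0 leqNgt -has_count; apply/hasP => -[y].
  move=> /(nthP 0)[i]; rewrite size_drop nth_drop => ilt <- /=.
  apply/negP; rewrite -ltNge (lt_le_trans thk) //.
  apply: (sorted_leq_nth le_trans lexx) => //; rewrite ?inE ?leq_addr //.
  by rewrite -ltn_subRL.
rewrite addn0 => h; have := leq_trans h (count_size _ _).
by rewrite size_take ks -ltnS prednK // ltnn.
Qed.

Lemma sorted_nth_ge (s : seq R) k (theta : R) : sorted <=%R s ->
  (count (< theta) s < k <= size s)%N -> theta <= s`_k.-1.
Proof.
move=> ss /andP[ck ks]; rewrite leNgt; apply/negP => thk.
have k0 : (0 < k)%N by exact: leq_ltn_trans ck.
move: ck; rewrite ltnNge => /negP; apply.
rewrite -(cat_take_drop k s) count_cat.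
apply: leq_trans (leq_addr _ _).
have /eqP -> : count (< theta) (take k s) == size (take k s).
  rewrite -all_count; apply/allP => y /(nthP 0)[i].
  rewrite size_takel // => ik; rewrite nth_take // => <- /=.
  apply: le_lt_trans thk; apply: (sorted_leq_nth le_trans lexx) => //.
  - by rewrite inE (leq_trans ik).
  - by rewrite inE prednK.
  - by rewrite -ltnS prednK.
by rewrite size_takel.
Qed.

Lemma kth_eigenvalue_mono n (M : 'M[R]_n) i j : M^T = M ->
  (i <= j <= n)%N -> kth_eigenvalue i M <= kth_eigenvalue j M.
Proof.
move=> sM /andP[ij jn]; have [P [d [PP ME]]] := spectral_theorem sM.
have [ss /perm_size] := eigenvalues_spectral PP ME.
rewrite size_map size_enum_ord => sz.
have [j0|j0] := posnP j.
  by move: ij; rewrite j0 leqn0 => /eqP ->.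
have j1 : (j.-1 < size (eigenvalues M))%N by rewrite sz prednK.
apply: (sorted_leq_nth le_trans lexx) => //; rewrite ?inE //.
  by rewrite (leq_ltn_trans _ j1) // -!subn1 leq_sub2r.
by rewrite -!subn1 leq_sub2r.
Qed.

Lemma count_entries n (d : 'rV[R]_n) (a : pred R) :
  count a [seq d 0 i | i <- enum 'I_n] = #|[pred i | a (d 0 i)]|.
Proof. by rewrite count_map -size_filter cardE enumT. Qed.

(** One half of Courant-Fischer: were fewer than k eigenvalues at most theta, some nonzero
    combination of the rows of W would be orthogonal to their eigenvectors and have Rayleigh
    quotient above theta. *)
Lemma kth_eigenvalue_le n (M : 'M[R]_n) k (W : 'M[R]_(k, n)) (theta : R) :
  M^T = M -> (0 < k)%N ->
  (forall c : 'rV_k, c != 0 -> c *m W != 0 /\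
    quad M (c *m W) <= theta * dot (c *m W) (c *m W)) ->
  kth_eigenvalue k M <= theta.
Proof.
move=> sM k0 H; have [P [d [PP ME]]] := spectral_theorem sM.
have [ss pe] := eigenvalues_spectral PP ME.
apply: sorted_nth_le => //; rewrite k0 /= (permP pe) count_entries.
set B := [pred i | _].
rewrite leqNgt; apply/negP => Bk.
pose A : 'M[R]_(k, #|B|) := \matrix_(i, j) (W *m P^T) i (enum_val j).
have [c c0 cA] := left_kernel_neq0 A Bk.
have [cW0 cq] := H c c0.
pose y := c *m W *m P^T.
have yP : y *m P = c *m W by rewrite -mulmxA (mulmx1C PP) mulmx1.
have yB i : i \in B -> y 0 i = 0.
  move=> iB; have /rowP/(_ (enum_rank_in iB i)) := cA.
  rewrite mxE [RHS]mxE => h; rewrite -[RHS]h /y -mulmxA mxE.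
  by apply: eq_bigr => l _; rewrite [A _ _]mxE enum_rankK_in.
move: cq; rewrite -yP ME quad_diag // dot_orthogonal // leNgt => /negP; apply.
have [i yi] : exists i, y 0 i != 0.
  apply/existsP; apply: contraNT cW0; rewrite negb_exists => /forallP y0.
  rewrite -yP (_ : y = 0) ?mul0mx //; apply/rowP => i; rewrite [RHS]mxE.
  by have := y0 i; rewrite negbK => /eqP.
have far j : y 0 j != 0 -> theta < d 0 j.
  by apply: contraNT; rewrite -leNgt => dj; rewrite yB.
rewrite mulr_sumr (bigD1 i) //= [ltRHS](bigD1 i) //=.
apply: ltr_leD; first by rewrite ltr_pM2r ?far // exprn_even_gt0.
apply: ler_sum => j _; have [->|yj] := eqVneq (y 0 j) 0.
  by rewrite expr0n !mulr0.
by rewrite ler_wpM2r ?sqr_ge0 // ltW ?far.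
Qed.

(** Were two eigenvalues below theta, the plane spanned by their eigenvectors would contain a
    nonzero vector orthogonal to w. *)
Lemma second_eigenvalue_ge n (M : 'M[R]_n) (w : 'rV[R]_n) (theta : R) :
  M^T = M -> (1 < n)%N ->
  (forall x : 'rV_n, dot x w = 0 -> theta * dot x x <= quad M x) ->
  theta <= kth_eigenvalue 2 M.
Proof.
move=> sM n1 H; have [P [d [PP ME]]] := spectral_theorem sM.
have [ss pe] := eigenvalues_spectral PP ME.
have sz := perm_size pe; rewrite size_map size_enum_ord in sz.
apply: sorted_nth_ge => //; rewrite sz n1 andbT (permP pe) count_entries.
set B := [pred i | _].
rewrite ltnS leqNgt; apply/negP => /card_gt1P[i [j [iB jB ij]]].
pose a := dot (delta_mx 0 i *m P) w; pose b := dot (delta_mx 0 j *m P) w.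
(* Coefficients of such a vector; if a and b both vanish, the whole plane is orthogonal to w. *)
pose e := if (a == 0) && (b == 0) then (1, 0) else (b, - a).
have eab : e.1 * a + e.2 * b = 0.
  rewrite /e; case: ifP => [/andP[/eqP-> /eqP->]|_] /=; first by rewrite !mulr0 addr0.
  by ring.
have e0 : 0 < e.1 ^+ 2 + e.2 ^+ 2.
  rewrite /e; case: ifP => [_|/negbT] /=; first by rewrite expr1n expr0n addr0.
  rewrite negb_and sqrrN => /orP[a0|b0].
    by rewrite ltr_wpDl ?sqr_ge0 // exprn_even_gt0.
  by rewrite ltr_pwDl ?sqr_ge0 // exprn_even_gt0.
pose y : 'rV[R]_n := e.1 *: delta_mx 0 i + e.2 *: delta_mx 0 j.
have yw : dot (y *m P) w = 0.
  by rewrite mulmxDl -!scalemxAl dotDl !dotZl.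
have yE l : y 0 l = e.1 * (l == i)%:R + e.2 * (l == j)%:R by rewrite !mxE eqxx.
have ji : j != i by rewrite eq_sym.
have sumE (f : 'I_n -> R) : \sum_l f l * y 0 l ^+ 2 = f i * e.1 ^+ 2 + f j * e.2 ^+ 2.
  rewrite (bigD1 i) //= (bigD1 j) //= !yE !eqxx (negbTE ij) (negbTE ji).
  rewrite big1 ?addr0 => [|l /andP[li lj]]; last first.
    by rewrite yE (negbTE li) (negbTE lj) !mulr0 addr0 expr0n mulr0.
  by rewrite !mulr0 !mulr1 addr0 add0r.
have := H _ yw; rewrite ME quad_diag // dot_orthogonal // sumE.
have := sumE (fun=> 1); under eq_bigr do rewrite mul1r.
move=> ->; rewrite !mul1r.
have di : d 0 i < theta by move: iB; rewrite inE.
have dj : d 0 j < theta by move: jB; rewrite inE.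
move: e0 (sqr_ge0 e.1) (sqr_ge0 e.2).
move: (e.1 ^+ 2) (e.2 ^+ 2) => A A2 AB A0 B0.
have h1 : 0 <= (theta - d 0 i) * A by rewrite mulr_ge0 // subr_ge0 ltW.
have h2 : 0 <= (theta - d 0 j) * A2 by rewrite mulr_ge0 // subr_ge0 ltW.
have [A1|A1] := ltP 0 A.
  have : 0 < (theta - d 0 i) * A by rewrite mulr_gt0 // subr_gt0.
  lra.
have : 0 < (theta - d 0 j) * A2 by rewrite mulr_gt0 ?subr_gt0 //; lra.
lra.
Qed.

End QuadraticForms.

(** * Eigenvalues of reweighted Laplacians *)

Section ReweightedLaplacian.
Context {R : realType} {V : finType} (E : rel V) (wt : V -> R).
Hypothesis Erefl : reflexive E.
Hypothesis wt0 : forall v, 0 < wt v.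
Implicit Types (a : V -> V -> R) (x y : V -> R) (A : 'M[R]_#|V|).

Definition energy a x : R := 2^-1 * \sum_u \sum_v a u v * (x u - x v) ^+ 2.

Definition sqnorm x : R := \sum_v wt v * x v ^+ 2.

Definition mx_fun A u v := A (enum_rank u) (enum_rank v).

Definition fun_mx a : 'M[R]_#|V| := \matrix_(i, j) a (enum_val i) (enum_val j).

Lemma fun_mxK a u v : mx_fun (fun_mx a) u v = a u v.
Proof. by rewrite /mx_fun mxE !enum_rankK. Qed.

Lemma mx_funE A i j : mx_fun A (enum_val i) (enum_val j) = A i j.
Proof. by rewrite /mx_fun !enum_valK. Qed.

Lemma reweighting_feasible A : reweighting E wt A -> feasible E wt (mx_fun A).
Proof. by case=> A0 AE Ar Ac; split => // u v; exact: A0. Qed.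

Lemma feasible_reweighting a : feasible E wt a -> reweighting E wt (fun_mx a).
Proof.
case=> a0 aE ar ac; split=> [i j|u v uv|u|u].
- by rewrite mxE.
- by rewrite -/(mx_fun _ _ _) fun_mxK aE.
- by rewrite -(ar u); apply: eq_bigr => v _; rewrite -/(mx_fun _ _ _) fun_mxK.
- by rewrite -(ac u); apply: eq_bigr => v _; rewrite -/(mx_fun _ _ _) fun_mxK.
Qed.

Lemma energy_feasible a x : feasible E wt a ->
  energy a x = sqnorm x - \sum_u \sum_v a u v * (x u * x v).
Proof.
case=> a0 aE ar ac.
have e1 : \sum_u \sum_v a u v * x u ^+ 2 = sqnorm x.
  by apply: eq_bigr => u _; rewrite -mulr_suml ar.
have e2 : \sum_u \sum_v a u v * x v ^+ 2 = sqnorm x.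
  by rewrite exchange_big; apply: eq_bigr => u _; rewrite -mulr_suml ac.
have -> : energy a x = 2^-1 * (\sum_u \sum_v a u v * x u ^+ 2 +
    \sum_u \sum_v a u v * x v ^+ 2 - 2 * \sum_u \sum_v a u v * (x u * x v)).
  congr (_ * _); rewrite mulr_sumr -big_split -sumrB; apply: eq_bigr => u _ /=.
  rewrite mulr_sumr -big_split -sumrB; apply: eq_bigr => v _ /=; ring.
by rewrite e1 e2; field.
Qed.

Lemma energy_ge0 a x : (forall u v, 0 <= a u v) -> 0 <= energy a x.
Proof.
move=> a0; rewrite mulr_ge0 ?invr_ge0 // sumr_ge0 // => u _.
by rewrite sumr_ge0 // => v _; rewrite mulr_ge0 // sqr_ge0.
Qed.

Lemma energy_le2 a x : feasible E wt a -> energy a x <= 2 * sqnorm x.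
Proof.
case=> a0 aE ar ac.
have e1 : \sum_u \sum_v a u v * x u ^+ 2 = sqnorm x.
  by apply: eq_bigr => u _; rewrite -mulr_suml ar.
have e2 : \sum_u \sum_v a u v * x v ^+ 2 = sqnorm x.
  by rewrite exchange_big; apply: eq_bigr => u _; rewrite -mulr_suml ac.
have -> : 2 * sqnorm x = 2^-1 * (2 * (\sum_u \sum_v a u v * x u ^+ 2 +
    \sum_u \sum_v a u v * x v ^+ 2)) by rewrite e1 e2; field.
rewrite ler_pM2l ?invr_gt0 // -big_split mulr_sumr; apply: ler_sum => u _ /=.
rewrite -big_split mulr_sumr; apply: ler_sum => v _ /=.
rewrite -mulrDr [leRHS]mulrCA ler_wpM2l //.
have := sqr_ge0 (x u + x v); nra.
Qed.

(** The substitution y = Pi^(1/2) x, which turns the form of the normalized Laplacian into [energy]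
    and the Euclidean squared norm into [sqnorm]. *)
Definition weighted_vec x : 'rV[R]_#|V| :=
  \row_i (Num.sqrt (wt (enum_val i)) * x (enum_val i)).

Lemma sum_enum_val (f : V -> R) : \sum_(i < #|V|) f (enum_val i) = \sum_v f v.
Proof. by rewrite -(big_enum_val f). Qed.

Lemma dot_weighted_vec x y :
  dot (weighted_vec x) (weighted_vec y) = \sum_v wt v * (x v * y v).
Proof.
rewrite -sum_enum_val; apply: eq_bigr => i _.
by rewrite !mxE mulrACA -expr2 sqr_sqrtr // ltW.
Qed.

Lemma sqrt_wt_neq0 v : Num.sqrt (wt v) != 0.
Proof. by rewrite gt_eqF // sqrtr_gt0. Qed.

Lemma weighted_vecP (y : 'rV[R]_#|V|) : exists x, y = weighted_vec x.
Proof.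
exists (fun v => y 0 (enum_rank v) / Num.sqrt (wt v)); apply/rowP => i.
by rewrite mxE enum_valK mulrC divfK // sqrt_wt_neq0.
Qed.

Lemma normalized_laplacian_sym A :
  (normalized_laplacian wt A)^T = normalized_laplacian wt A.
Proof.
rewrite /normalized_laplacian linearB /= trmx1; congr (_ - _).
rewrite !trmx_mul tr_diag_mx linearZ /= linearD /= trmxK -mulmxA.
by rewrite (addrC A^T).
Qed.

Lemma quad_normalized_laplacian A x : feasible E wt (mx_fun A) ->
  quad (normalized_laplacian wt A) (weighted_vec x) = energy (mx_fun A) x.
Proof.
move=> fA; rewrite energy_feasible // /quad /normalized_laplacian mulmxBr mulmx1.
rewrite -scaleN1r dotDl dotZl mulN1r; congr (_ - _).
  by rewrite dot_weighted_vec; apply: eq_bigr => v _; rewrite expr2.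
rewrite !mulmxA dot_mulmx tr_diag_mx.
have -> : weighted_vec x *m inv_sqrt_weight_mx wt = \row_i x (enum_val i).
  apply/rowP => i; rewrite mul_mx_diag !mxE mulrAC mulfV ?mul1r //.
  exact: sqrt_wt_neq0.
rewrite -scalemxAr dotZl mulmxDr dotDl [X in _ * (_ + X)]dot_mulmx trmxK.
rewrite [X in _ * (_ + X)]dotC.
have -> : dot (\row_i x (enum_val i) *m A) (\row_i x (enum_val i)) =
    \sum_u \sum_v mx_fun A u v * (x u * x v).
  rewrite exchange_big -sum_enum_val; apply: eq_bigr => i _ /=.
  rewrite -sum_enum_val !mxE mulr_suml; apply: eq_bigr => j _.
  by rewrite mxE mx_funE; ring.
by field.
Qed.

(** The functions h i span the test space for [kth_eigenvalue_le]; being orthogonal of equal squared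
    norm C, they give a combination the squared norm C sum c_i^2. *)
Lemma kth_laplacian_le A k (h : 'I_k -> V -> R) (C theta : R) :
  feasible E wt (mx_fun A) -> (0 < k)%N -> 0 < C ->
  (forall i j, \sum_v wt v * (h i v * h j v) = C * (i == j)%:R) ->
  (forall c : 'I_k -> R, energy (mx_fun A) (fun v => \sum_i c i * h i v) <=
    theta * (C * \sum_i c i ^+ 2)) ->
  kth_eigenvalue k (normalized_laplacian wt A) <= theta.
Proof.
move=> fA k0 C0 ortho H.
apply: (@kth_eigenvalue_le _ _ _ _ (\matrix_i weighted_vec (h i))) => //.
  exact: normalized_laplacian_sym.
move=> c c0; pose f v := \sum_i c 0 i * h i v.
have -> : c *m (\matrix_i weighted_vec (h i)) = weighted_vec f.
  apply/rowP => j; rewrite !mxE mulr_sumr; apply: eq_bigr => i _.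
  by rewrite !mxE mulrCA.
have normE : dot (weighted_vec f) (weighted_vec f) = C * \sum_i c 0 i ^+ 2.
  rewrite dot_weighted_vec mulr_sumr.
  transitivity (\sum_i \sum_j c 0 i * c 0 j * (C * (i == j)%:R)).
    under [RHS]eq_bigr do under eq_bigr do rewrite -ortho mulr_sumr.
    under [RHS]eq_bigr do rewrite exchange_big.
    rewrite [RHS]exchange_big; apply: eq_bigr => v _ /=.
    rewrite /f mulr_suml mulr_sumr; apply: eq_bigr => i _.
    by rewrite !mulr_sumr; apply: eq_bigr => j _; ring.
  apply: eq_bigr => i _; rewrite (bigD1 i) //= eqxx big1 ?addr0 => [|j ji].
    by rewrite mulr1 mulrC expr2.
  by rewrite eq_sym (negbTE ji) !mulr0.
split; last by rewrite quad_normalized_laplacian // normE; exact: H.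
rewrite -dot_gt0 normE mulr_gt0 // lt_neqAle sumr_ge0 ?andbT => [|i _].
  rewrite eq_sym; apply: contra c0; rewrite psumr_eq0 => [/allP c1|i _].
    apply/eqP/rowP => i; rewrite mxE; apply/eqP; rewrite -sqrf_eq0.
    exact: c1 (mem_index_enum i).
  exact: sqr_ge0.
exact: sqr_ge0.
Qed.

Lemma second_laplacian_ge A (theta : R) :
  feasible E wt (mx_fun A) -> (1 < #|V|)%N ->
  (forall x, \sum_v wt v * x v = 0 -> theta * sqnorm x <= energy (mx_fun A) x) ->
  theta <= kth_eigenvalue 2 (normalized_laplacian wt A).
Proof.
move=> fA n1 H.
apply: (@second_eigenvalue_ge _ _ _ (weighted_vec (fun=> 1))) => //.
  exact: normalized_laplacian_sym.
move=> y; have [x ->] := weighted_vecP y; rewrite dot_weighted_vec => x1.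
rewrite quad_normalized_laplacian // dot_weighted_vec.
have -> : \sum_v wt v * (x v * x v) = sqnorm x.
  by apply: eq_bigr => v _; rewrite expr2.
by apply: H; rewrite -[RHS]x1; apply: eq_bigr => v _; rewrite mulr1.
Qed.

(** Provides the upper bound that makes the supremum in [reweighted_eigenvalue] meaningful. The test
    functions are normalized indicators of k vertices. *)
Lemma kth_laplacian_le2 A k : feasible E wt (mx_fun A) -> (0 < k <= #|V|)%N ->
  kth_eigenvalue k (normalized_laplacian wt A) <= 2.
Proof.
move=> fA /andP[k0 kn]; pose e (i : 'I_k) : V := enum_val (widen_ord kn i).
have eI i j : (e i == e j) = (i == j).
  by rewrite (inj_eq enum_val_inj) -!val_eqE.
pose h (i : 'I_k) v : R := (v == e i)%:R / Num.sqrt (wt v).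
have ortho i j : \sum_v wt v * (h i v * h j v) = 1 * (i == j)%:R.
  rewrite mul1r (bigD1 (e i)) //= big1 => [|v vi]; last first.
    by rewrite /h (negbTE vi) !mul0r mulr0.
  rewrite addr0 /h eqxx mul1r eI -[X in X * _](sqr_sqrtr (ltW (wt0 (e i)))).
  by field; exact: sqrt_wt_neq0.
apply: (kth_laplacian_le fA k0 ltr01 ortho) => c.
apply: le_trans (energy_le2 _ fA) _; rewrite ler_pM2l // mul1r.
rewrite le_eqVlt; apply/orP; left; apply/eqP.
transitivity (\sum_i \sum_j c i * c j * (1 * (i == j)%:R)).
  under [RHS]eq_bigr do under eq_bigr do rewrite -ortho mulr_sumr.
  under [RHS]eq_bigr do rewrite exchange_big.
  rewrite [RHS]exchange_big; apply: eq_bigr => v _ /=.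
  rewrite expr2 mulr_suml mulr_sumr; apply: eq_bigr => i _.
  by rewrite !mulr_sumr; apply: eq_bigr => j _; ring.
apply: eq_bigr => i _; rewrite (bigD1 i) //= eqxx big1 ?addr0 => [|j ji].
  by rewrite !mulr1 expr2.
by rewrite eq_sym (negbTE ji) !mulr0.
Qed.

Definition laplacian_eigenvalues k : set R :=
  [set kth_eigenvalue k (normalized_laplacian wt A) | A in reweighting E wt]%classic.

Lemma laplacian_eigenvalues_neq0 k : (laplacian_eigenvalues k !=set0)%classic.
Proof.
eexists; exists (fun_mx (loops wt)); last by [].
by apply: feasible_reweighting; exact: loops_feasible.
Qed.

Lemma kth_le_reweighted A k : reweighting E wt A -> (0 < k <= #|V|)%N ->
  kth_eigenvalue k (normalized_laplacian wt A) <= reweighted_eigenvalue E wt k.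
Proof.
move=> rA kn; apply: ub_le_sup; last by exists A.
exists 2 => _ [B rB <-]; apply: kth_laplacian_le2 => //.
exact: reweighting_feasible.
Qed.

Lemma reweighted_le k theta :
  (forall A, reweighting E wt A ->
     kth_eigenvalue k (normalized_laplacian wt A) <= theta) ->
  reweighted_eigenvalue E wt k <= theta.
Proof.
move=> H; apply: ge_sup; first exact: laplacian_eigenvalues_neq0.
by move=> _ [A rA <-]; exact: H.
Qed.

Lemma reweighted_mono i j : (0 < i <= j)%N -> (j <= #|V|)%N ->
  reweighted_eigenvalue E wt i <= reweighted_eigenvalue E wt j.
Proof.
move=> /andP[i0 ij] jn; apply: reweighted_le => A rA.
apply: le_trans (kth_le_reweighted rA (_ : 0 < j <= #|V|)%N).
  by apply: kth_eigenvalue_mono; [exact: normalized_laplacian_sym|rewrite ij].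
by rewrite jn andbT (leq_trans i0).
Qed.

Lemma reweighted_second_ge a theta : feasible E wt a -> (1 < #|V|)%N ->
  (forall x, \sum_v wt v * x v = 0 -> theta * sqnorm x <= energy a x) ->
  theta <= reweighted_eigenvalue E wt 2.
Proof.
move=> fa n1 H.
have aE : mx_fun (fun_mx a) = a by apply/funext => u; apply/funext => v; rewrite fun_mxK.
apply: le_trans (kth_le_reweighted (feasible_reweighting fa) (_ : 0 < 2 <= #|V|)%N) => //.
by apply: second_laplacian_ge; rewrite ?aE.
Qed.

End ReweightedLaplacian.

(** * The minimax theorem for the second reweighted eigenvalue *)

Section Minimax.
Context {R : realType} {V : finType} (E : rel V) (wt : V -> R).
Hypothesis Erefl : reflexive E.
Hypothesis wt0 : forall v, 0 < wt v.
Variable c : R.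
Local Notation W := (\sum_v wt v).
Implicit Types (a Y : V * V -> R) (x y : V -> R).

Definition variance x : R := sqnorm wt x - (\sum_v wt v * x v) ^+ 2 / W.

(** The matrix of [energy a - c * variance]. Subtracting the variance removes the restriction to
    mean-zero functions, and the matrix is affine in a. *)
Definition shifted_laplacian a (p : V * V) : R :=
  wt p.1 * (p.1 == p.2)%:R - (a p + a (p.2, p.1)) / 2
  - c * (wt p.1 * (p.1 == p.2)%:R - wt p.1 * wt p.2 / W).

Definition form (Y : V * V -> R) x : R := \sum_p Y p * (x p.1 * x p.2).

Lemma sum_pair (F : V * V -> R) : \sum_p F p = \sum_u \sum_v F (u, v).
Proof. by rewrite pair_big; apply: eq_bigr => -[]. Qed.

Lemma sum_swap (f : V * V -> R) : \sum_p f (p.2, p.1) = \sum_p f p.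
Proof.
rewrite [RHS](reindex (fun p => (p.2, p.1))) //=.
by exists (fun p : V * V => (p.2, p.1)) => -[].
Qed.

Lemma sum_diag (f : V -> R) (g : V * V -> R) :
  \sum_p f p.1 * (p.1 == p.2)%:R * g p = \sum_v f v * g (v, v).
Proof.
rewrite sum_pair /=.
apply: eq_bigr => u _; rewrite (bigD1 u) //= eqxx mulr1 big1 ?addr0 // => v vu.
by rewrite eq_sym (negbTE vu) mulr0 mul0r.
Qed.

Lemma form_shifted_laplacian a x : feasible E wt (fun u v => a (u, v)) ->
  form (shifted_laplacian a) x = energy (fun u v => a (u, v)) x - c * variance x.
Proof.
move=> fa; rewrite (energy_feasible _ fa) /form /variance.
have e1 : \sum_p wt p.1 * (p.1 == p.2)%:R * (x p.1 * x p.2) = sqnorm wt x.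
  by rewrite (sum_diag wt (fun p => x p.1 * x p.2)); apply: eq_bigr => v _; rewrite expr2.
have e2 : \sum_p a (p.2, p.1) * (x p.1 * x p.2) = \sum_p a p * (x p.1 * x p.2).
  rewrite -[RHS]sum_swap; apply: eq_bigr => p _ /=.
  by rewrite (mulrC (x p.1)).
have e3 : \sum_p a p * (x p.1 * x p.2) = \sum_u \sum_v a (u, v) * (x u * x v).
  exact: sum_pair.
have e4 : \sum_p (wt p.1 * wt p.2) * (x p.1 * x p.2) = (\sum_v wt v * x v) ^+ 2.
  rewrite expr2 mulr_suml sum_pair /=.
  apply: eq_bigr => u _; rewrite mulr_sumr; apply: eq_bigr => v _.
  by rewrite mulrACA.
rewrite -e1 -e3 -e4 mulrBr !mulr_suml !mulr_sumr.
have -> : \sum_i a i * (x i.1 * x i.2) =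
  \sum_i (a i + a (i.2, i.1)) / 2 * (x i.1 * x i.2).
  have -> : \sum_i (a i + a (i.2, i.1)) / 2 * (x i.1 * x i.2) =
     (\sum_p a p * (x p.1 * x p.2) + \sum_p a (p.2, p.1) * (x p.1 * x p.2)) / 2.
    rewrite -big_split mulr_suml; apply: eq_bigr => p _ /=; ring.
  by rewrite e2; field.
rewrite -!sumrB; apply: eq_bigr => p _; rewrite /shifted_laplacian; ring.
Qed.

Lemma energy_shift (a' : V -> V -> R) x (t : R) : energy a' (fun v => x v - t) = energy a' x.
Proof.
congr (_ * _); apply: eq_bigr => u _; apply: eq_bigr => v _; congr (_ * _ ^+ 2).
by ring.
Qed.

Lemma total_weight_gt0 (v : V) : 0 < W.
Proof.
by rewrite (bigD1 v) //= ltr_pwDl // sumr_ge0 // => u _; exact: ltW.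
Qed.

Lemma variance_center x (v : V) : variance x =
  sqnorm wt (fun v => x v - (\sum_v wt v * x v) / W).
Proof.
have W0 : W != 0 by rewrite gt_eqF // (total_weight_gt0 v).
rewrite /variance /sqnorm; set m := \sum_v wt v * x v.
transitivity (\sum_v wt v * x v ^+ 2 - 2 * (m / W) * m + (m / W) ^+ 2 * W).
  by field.
rewrite {2}/m 2!mulr_sumr -sumrB -big_split; apply: eq_bigr => u _ /=; ring.
Qed.

Lemma mean_center x (v : V) :
  \sum_v wt v * (x v - (\sum_v wt v * x v) / W) = 0.
Proof.
have W0 : W != 0 by rewrite gt_eqF // (total_weight_gt0 v).
set m := \sum_v wt v * x v; under eq_bigr do rewrite mulrBr.
by rewrite sumrB -mulr_suml -/m; field.
Qed.

(* X is Y - M for the nearest pair of a shifted Laplacian M and a positive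
   semidefinite Y. *)
Lemma separating_matrix : (1 < #|V|)%N -> reweighted_eigenvalue E wt 2 < c ->
  exists X : V * V -> R,
    [/\ forall p, X p = X (p.2, p.1), forall x, 0 <= form X x &
    forall a, feasible E wt (fun u v => a (u, v)) ->
      \sum_p X p * shifted_laplacian a p < 0].
Proof.
move=> n1 lc; have /card_gt0P[v0 _] : (0 < #|V|)%N by exact: ltn_trans n1.
have W0 := total_weight_gt0 v0.
pose I := (V * V + V * V)%type.
pose T : topologicalType := {ptws I -> R}.
pose ma (z : T) : V * V -> R := fun p => z (inl p).
pose my (z : T) : V * V -> R := fun p => z (inr p).
pose D (z : T) p := my z p - shifted_laplacian (ma z) p.
pose Phi z : R := \sum_p D z p ^+ 2.
pose K := [set z : T | feasible E wt (fun u v => ma z (u, v)) /\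
  ((forall p, my z p - my z (p.2, p.1) = 0) /\ forall x, 0 <= form (my z) x)]%classic.
have cco i : continuous (fun z : T => z i : R) by exact: continuous_coord.
have cfeasible : closed [set z : T | feasible E wt (fun u v => ma z (u, v))]%classic.
  rewrite (_ : [set z | _]%classic =
    ([set z : T | forall p, 0 <= z (inl p)] `&` ([set z : T |
      forall p, forall _ : ~~ E p.1 p.2, z (inl p) = 0] `&` ([set z : T |
      forall u, \sum_v z (inl (u, v)) - wt u = 0] `&` [set z : T |
      forall u, \sum_v z (inl (v, u)) - wt u = 0])))%classic); last first.
    apply/seteqP; split=> z.
      case=> h1 h2 h3 h4; split; [|split; [|split]].
      - by move=> [u v]; exact: h1.
      - by move=> [u v]; exact: h2.
      - by move=> u; rewrite h3 subrr.
      - by move=> u; rewrite h4 subrr.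
    case=> h1 [h2 [h3 h4]]; split=> [u v|u v uv|u|u].
    - exact: h1.
    - exact: (h2 (u, v)).
    - by apply/eqP; rewrite -subr_eq0; apply/eqP; exact: h3.
    - by apply/eqP; rewrite -subr_eq0; apply/eqP; exact: h4.
  apply: closedI; [|apply: closedI; [|apply: closedI]].
  - by apply: closed_forall => p; apply: closed_nonneg.
  - by apply: closed_forall => p; apply: closed_forall => _; apply: closed_zero.
  - apply: closed_forall => u; apply: closed_zero; apply: continuous_subf.
      by apply: continuous_sumf.
    exact: continuous_cst.
  - apply: closed_forall => u; apply: closed_zero; apply: continuous_subf.
      by apply: continuous_sumf.
    exact: continuous_cst.
have cK : closed K.
  apply: closedI; last apply: closedI.
  - exact: cfeasible.
  - apply: closed_forall => p; apply: closed_zero.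
    by apply: continuous_subf; exact: cco.
  - apply: closed_forall => x; apply: closed_nonneg; apply: continuous_sumf => p _.
    by apply: continuous_mulf; [exact: cco|exact: continuous_cst].
have cPhi : continuous Phi.
  apply: continuous_sumf => p _; apply: continuous_expf.
  apply: continuous_subf; first exact: cco.
  apply: continuous_subf; last exact: continuous_cst.
  apply: continuous_subf; first exact: continuous_cst.
  apply: continuous_mulf; last exact: continuous_cst.
  by apply: continuous_addf; exact: cco.
pose z0 : T := fun i => match i with inl p => loops wt p.1 p.2 | inr _ => 0 end.
have Kz0 : K z0.
  split; first exact: loops_feasible.
  by split=> [p|x]; [rewrite /my /= subrr|rewrite /form big1 // => p _; rewrite mul0r].
have wtW v : wt v <= W.
  by rewrite (bigD1 v) //= lerDl sumr_ge0 // => u _; exact: ltW.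
have maW z p : K z -> 0 <= ma z p <= W.
  case=> -[h1 _ h3 _] _; case: p => u v; rewrite h1 /=.
  apply: le_trans (wtW u); rewrite -(h3 u) (bigD1 v) //= lerDl.
  by apply: sumr_ge0 => w _; exact: h1.
have bnd z p : K z -> `|shifted_laplacian (ma z) p| <= 2 * W + `|c| * (2 * W).
  move=> Kz; rewrite /shifted_laplacian.
  have b1 : 0 <= wt p.1 * (p.1 == p.2)%:R <= W.
    case: (p.1 == p.2); first by rewrite mulr1 wtW ltW.
    by rewrite mulr0 lexx ltW.
  have b2 : 0 <= wt p.1 * wt p.2 / W <= W.
    rewrite divr_ge0 ?mulr_ge0 ?(ltW (wt0 _)) ?(ltW W0) //= ler_pdivrMr //.
    by apply: ler_pM => //; exact: ltW.
  move: (maW z p Kz) (maW z (p.2, p.1) Kz) b1 b2.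
  move: (wt p.1 * _) (ma z p) (ma z _) (wt p.1 * wt p.2 / W) => q1 q2 q3 q4.
  move=> /andP[? ?] /andP[? ?] /andP[? ?] /andP[? ?].
  apply: le_trans (ler_normB _ _) _; rewrite normrM; apply: lerD.
    by rewrite ler_norml; apply/andP; split; lra.
  by rewrite ler_wpM2l // ler_norml; apply/andP; split; lra.
have sq1 (s t : R) : s ^+ 2 <= t -> `|s| <= 1 + t.
  by move=> st; rewrite ler_norml; apply/andP; split; nra.
have [z Kz zmin] : exists2 z, K z & forall z', K z' -> Phi z <= Phi z'.
  apply: (@coercive_min R I Phi K z0 (W + (2 * W + `|c| * (2 * W)) + (1 + Phi z0))) => //.
  have P0 : 0 <= Phi z0 by apply: sumr_ge0 => p _; exact: sqr_ge0.
  move=> z Kz zle [p|p].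
    have /andP[h1 h2] := maW z p Kz; rewrite ger0_norm //.
    have : 0 <= `|c| * (2 * W) by rewrite mulr_ge0 // mulr_ge0 // ltW.
    by rewrite -/(ma z p); lra.
  have : D z p ^+ 2 <= Phi z0.
    by apply: le_trans zle; rewrite /Phi (bigD1 p) //= lerDl sumr_ge0 // => *; exact: sqr_ge0.
  move=> /sq1 h1; have h2 := bnd z p Kz.
  have -> : z (inr p) = D z p + shifted_laplacian (ma z) p by rewrite /D subrK.
  by apply: le_trans (ler_normD _ _) _; lra.
have [fz [symY psdY]] := Kz.
pose X := D z.
have variation (e1 e2 : V * V -> R) :
    (forall t, 0 < t -> t <= 1 ->
      K (fun i => match i with inl p => ma z p + t * e1 p | inr p => my z p + t * e2 p end)) ->
    0 <= \sum_p X p * (e2 p + (e1 p + e1 (p.2, p.1)) / 2).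
  move=> Ke; apply: sum_square_min => t t0 t1; have := zmin _ (Ke t t0 t1).
  rewrite /Phi; congr (_ <= _); apply: eq_bigr => p _; congr (_ ^+ 2).
  by rewrite /X /D /shifted_laplacian /ma /my /=; ring.
(* Adding t x x^T to Y stays in the cone. *)
have psdX x : 0 <= form X x.
  have := @variation (fun=> 0) (fun p => x p.1 * x p.2).
  have Kd t : 0 < t -> t <= 1 -> K (fun i => match i with
      inl p => ma z p + t * 0 | inr p => my z p + t * (x p.1 * x p.2) end).
    move=> t0 t1; split.
      by under eq_fun do under eq_fun do rewrite /ma mulr0 addr0.
    split=> [p|y].
      by have := symY p; rewrite /my /= (mulrC (x p.2)); lra.
    rewrite /form /my; under eq_bigr do rewrite mulrDl.
    rewrite big_split addr_ge0 //; first exact: psdY.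
    have -> : \sum_i t * (x i.1 * x i.2) * (y i.1 * y i.2) = t * (\sum_v x v * y v) ^+ 2.
      rewrite expr2 mulr_suml sum_pair mulr_sumr /=; apply: eq_bigr => u _; rewrite !mulr_sumr.
      by apply: eq_bigr => v _; ring.
    by rewrite mulr_ge0 ?sqr_ge0 // ltW.
  move=> /(_ Kd) h; apply: le_trans h _; rewrite le_eqVlt; apply/orP; left; apply/eqP.
  by apply: eq_bigr => p _; rewrite addr0 mul0r addr0.
(* Scaling Y by 1 - t stays in the cone. *)
have XY : \sum_p X p * my z p <= 0.
  have := @variation (fun=> 0) (fun p => - my z p).
  have Kd t : 0 < t -> t <= 1 -> K (fun i => match i with
      inl p => ma z p + t * 0 | inr p => my z p + t * - my z p end).
    move=> t0 t1; split.
      by under eq_fun do under eq_fun do rewrite /ma mulr0 addr0.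
    split=> [p|y].
      have := symY p; rewrite /my /=; move: (z _) (z _) => s1 s2 h.
      have -> : s1 = s2 by lra.
      by rewrite subrr.
    have := psdY y; rewrite /form /my /= => h.
    have -> : \sum_p (z (inr p) + t * - z (inr p)) * (y p.1 * y p.2) =
      (1 - t) * \sum_p z (inr p) * (y p.1 * y p.2).
      by rewrite mulr_sumr; apply: eq_bigr => p _; ring.
    by rewrite mulr_ge0 // subr_ge0.
  move=> /(_ Kd) h; rewrite -oppr_ge0 -sumrN; apply: le_trans h _.
  rewrite le_eqVlt; apply/orP; left; apply/eqP.
  by apply: eq_bigr => p _; rewrite addr0 mul0r addr0 mulrN.
(* If X vanished, the shifted Laplacian of a reweighting would be positive semidefinite, and the
   second reweighted eigenvalue would be at least c. *)
have XX : 0 < \sum_p X p ^+ 2.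
  rewrite lt_neqAle sumr_ge0 ?andbT; last by move=> *; exact: sqr_ge0.
  rewrite eq_sym; apply/negP; rewrite psumr_eq0 => [/allP X0|*]; last exact: sqr_ge0.
  move: lc; rewrite ltNge => /negP; apply.
  apply: (reweighted_second_ge wt0 fz n1) => x x0.
  have := psdY x; have -> : form (my z) x = form (shifted_laplacian (ma z)) x.
    apply: eq_bigr => p _; congr (_ * _); have := X0 p (mem_index_enum p).
    by rewrite sqrf_eq0 /X /D subr_eq0 => /eqP.
  by rewrite form_shifted_laplacian // /variance x0 expr0n mul0r subr0 subr_ge0.
exists X; split=> // [p|b fb].
  case: p => u v; have := symY (u, v).
  rewrite /X /D /shifted_laplacian /= [v == u]eq_sym (mulrC (wt v) (wt u)).
  by have [->|_] := eqVneq u v; rewrite ?mulr0; lra.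
have Xa : \sum_p X p * shifted_laplacian (ma z) p < 0.
  have -> : \sum_p X p * shifted_laplacian (ma z) p =
      \sum_p X p * my z p - \sum_p X p ^+ 2.
    rewrite -sumrB; apply: eq_bigr => p _.
    have -> : shifted_laplacian (ma z) p = my z p - X p.
      by rewrite /X /D opprB addrC subrK.
    by ring.
  by rewrite subr_lt0 (le_lt_trans XY).
(* Moving from the optimal reweighting towards b cannot shrink the distance, so X pairs with the
   matrix of b to at most its pairing with the optimal one. *)
apply: le_lt_trans Xa; rewrite -subr_ge0 -sumrB.
have := @variation (fun p => b p - ma z p) (fun=> 0).
have Kd t : 0 < t -> t <= 1 -> K (fun i => match i with
    inl p => ma z p + t * (b p - ma z p) | inr p => my z p + t * 0 end).
  move=> t0 t1; have t1' : 0 <= 1 - t by rewrite subr_ge0.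
  have [h1 h2 h3 h4] := fz; have [g1 g2 g3 g4] := fb.
  have mE p : ma z p + t * (b p - ma z p) = (1 - t) * ma z p + t * b p by ring.
  split; last first.
    rewrite (_ : my _ = my z) //.
    by apply/funext => p; rewrite /my mulr0 addr0.
  split=> [u v|u v uv|u|u]; rewrite /ma /= -/(ma z _).
  - by rewrite mE addr_ge0 // mulr_ge0 // ?ltW.
  - by rewrite mE h2 // g2 // !mulr0 addr0.
  - under eq_bigr do rewrite mE.
    by rewrite big_split /= -!mulr_sumr h3 g3; ring.
  - under eq_bigr do rewrite mE.
    by rewrite big_split /= -!mulr_sumr h4 g4; ring.
move=> /(_ Kd) h; apply: le_trans h _; rewrite le_eqVlt; apply/orP; left; apply/eqP.
by apply: eq_bigr => p _; rewrite /shifted_laplacian; ring.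
Qed.

(** Write the separating matrix as G^T G. Its negative pairing with each shifted Laplacian says that
    the rows of G have total energy below c times their total variance; centring keeps energies and
    turns variances into squared norms. *)
Theorem minimax_embedding : (1 < #|V|)%N -> reweighted_eigenvalue E wt 2 < c ->
  exists f : 'I_#|V| -> V -> R,
    (forall i, \sum_v wt v * f i v = 0) /\
    forall a : V -> V -> R, feasible E wt a -> \sum_i energy a (f i) < c * \sum_i sqnorm wt (f i).
Proof.
move=> n1 lc; have /card_gt0P[v0 _] : (0 < #|V|)%N by exact: ltn_trans n1.
have [X [symX psdX negX]] := separating_matrix n1 lc.
pose M : 'M[R]_#|V| := \matrix_(i, j) X (enum_val i, enum_val j).
have sM : M^T = M by apply/matrixP => i j; rewrite !mxE symX.
have [G MG] : exists G : 'M[R]_#|V|, M = G^T *m G.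
  apply: psd_gram => // y; have := psdX (fun v => y 0 (enum_rank v)).
  suff -> : form X (fun v => y 0 (enum_rank v)) = quad M y by [].
  rewrite /form sum_pair exchange_big -sum_enum_val /=.
  apply: eq_bigr => i _; rewrite -sum_enum_val mxE mulr_suml; apply: eq_bigr => j _.
  by rewrite !enum_valK mxE; ring.
pose f i v := G i (enum_rank v).
have XE u v : X (u, v) = \sum_i f i u * f i v.
  have := congr1 (fun N : 'M[R]_#|V| => N (enum_rank u) (enum_rank v)) MG.
  rewrite /M !mxE !enum_rankK => ->.
  by apply: eq_bigr => i _; rewrite mxE.
exists (fun i v => f i v - (\sum_v wt v * f i v) / W); split=> [i|a fa].
  exact: mean_center.
under eq_bigr do rewrite energy_shift.
under [X in _ < _ * X]eq_bigr do rewrite -(variance_center _ v0).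
rewrite -subr_lt0 mulr_sumr -sumrB.
pose b p := a p.1 p.2.
have fb : feasible E wt (fun u v => b (u, v)) by [].
have formE i : energy a (f i) - c * variance (f i) = form (shifted_laplacian b) (f i).
  by rewrite form_shifted_laplacian.
under eq_bigr do rewrite formE.
have := negX _ fb; congr (_ < _); rewrite /form exchange_big /=.
apply: eq_bigr => -[u v] _ /=; rewrite XE mulr_suml.
by apply: eq_bigr => i _; ring.
Qed.

End Minimax.

(** * Random signs *)

Section HyperbolicCosine.
Context {R : realType}.

Definition cosh (t : R) : R := (expR t + expR (- t)) / 2.

Lemma cosh_ge1 t : 1 <= cosh t.
Proof. by rewrite /cosh; have := expR_ge1Dx t; have := expR_ge1Dx (- t); lra. Qed.

Lemma cosh_ge0 t : 0 <= cosh t.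
Proof. exact: le_trans (cosh_ge1 t). Qed.

Lemma cosh0 : cosh 0 = 1.
Proof. by rewrite /cosh oppr0 expR0; field. Qed.

Lemma coshD_coshB x y : cosh (x + y) + cosh (x - y) = 2 * cosh x * cosh y.
Proof. by rewrite /cosh !opprD !opprK !expRD; field. Qed.

(** Averaging [expR x <= (1 - x)^-1] at t and -t gives cosh t <= 1 / (1 - t^2), which is at most 1 +
    2 t^2 in this range. *)
Lemma cosh_small t : `|t| <= 1 / 2 -> cosh t <= expR (2 * t ^+ 2).
Proof.
rewrite ler_norml => /andP[t1 t2].
apply: le_trans (expR_ge1Dx _).
have exp_le (x : R) : x <= 1 / 2 -> expR x <= (1 - x)^-1.
  move=> x1; rewrite -[x in expR x]opprK expRN lef_pV2 ?posrE ?expR_gt0 //; last lra.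
  exact: expR_ge1Dx.
have h1 := exp_le t t2; have h2 : expR (- t) <= (1 + t)^-1.
  by rewrite -[in leRHS](opprK t); apply: exp_le; lra.
have h3 : (1 - t)^-1 + (1 + t)^-1 <= 2 * (1 + 2 * t ^+ 2).
  have -> : (1 - t)^-1 + (1 + t)^-1 = 2 / ((1 - t) * (1 + t)).
    by field; rewrite !gt_eqF //; lra.
  rewrite ler_pdivrMr; last by nra.
  have : t ^+ 2 <= 1 / 4 by nra.
  have := sqr_ge0 t; move: (t ^+ 2) (expr2 t) => x -> ; nra.
by rewrite /cosh; lra.
Qed.

(* cosh (2 s) <= (cosh s) ^ 4, so the bound passes from s to 2 s. *)
Lemma cosh_le t : cosh t <= expR (2 * t ^+ 2).
Proof.
suff dyadic n s : `|s| <= 2 ^+ n / 2 -> cosh s <= expR (2 * s ^+ 2).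
  have := archi_boundP (normr_ge0 t); set n := Num.bound _ => tn.
  apply: (dyadic n.+1); rewrite exprS mulrAC divff // mul1r.
  apply: le_trans (ltW tn) _; rewrite -natrX ler_nat.
  exact/ltnW/ltn_expl.
elim: n s => [|n IH] s; first by rewrite expr0; exact: cosh_small.
move=> sn; have : cosh (s / 2) <= expR (2 * (s / 2) ^+ 2).
  apply: IH; rewrite normrM (@ger0_norm _ 2^-1) ?invr_ge0 //.
  by move: sn; rewrite exprS; lra.
move=> h.
have -> : expR (2 * s ^+ 2) = expR (2 * (s / 2) ^+ 2) ^+ 4.
  by rewrite -expRM_natl; congr expR; field.
apply: le_trans (_ : cosh (s / 2) ^+ 4 <= _); last first.
  by rewrite lerXn2r ?nnegrE ?expR_ge0 // (le_trans _ (cosh_ge1 _)).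
have := coshD_coshB (s / 2) (s / 2).
rewrite subrr cosh0 -splitr.
set x := cosh (s / 2); have := sqr_ge0 (x ^+ 2 - 1).
have -> : (x ^+ 2 - 1) ^+ 2 = x ^+ 4 - 2 * (x * x) + 1 by ring.
lra.
Qed.

Lemma exp_quadratic (y : R) : 0 <= y -> y ^+ 2 <= 4 * expR y.
Proof.
move=> y0; have -> : expR y = expR (y / 2) ^+ 2.
  by rewrite -expRM_natl; congr expR; field.
have := expR_ge1Dx (y / 2); nra.
Qed.

(** A pointwise Chernoff bound. With y = |x| / sqrt d, the left side is nonzero only if y >= sqrt T;
    there y^2 <= 4 e^y, and e^y is at most e^(sigma y) e^(-(sigma - 1) sqrt T). *)
Lemma cosh_tail (T d sigma x : R) : 0 < d -> 0 <= T -> 1 <= sigma ->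
  Num.max 0 (x ^+ 2 - T * d) <=
  8 * d * expR (- (sigma - 1) * Num.sqrt T) * cosh (sigma / Num.sqrt d * x).
Proof.
move=> d0 T0 sg1; set rhs := _ * cosh _.
have rhs0 : 0 <= rhs.
  by rewrite !mulr_ge0 ?expR_ge0 ?cosh_ge0 // ltW.
have [small|big] := leP (x ^+ 2) (T * d).
  by rewrite max_l // subr_le0.
rewrite max_r ?subr_ge0 ?(ltW big) //.
apply: le_trans (_ : x ^+ 2 <= _); first by rewrite gerBl mulr_ge0 // ltW.
have sd0 : 0 < Num.sqrt d by rewrite sqrtr_gt0.
pose y := `|x| / Num.sqrt d.
have y0 : 0 <= y by rewrite divr_ge0 // ltW.
have xy : x ^+ 2 = d * y ^+ 2.
  rewrite /y expr_div_n real_normK ?num_real // sqr_sqrtr ?(ltW d0) //.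
  by rewrite mulrC divfK // gt_eqF.
have Ty : Num.sqrt T <= y.
  rewrite -(@ler_pXn2r _ 2) ?nnegrE ?sqrtr_ge0 // sqr_sqrtr //.
  by move: big; rewrite xy mulrC ltr_pM2l // => /ltW.
have coshy : expR (sigma * y) <= 2 * cosh (sigma / Num.sqrt d * x).
  have -> : sigma / Num.sqrt d * x = sigma * (x / Num.sqrt d) by rewrite mulrA mulrAC.
  rewrite /cosh [leRHS]mulrCA divff // mulr1 /y.
  have [x0|x0] := leP 0 x; first by rewrite ger0_norm // lerDl expR_ge0.
  by rewrite ltr0_norm // !mulNr mulrN lerDr expR_ge0.
have step : expR y <= expR (sigma * y) * expR (- (sigma - 1) * Num.sqrt T).
  rewrite -expRD ler_expR; nra.
have q := exp_quadratic y0.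
have e0 := expR_gt0 (- (sigma - 1) * Num.sqrt T).
rewrite xy /rhs.
have -> : 8 * d * expR (- (sigma - 1) * Num.sqrt T) * cosh (sigma / Num.sqrt d * x)
  = d * (4 * (2 * cosh (sigma / Num.sqrt d * x) * expR (- (sigma - 1) * Num.sqrt T))).
  by ring.
rewrite ler_pM2l //; apply: le_trans q _; rewrite ler_pM2l //.
by apply: le_trans step _; rewrite ler_pM2r.
Qed.

End HyperbolicCosine.

(** * Moments and tails of random signed sums *)

Section RandomSigns.
Context {R : realType} {V : finType}.
Implicit Types (f z : V -> R) (fs : seq (V -> R)) (G H : (V -> R) -> R).

(* The mean of G at z plus or minus the members of fs, over independent signs. *)
Fixpoint sign_mean fs G z : R :=
  if fs is f :: fs' then (sign_mean fs' G (fun v => z v + f v)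
    + sign_mean fs' G (fun v => z v - f v)) / 2
  else G z.

Lemma sign_mean_le fs G H z : (forall y, G y <= H y) ->
  sign_mean fs G z <= sign_mean fs H z.
Proof.
move=> GH; elim: fs z => //= f fs IH z.
by rewrite ler_pM2r ?invr_gt0 // lerD.
Qed.

Lemma sign_meanD fs G H z :
  sign_mean fs (fun y => G y + H y) z = sign_mean fs G z + sign_mean fs H z.
Proof. by elim: fs z => //= f fs IH z; rewrite !IH; ring. Qed.

Lemma sign_meanZ fs c G z :
  sign_mean fs (fun y => c * G y) z = c * sign_mean fs G z.
Proof. by elim: fs z => //= f fs IH z; rewrite !IH; ring. Qed.

Lemma sign_mean_cst fs c z : sign_mean fs (fun=> c) z = c.
Proof. by elim: fs z => //= f fs IH z; rewrite !IH; field. Qed.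

Lemma sign_mean_sum fs (J : finType) (F : J -> (V -> R) -> R) z :
  sign_mean fs (fun y => \sum_j F j y) z = \sum_j sign_mean fs (F j) z.
Proof.
elim: fs z => //= f fs IH z; rewrite !IH -big_split mulr_suml.
by apply: eq_bigr.
Qed.

(** A positive mean forces a positive value for some choice of signs. The invariant P carries the
    mean-zero condition along. *)
Lemma sign_mean_gt0 fs (P : set (V -> R)) G z :
  P z -> (forall y i, P y -> P (fun v => y v + nth (fun=> 0) fs i v)
    /\ P (fun v => y v - nth (fun=> 0) fs i v)) ->
  0 < sign_mean fs G z -> exists2 y, P y & 0 < G y.
Proof.
elim: fs z => [z Pz _ Gz|f fs IH z Pz cl] /=; first by exists z.
have cl' y i : P y -> P (fun v => y v + nth (fun=> 0) fs i v)
    /\ P (fun v => y v - nth (fun=> 0) fs i v) by move=> Py; exact: (cl y i.+1).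
have [P1 P2] := cl z 0%N Pz; rewrite pmulr_lgt0 ?invr_gt0 // => pos.
have [p1|p1] := ltP 0 (sign_mean fs G (fun v => z v + f v)).
  exact: IH P1 cl' p1.
by apply: (IH _ P2 cl'); move: pos p1; rewrite -/(sign_mean _ _ _); lra.
Qed.

Lemma sign_mean_diff_square fs u v z :
  sign_mean fs (fun y => (y u - y v) ^+ 2) z =
  (z u - z v) ^+ 2 + \sum_(f <- fs) (f u - f v) ^+ 2.
Proof.
elim: fs z => [|f fs IH] z /=; first by rewrite big_nil addr0.
by rewrite !IH big_cons; field.
Qed.

(** By the addition formula each sign contributes a factor cosh (s (f u - f v)), which [cosh_le]
    bounds. *)
Lemma sign_mean_cosh fs (s : R) u v z :
  sign_mean fs (fun y => cosh (s * (y u - y v))) z <=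
  cosh (s * (z u - z v)) * expR (2 * s ^+ 2 * \sum_(f <- fs) (f u - f v) ^+ 2).
Proof.
elim: fs z => [|f fs IH] z /=; first by rewrite big_nil mulr0 expR0 mulr1.
rewrite big_cons ler_pdivrMr //; apply: le_trans (lerD (IH _) (IH _)) _.
rewrite -mulrDl (mulrDr (2 * s ^+ 2)) expRD.
have -> : s * (z u + f u - (z v + f v)) = s * (z u - z v) + s * (f u - f v) by ring.
have -> : s * (z u - f u - (z v - f v)) = s * (z u - z v) - s * (f u - f v) by ring.
rewrite coshD_coshB.
set e := expR (_ * \sum_(_ <- _) _); set b := cosh (s * (f u - f v)).
have -> : 2 * s ^+ 2 * (f u - f v) ^+ 2 = 2 * (s * (f u - f v)) ^+ 2 by ring.
have bl : b <= expR (2 * (s * (f u - f v)) ^+ 2) := cosh_le _.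
have -> : cosh (s * (z u - z v)) * (expR (2 * (s * (f u - f v)) ^+ 2) * e) * 2 =
  2 * cosh (s * (z u - z v)) * expR (2 * (s * (f u - f v)) ^+ 2) * e by ring.
rewrite ler_wpM2r ?expR_ge0 // ler_wpM2l // mulr_ge0 //.
exact: cosh_ge0.
Qed.

Lemma sign_mean_tail fs (L : R) u v : 1 / 2 <= L ->
  let d := \sum_(f <- fs) (f u - f v) ^+ 2 in
  sign_mean fs (fun y => Num.max 0 ((y u - y v) ^+ 2 - 512 * L * d)) (fun=> 0)
  <= 8 * d * expR (- L).
Proof.
move=> L1; cbv zeta; set d := \sum_(f <- fs) (f u - f v) ^+ 2.
have d0 : 0 <= d by apply: sumr_ge0 => *; exact: sqr_ge0.
have [dz|dn] := eqVneq d 0.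
  rewrite dz !mulr0 mul0r; apply: le_trans (_ : sign_mean fs (fun y => (y u - y v) ^+ 2) (fun=> 0) <= _).
    by apply: sign_mean_le => y; rewrite subr0 max_r ?sqr_ge0.
  by rewrite sign_mean_diff_square subrr expr0n add0r -/d dz.
have dp : 0 < d by rewrite lt_neqAle eq_sym dn.
(* With t = sqrt T and sigma = t / 4 the exponent is -(sigma - 1) t + 2 sigma^2 = t - t^2 / 8. Since
   t >= 16, this is at most -t^2 / 16, hence at most -t^2 / 512 = -L. *)
pose T := 512 * L; pose t := Num.sqrt T.
have T0 : 0 <= T by rewrite /T; lra.
have tT : t ^+ 2 = T by rewrite sqr_sqrtr.
have t16 : 16 <= t.
  rewrite -(@ler_pXn2r _ 2) ?nnegrE ?sqrtr_ge0 // tT /T.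
  have -> : (16 : R) ^+ 2 = 256 by ring.
  lra.
pose sg := t / 4.
have sg1 : 1 <= sg by rewrite /sg; lra.
apply: le_trans (_ : sign_mean fs (fun y => 8 * d * expR (- (sg - 1) * Num.sqrt T) *
    cosh (sg / Num.sqrt d * (y u - y v))) (fun=> 0) <= _).
  by apply: sign_mean_le => y; exact: cosh_tail.
rewrite sign_meanZ -mulrA ler_pM2l; last by rewrite mulr_gt0.
apply: le_trans (_ : expR (- (sg - 1) * Num.sqrt T) *
    expR (2 * (sg / Num.sqrt d) ^+ 2 * d) <= _).
  rewrite ler_pM2l ?expR_gt0 //; apply: le_trans (sign_mean_cosh _ _ _ _ _) _.
  by rewrite subrr mulr0 -/d cosh0 mul1r.
rewrite -expRD ler_expR -/t.
have -> : 2 * (sg / Num.sqrt d) ^+ 2 * d = 2 * sg ^+ 2.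
  rewrite expr_div_n sqr_sqrtr // ?ltW //; field.
  by [].
have -> : L = t ^+ 2 / 512 by rewrite tT /T; field.
rewrite /sg; nra.
Qed.

Context (wt : V -> R).
Hypothesis wt0 : forall v, 0 < wt v.

Lemma sqnorm_ge0 z : 0 <= sqnorm wt z.
Proof. by apply: sumr_ge0 => v _; rewrite mulr_ge0 ?sqr_ge0 // ltW. Qed.

Lemma sqnorm_shift z f (t : R) : sqnorm wt (fun v => z v + t * f v) =
  sqnorm wt z + 2 * t * (\sum_v wt v * (z v * f v)) + t ^+ 2 * sqnorm wt f.
Proof.
rewrite /sqnorm !mulr_sumr -!big_split; apply: eq_bigr => v _ /=; ring.
Qed.

Lemma sqnorm_cauchy z f :
  (\sum_v wt v * (z v * f v)) ^+ 2 <= sqnorm wt z * sqnorm wt f.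
Proof.
set b := \sum_v _; have quad t : 0 <= sqnorm wt z + 2 * t * b + t ^+ 2 * sqnorm wt f.
  by rewrite -sqnorm_shift sqnorm_ge0.
have n0 := sqnorm_ge0 z; have m0 := sqnorm_ge0 f.
have [mz|mn] := eqVneq (sqnorm wt f) 0.
  have [->|bn] := eqVneq b 0; first by rewrite expr2 !mul0r mulr_ge0.
  have := quad (- (1 + sqnorm wt z) / (2 * b)); rewrite mz !mulr0 addr0.
  have -> : 2 * (- (1 + sqnorm wt z) / (2 * b)) * b = - (1 + sqnorm wt z) by field.
  lra.
have mp : 0 < sqnorm wt f by rewrite lt_neqAle eq_sym mn.
have := quad (- b / sqnorm wt f).
have -> : sqnorm wt z + 2 * (- b / sqnorm wt f) * b + (- b / sqnorm wt f) ^+ 2 * sqnorm wt f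
  = (sqnorm wt z * sqnorm wt f - b ^+ 2) / sqnorm wt f by field.
by rewrite pmulr_lge0 ?invr_gt0 // subr_ge0.
Qed.

Lemma sign_mean_sqnorm fs z : sign_mean fs (sqnorm wt) z =
  sqnorm wt z + \sum_(f <- fs) sqnorm wt f.
Proof.
elim: fs z => [|f fs IH] z /=; first by rewrite big_nil addr0.
rewrite !IH big_cons.
have e1 : sqnorm wt (fun v => z v + f v) = sqnorm wt (fun v => z v + 1 * f v).
  by congr sqnorm; apply/funext => v; rewrite mul1r.
have e2 : sqnorm wt (fun v => z v - f v) = sqnorm wt (fun v => z v + -1 * f v).
  by congr sqnorm; apply/funext => v; rewrite mulN1r.
by rewrite e1 e2 !sqnorm_shift; field.
Qed.

(** A step by plus or minus f adds 4 <z, f>^2 to (|z|^2 + |f|^2)^2 on average, and Cauchy-Schwarz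
    bounds it. At z = 0 the fourth moment is at most 3 S^2. *)
Lemma sign_mean_sqnorm2 fs z : let S := \sum_(f <- fs) sqnorm wt f in
  sign_mean fs (fun y => sqnorm wt y ^+ 2) z <=
  sqnorm wt z ^+ 2 + 6 * sqnorm wt z * S + 3 * S ^+ 2.
Proof.
elim: fs z => [|f fs IH] z /=; first by rewrite big_nil expr0n !mulr0 !addr0.
rewrite big_cons; set S := \sum_(_ <- _) _ in IH *.
rewrite ler_pdivrMr //; apply: le_trans (lerD (IH _) (IH _)) _.
have e1 : sqnorm wt (fun v => z v + f v) = sqnorm wt (fun v => z v + 1 * f v).
  by congr sqnorm; apply/funext => v; rewrite mul1r.
have e2 : sqnorm wt (fun v => z v - f v) = sqnorm wt (fun v => z v + -1 * f v).
  by congr sqnorm; apply/funext => v; rewrite mulN1r.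
rewrite e1 e2 !sqnorm_shift; have := sqnorm_cauchy z f.
have := sqnorm_ge0 z; have := sqnorm_ge0 f.
have : 0 <= S by apply: sumr_ge0 => *; exact: sqnorm_ge0.
move: (sqnorm wt z) (sqnorm wt f) (\sum_v _) => n m b S0 m0 n0 cs.
have := sqr_ge0 m; nra.
Qed.

End RandomSigns.

(** * Dimension reduction *)

Section DimensionReduction.
Context {R : realType} {V : finType} (E : rel V) (wt : V -> R).
Hypothesis wt0 : forall v, 0 < wt v.

Definition edge_capacity u v : R := (E u v)%:R * Num.min (wt u) (wt v).

Lemma edge_capacity_ge0 u v : 0 <= edge_capacity u v.
Proof. by rewrite mulr_ge0 // le_min !ltW. Qed.

Lemma feasible_le_capacity a u v : feasible E wt a -> a u v <= edge_capacity u v.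
Proof.
case=> a0 aE ar ac; rewrite /edge_capacity.
have [uv|uv] := boolP (E u v); last by rewrite aE // mul0r.
rewrite mul1r le_min; apply/andP; split.
  by rewrite -(ar u) (bigD1 v) //= lerDl sumr_ge0.
by rewrite -(ac v) (bigD1 u) //= lerDl sumr_ge0.
Qed.

Theorem dimension_reduction (a0 : V -> V -> R) (kappa L c : R) m (f : 'I_m -> V -> R) :
  feasible E wt a0 -> (forall u v, kappa * edge_capacity u v <= a0 u v) ->
  1 / 2 <= L -> expR (- L) <= kappa -> 0 < c ->
  (forall i, \sum_v wt v * f i v = 0) ->
  (forall a, feasible E wt a -> \sum_i energy a (f i) < c * \sum_i sqnorm wt (f i)) ->
  exists z, [/\ \sum_v wt v * z v = 0, 0 < sqnorm wt z &
    forall a, feasible E wt a -> energy a z <= 2112 * L * c * sqnorm wt z].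
Proof.
move=> fa0 a0w L1 Lk c0 fmean fa.
pose fs := [seq f i | i <- enum 'I_m].
have sum_fs (F : (V -> R) -> R) : \sum_(g <- fs) F g = \sum_i F (f i).
  by rewrite big_map big_enum.
pose S := \sum_i sqnorm wt (f i).
have S0 : 0 < S.
  rewrite -(pmulr_rgt0 _ c0); apply: le_lt_trans (fa a0 fa0).
  by apply: sumr_ge0 => i _; apply: energy_ge0; case: fa0.
pose d u v := \sum_(g <- fs) (g u - g v) ^+ 2.
have energy_d a : \sum_i energy a (f i) = 2^-1 * \sum_u \sum_v a u v * d u v.
  rewrite -mulr_sumr exchange_big; congr (_ * _); apply: eq_bigr => u _.
  rewrite exchange_big; apply: eq_bigr => v _ /=.
  by rewrite /d sum_fs mulr_sumr.
pose T := 512 * L.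
pose rest (z : V -> R) := \sum_u \sum_v edge_capacity u v *
  Num.max 0 ((z u - z v) ^+ 2 - T * d u v).
(* Bounds [energy a z] for all a at once: the part of (z u - z v)^2 up to [T * d u v] costs at most
   T c S by the hypothesis on f, and the excess is charged to the capacities. *)
pose Y z := T * c * S + 2^-1 * rest z.
have energyY a z : feasible E wt a -> energy a z <= Y z.
  move=> faa; have [age0 _ _ _] := faa.
  have -> : energy a z = T * \sum_i energy a (f i)
      + 2^-1 * \sum_u \sum_v a u v * ((z u - z v) ^+ 2 - T * d u v).
    rewrite energy_d mulrCA -mulrDr; congr (_ * _).
    rewrite mulr_sumr -big_split; apply: eq_bigr => u _ /=.
    rewrite mulr_sumr -big_split; apply: eq_bigr => v _ /=; ring.
  apply: lerD.
    rewrite -mulrA ler_wpM2l ?(ltW (fa a faa)) //.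
    by rewrite /T; lra.
  rewrite ler_pM2l ?invr_gt0 //; apply: ler_sum => u _; apply: ler_sum => v _.
  apply: le_trans (_ : a u v * Num.max 0 ((z u - z v) ^+ 2 - T * d u v) <= _).
    by rewrite ler_wpM2l // le_max lexx orbT.
  by rewrite ler_wpM2r ?feasible_le_capacity // le_max lexx.
have meanY : sign_mean fs Y (fun=> 0) <= (T + 8) * c * S.
  have -> : sign_mean fs Y (fun=> 0) = T * c * S + 2^-1 * \sum_u \sum_v
      edge_capacity u v * sign_mean fs (fun y =>
        Num.max 0 ((y u - y v) ^+ 2 - T * d u v)) (fun=> 0).
    rewrite /Y sign_meanD sign_mean_cst sign_meanZ /rest sign_mean_sum.
    congr (_ + _ * _); apply: eq_bigr => u _; rewrite sign_mean_sum.
    by apply: eq_bigr => v _; rewrite sign_meanZ.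
  rewrite [in leRHS]mulrDl [in leRHS]mulrDl lerD2l.
  (* The factor e^(-L) <= kappa from the tail bound turns capacities into a0, whose total energy on
     f is below c S. *)
  apply: le_trans (_ : 2^-1 * \sum_u \sum_v a0 u v * (8 * d u v) <= _).
    rewrite ler_pM2l ?invr_gt0 //; apply: ler_sum => u _; apply: ler_sum => v _.
    have d0 : 0 <= d u v by apply: sumr_ge0 => *; exact: sqr_ge0.
    apply: le_trans (_ : edge_capacity u v * (8 * d u v * kappa) <= _).
      rewrite ler_wpM2l ?edge_capacity_ge0 //.
      apply: le_trans (sign_mean_tail _ _ _ L1) _.
      by rewrite ler_wpM2l // mulr_ge0.
    by rewrite mulrCA mulrC ler_wpM2r ?mulr_ge0 // mulrC.
  have -> : 2^-1 * \sum_u \sum_v a0 u v * (8 * d u v) = 8 * \sum_i energy a0 (f i).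
    rewrite energy_d mulrCA; congr (_ * _); rewrite mulr_sumr; apply: eq_bigr => u _.
    by rewrite mulr_sumr; apply: eq_bigr => v _; ring.
  by rewrite -mulrA ler_pM2l // ltW // fa.
pose K := 4 * (T + 8) * c.
have K0 : 0 < K by rewrite /K mulr_gt0 // /T; lra.
(* The mean of G is at least S - S/2 - S/4, and G z > 0 forces Y z < K |z|^2. *)
pose G (z : V -> R) := sqnorm wt z + (- (6 * S)^-1) * sqnorm wt z ^+ 2 + (- K^-1) * Y z.
have meanG : 0 < sign_mean fs G (fun=> 0).
  rewrite /G 2!sign_meanD !sign_meanZ sign_mean_sqnorm // sum_fs -/S.
  have n0 : sqnorm wt (fun=> 0) = 0.
    by rewrite /sqnorm big1 // => v _; rewrite expr2 mul0r mulr0.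
  have h2 : sign_mean fs (fun y => sqnorm wt y ^+ 2) (fun=> 0) <= 3 * S ^+ 2.
    by have := sign_mean_sqnorm2 wt0 fs (fun=> 0); cbv zeta; rewrite sum_fs -/S n0; lra.
  have {}h2 : (6 * S)^-1 * sign_mean fs (fun y => sqnorm wt y ^+ 2) (fun=> 0) <= S / 2.
    rewrite mulrC ler_pdivrMr ?mulr_gt0 //; apply: le_trans h2 _.
    by rewrite le_eqVlt; apply/orP; left; apply/eqP; field.
  have h3 : K^-1 * sign_mean fs Y (fun=> 0) <= S / 4.
    rewrite mulrC ler_pdivrMr //; apply: le_trans meanY _.
    by rewrite le_eqVlt; apply/orP; left; apply/eqP; rewrite /K; field.
  by rewrite !mulNr; lra.
have [z zmean Gz] : exists2 z, \sum_v wt v * z v = 0 & 0 < G z.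
  apply: (@sign_mean_gt0 _ _ fs [set z | \sum_v wt v * z v = 0]%classic _ _ _ _ meanG).
    by rewrite /= big1 // => v _; rewrite mulr0.
  have fs0 i : \sum_v wt v * nth (fun=> 0) fs i v = 0.
    rewrite /fs; elim: (enum _) i => [|j s IH] [|i] //=.
      by rewrite big1 // => v _; rewrite mulr0.
    by rewrite big1 // => v _; rewrite mulr0.
  move=> y i /= y0; split.
    by under eq_bigr do rewrite mulrDr; rewrite big_split /= y0 fs0 addr0.
  by under eq_bigr do rewrite mulrBr; rewrite sumrB y0 fs0 subrr.
have Yz : 0 <= Y z.
  have T0 : 0 <= T by rewrite /T; lra.
  apply: addr_ge0; first by apply: mulr_ge0; [apply: mulr_ge0 => //|]; exact: ltW.
  apply: mulr_ge0; first by rewrite invr_ge0.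
  apply: sumr_ge0 => u _; apply: sumr_ge0 => v _.
  by rewrite mulr_ge0 ?edge_capacity_ge0 // le_max lexx.
have q0 : 0 <= (6 * S)^-1 * sqnorm wt z ^+ 2.
  by rewrite mulr_ge0 ?sqr_ge0 // invr_ge0 mulr_ge0 // ltW.
have Kz : K^-1 * Y z < sqnorm wt z by move: Gz; rewrite /G !mulNr; lra.
exists z; split=> // [|a faa].
  by apply: le_lt_trans Kz; rewrite mulr_ge0 // invr_ge0 ltW.
(* As L >= 1/2, K = 4 (512 L + 8) c is at most 4 (512 L + 16 L) c = 2112 L c. *)
apply: le_trans (energyY a z faa) _.
move: Kz; rewrite mulrC ltr_pdivrMr // => Kz; apply: le_trans (ltW Kz) _.
rewrite mulrC ler_wpM2r ?sqnorm_ge0 // /K ler_pM2r // /T; lra.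
Qed.

End DimensionReduction.

(** * Greedy choice of thresholds *)

Section Tents.
Context {R : realType}.

Definition tent (a b x : R) : R := Num.max 0 (Num.min (x - a) (b - x)).

(* The antiderivative of tent a b on [a, b] vanishing at a. *)
Definition tent_integral (a b x : R) : R :=
  if x <= (a + b) / 2 then (x - a) ^+ 2 / 2 else (b - a) ^+ 2 / 4 - (b - x) ^+ 2 / 2.

Lemma tent_ge0 a b x : 0 <= tent a b x.
Proof. by rewrite /tent le_max lexx. Qed.

Lemma tent_left a b x : x <= a -> tent a b x = 0.
Proof. by move=> xa; rewrite /tent max_l // ge_min subr_le0 xa. Qed.

Lemma tent_right a b x : b <= x -> tent a b x = 0.
Proof. by move=> xb; rewrite /tent max_l // ge_min !subr_le0 xb orbT. Qed.

Lemma tent_mid a b x : a <= x -> x <= b ->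
  tent a b x = if x <= (a + b) / 2 then x - a else b - x.
Proof.
move=> ax xb; rewrite /tent max_r; last by rewrite le_min !subr_ge0 ax.
by case: ifP => h; [rewrite min_l|rewrite min_r]; lra.
Qed.

Lemma tent_lipschitz a b x y : `|tent a b x - tent a b y| <= `|x - y|.
Proof.
wlog xy : x y / x <= y => [H|].
  by have [|/ltW] := leP x y; [exact: H|rewrite distrC (distrC x); exact: H].
rewrite (ler0_norm (_ : x - y <= 0)) ?subr_le0 //.
have [xa|xa] := leP x a.
  rewrite (tent_left _ xa); have [ya|ya] := leP y a.
    by rewrite (tent_left _ ya) subrr normr0; lra.
  have [yb|yb] := leP y b; last by rewrite (tent_right _ (ltW yb)) subrr normr0; lra.
  rewrite (tent_mid (ltW ya) yb) ler_norml; case: ifP => h; apply/andP; split; lra.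
have [xb|xb] := leP x b; last first.
  rewrite (tent_right _ (ltW xb)) (tent_right _ (_ : b <= y)) ?subrr ?normr0; lra.
rewrite (tent_mid (ltW xa) xb); have [yb|yb] := leP y b; last first.
  rewrite (tent_right _ (ltW yb)) ler_norml; case: ifP => h; apply/andP; split; lra.
rewrite (tent_mid (_ : a <= y) yb); last lra.
by rewrite ler_norml; case: ifP => h; case: ifP => h'; apply/andP; split; lra.
Qed.

(** The upper bound holds because the derivative [tent a b] is 1-Lipschitz. In the lower one the
    factor 4 is attained at x = a, y = b. *)
Lemma tent_integral_bounds a b x y : a <= x -> x <= y -> y <= b ->
  tent_integral a b y - tent_integral a b x <= (y - x) * (tent a b x + (y - x)) /\
  (y - x) ^+ 2 <= 4 * (tent_integral a b y - tent_integral a b x).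
Proof.
move=> ax xy yb; rewrite tent_mid //; last exact: le_trans yb.
rewrite /tent_integral.
have [hx|hx] := leP x ((a + b) / 2); have [hy|hy] := leP y ((a + b) / 2).
- by split; nra.
- move: hx hy; have [h bE] : exists h, b = a + 2 * h by exists ((b - a) / 2); field.
  rewrite bE in yb *; have -> : (a + (a + 2 * h)) / 2 = a + h by field.
  move=> hx hy.
  have h2 : 0 <= (a + h - x) * (y - (a + h)) by rewrite mulr_ge0; lra.
  have h3 : 0 <= (a + h - x) * (x - a) by rewrite mulr_ge0; lra.
  have h4 : 0 <= (y - (a + h)) * (a + 2 * h - y) by rewrite mulr_ge0; lra.
  have h5 : 0 <= (y - (a + h)) * (x - a) by rewrite mulr_ge0; lra.
  by split; nra.
- by have := lt_le_trans hx (le_trans xy hy); rewrite ltxx.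
- by split; nra.
Qed.

Lemma continuous_tent a x : continuous (fun b => tent a b x).
Proof.
have -> : (fun b => tent a b x) = fun b =>
    (0 + (x - a + (b - x) - `|x - a - (b - x)|) / 2 +
     `|0 - (x - a + (b - x) - `|x - a - (b - x)|) / 2|) / 2.
  by apply/funext => b; rewrite /tent maxr_absE minr_absE.
have cn (g : R -> R) : continuous g -> continuous (fun b => `|g b|).
  by move=> cg b; apply: cvg_norm; exact: cg.
have ci : continuous (fun b : R => b) by move=> b; exact: cvg_id.
have cc (t : R) : continuous (fun _ : R => t) by exact: continuous_cst.
have ce : continuous (fun b => (x - a + (b - x) - `|x - a - (b - x)|) / 2).
  apply: continuous_mulf => //; apply: continuous_subf.
    by apply: continuous_addf => //; exact: continuous_subf.
  by apply: cn; apply: continuous_subf => //; exact: continuous_subf.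
apply: continuous_mulf => //; apply: continuous_addf.
  exact: continuous_addf.
by apply: cn; exact: continuous_subf.
Qed.

(* On [a, +oo[, D plays the distance to a set of n thresholds containing a, and
   Psi its antiderivative. *)
Definition potential (a : R) (n : nat) (Psi D : R -> R) :=
  [/\ D a = 0, forall x, a <= x -> 0 <= D x &
    forall x y, a <= x -> x <= y ->
      Psi y - Psi x <= (y - x) * (D x + (y - x)) /\
      (y - x) ^+ 2 <= 4 * n%:R * (Psi y - Psi x)].

Lemma ray_potential a : potential a 1 (fun x => (x - a) ^+ 2 / 2) (fun x => x - a).
Proof.
split=> [|x|x y ax xy]; rewrite ?subrr ?subr_ge0 //.
by split; nra.
Qed.

(** A step across b splits into p before b and q after it; (p + q)^2 <= (n + 1) (p^2 + q^2 / n) then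
    raises n to n + 1. *)
Lemma potential_glue a b n Psi D : a <= b -> (0 < n)%N -> potential b n Psi D ->
  potential a n.+1
    (fun x => if x <= b then tent_integral a b x else (b - a) ^+ 2 / 4 + (Psi x - Psi b))
    (fun x => if x <= b then tent a b x else D x).
Proof.
move=> ab n0 [Db D0 PD].
have n1 : (1 : R) <= n%:R by rewrite ler1n.
have Ib : tent_integral a b b = (b - a) ^+ 2 / 4.
  rewrite /tent_integral; case: ifP => h; last by rewrite subrr expr0n mul0r subr0.
  have -> : a = b by lra.
  by rewrite subrr expr2 !mul0r.
split=> [|x ax|x y ax xy].
- by rewrite ab tent_left.
- by case: (leP x b) => xb; [exact: tent_ge0|exact/D0/ltW].
have [yb|yb] := leP y b.
  have xb := le_trans xy yb; rewrite xb.
  have [h1 h2] := tent_integral_bounds ax xy yb; split=> //.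
  apply: (le_trans h2); rewrite ler_wpM2r //; last by rewrite ler_peMr // ler1n.
  by have := sqr_ge0 (y - x); lra.
have [xb|xb] := leP x b.
  have [h1 h2] := tent_integral_bounds ax xb (lexx b).
  have [h3 h4] := PD b y (lexx b) (ltW yb).
  have tx := tent_ge0 a b x.
  rewrite Ib in h1 h2; rewrite Db add0r in h3.
  move: (tent_integral a b x) (tent a b x) ((b - a) ^+ 2 / 4) (Psi y - Psi b)
    h1 h2 h3 h4 tx => I t J Q h1 h2 h3 h4 t0.
  have hp : 0 <= b - x by rewrite subr_ge0.
  have hq : 0 <= y - b by rewrite subr_ge0 ltW.
  split; first by nra.
  have -> : y - x = (b - x) + (y - b) by ring.
  have -> : n.+1%:R = n%:R + 1 :> R by rewrite natr1.
  move: (n%:R) n1 h4 => N n1 h4.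
  move: (b - x) (y - b) hp hq h1 h2 h3 h4 => p q p0 q0 h1 h2 h3 h4.
  have N0 : 0 < N by lra.
  rewrite -(ler_pM2l N0).
  have := sqr_ge0 (N * p - q).
  have : N * (N + 1) * p ^+ 2 <= N * (N + 1) * (4 * (J - I)).
    by rewrite ler_wpM2l // mulr_ge0; lra.
  have : (N + 1) * q ^+ 2 <= (N + 1) * (4 * N * Q).
    by rewrite ler_wpM2l //; lra.
  lra.
have [h1 h2] := PD x y (ltW xb) xy.
have e : (b - a) ^+ 2 / 4 + (Psi y - Psi b) - ((b - a) ^+ 2 / 4 + (Psi x - Psi b)) =
  Psi y - Psi x by ring.
rewrite e; split=> //; apply: (le_trans h2).
have : 0 <= Psi y - Psi x.
  have := sqr_ge0 (y - x); rewrite leNgt => h; rewrite leNgt; apply/negP => h3.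
  move: h => /negP; apply; apply: (le_lt_trans h2).
  by rewrite nmulr_llt0 // mulr_gt0 // ltr0n.
by move=> h; rewrite ler_wpM2r // ler_pM2l // ler_nat.
Qed.

End Tents.

Section Greedy.
Context {R : realType} {V : finType} (wt f : V -> R) (C : R).
Hypothesis wt0 : forall v, 0 < wt v.
Hypothesis C0 : 0 < C.

(** The last clause bounds the total energy of all bumps by that of f, whatever N is; truncating f
    at a leaves room for a further tent to the left of a. *)
Definition disjoint_bumps (N : nat) (a : R) (h : nat -> V -> R) :=
  [/\ forall i, (i < N)%N -> sqnorm wt (h i) = C,
      forall i v, (i < N)%N -> f v <= a -> h i v = 0,
      forall i j v, (i < N)%N -> (j < N)%N -> i != j -> h i v * h j v = 0 &
      forall u v, \sum_(i < N) (h i u - h i v) ^+ 2 <=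
        (Num.max a (f u) - Num.max a (f v)) ^+ 2].

Definition fitting_potential (N : nat) (a : R) (Psi D : R -> R) :=
  exists2 n, (0 < n <= N)%N & potential a n Psi D /\
    \sum_(v | a <= f v) wt v * D (f v) ^+ 2 <= n%:R * C.

(** Intermediate values: as b moves right from a, the squared norm of the tent passes continuously
    from 0 to beyond C unless the whole ray has squared norm at most C. *)
Lemma exact_tent a :
  \sum_(v | a <= f v) wt v * (f v - a) ^+ 2 <= C \/
  exists2 b, a < b & sqnorm wt (fun v => tent a b (f v)) = C.
Proof.
have [|big] := leP (\sum_(v | a <= f v) wt v * (f v - a) ^+ 2) C; first by left.
right; pose g b := sqnorm wt (fun v => tent a b (f v)).
have ga : g a = 0.
  rewrite /g /sqnorm big1 // => v _; have [fa|/ltW fa] := leP (f v) a.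
    by rewrite tent_left // expr2 !mulr0.
  by rewrite tent_right // expr2 !mulr0.
(* So far right that every point at or beyond a lies in the rising half of the tent, where the tent
   equals f v - a. *)
pose b1 := a + \sum_v 2 * `|f v - a|.
have ab1 : a <= b1 by rewrite /b1 lerDl sumr_ge0 // => v _; rewrite mulr_ge0.
have gb1 : C < g b1.
  apply: lt_le_trans big _; rewrite /g /sqnorm big_mkcond; apply: ler_sum => v _.
  case: ifP => [av|_]; last by rewrite mulr_ge0 ?sqr_ge0 // ltW.
  have far : 2 * (f v - a) <= b1 - a.
    have -> : b1 - a = \sum_v 2 * `|f v - a| by rewrite /b1; ring.
    rewrite (bigD1 v) //= ger0_norm ?subr_ge0 // lerDl.
    by apply: sumr_ge0 => u _; rewrite mulr_ge0.
  rewrite /tent min_l ?max_r ?subr_ge0 //; lra.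
have cg : continuous g.
  apply: continuous_sumf => v _; apply: continuous_mulf; first exact: continuous_cst.
  by apply: continuous_expf; exact: continuous_tent.
have [||b] := @IVT R g a b1 C ab1.
- exact: continuous_subspaceT.
- by rewrite ga ge_min le_max (ltW C0) (ltW gb1) orbT.
rewrite in_itv /= => /andP[ab _] gb; exists b => //.
rewrite lt_neqAle ab andbT; apply/eqP => abE.
by move: C0; rewrite -gb -abE ga ltxx.
Qed.

Lemma bumps_cons N a b h : a < b -> sqnorm wt (fun v => tent a b (f v)) = C ->
  disjoint_bumps N b h ->
  disjoint_bumps N.+1 a (fun i => if i is j.+1 then h j else fun v => tent a b (f v)).
Proof.
move=> ab tC [hC hb hd hl].
have hba i v : (i < N)%N -> f v <= a -> h i v = 0.
  by move=> iN fa; apply: hb => //; rewrite (le_trans fa) // ltW.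
have td i v : (i < N)%N -> tent a b (f v) * h i v = 0.
  move=> iN; have [fb|/ltW fb] := leP (f v) b; first by rewrite hb // mulr0.
  by rewrite tent_right // mul0r.
split=> [[|i]//|[|i] v|[|i] [|j] v|u v] //=.
- by move=> iN; exact: hC.
- by move=> _ fa; rewrite tent_left.
- by move=> iN; exact: hba.
- by move=> _ jN _; exact: td.
- by move=> iN _ _; rewrite mulrC; exact: td.
- by move=> iN jN ij; exact: hd.
rewrite big_ord_recl /=.
wlog uv : u v / f u <= f v => [H|].
  have [|/ltW vu] := leP (f u) (f v); first exact: H.
  have sw (s t : R) : (s - t) ^+ 2 = (t - s) ^+ 2 by ring.
  rewrite sw [leRHS]sw; under eq_bigr do rewrite sw.
  exact: H.
have lip := tent_lipschitz a b.
have zero w : f w <= b -> forall i : 'I_N, h i w = 0 by move=> wb i; exact: hb.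
have [vb|vb] := leP (f v) b.
  rewrite big1 => [|i _]; last by rewrite !zero ?subrr ?expr2 ?mul0r // (le_trans uv).
  have tm w : tent a b (f w) = tent a b (Num.max a (f w)).
    by case/orP: (le_total (f w) a) => wa; [rewrite (@max_l _ _ a) // !tent_left|rewrite (@max_r _ _ a)].
  rewrite addr0 (tm u) (tm v) -[leLHS]real_normK ?num_real //.
  by rewrite -[leRHS]real_normK ?num_real // lerXn2r ?nnegrE.
have vmax : Num.max a (f v) = f v by rewrite max_r // ltW // (lt_trans ab).
have vmax' : Num.max b (f v) = f v by rewrite max_r // ltW.
rewrite (tent_right _ (ltW vb)) subr0 vmax.
have [ub|ub] := leP (f u) b; last first.
  rewrite tent_right ?(ltW ub) // expr2 mul0r add0r.
  have := hl u v; rewrite vmax' max_r ?(ltW ub) // max_r // ltW //.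
  exact: lt_trans ub.
(* The pair straddles b: the tent contributes at most (b - max a (f u))^2 and the bumps at most (f v
   - b)^2, squares of the two pieces of one interval. *)
have h1 := hl u v; rewrite vmax' max_l // in h1.
have tm : tent a b (f u) <= b - Num.max a (f u).
  have [ua|/ltW ua] := leP (f u) a; first by rewrite tent_left // subr_ge0 ltW.
  by rewrite tent_mid //; case: ifP; lra.
have h2 : tent a b (f u) ^+ 2 <= (b - Num.max a (f u)) ^+ 2.
  by rewrite lerXn2r ?nnegrE ?tent_ge0 // (le_trans (tent_ge0 a b (f u))).
have h3 : 0 <= b - Num.max a (f u) := le_trans (tent_ge0 a b (f u)) tm.
have h4 : 0 <= f v - b by rewrite subr_ge0 ltW.
have h5 : 0 <= (b - Num.max a (f u)) * (f v - b) by rewrite mulr_ge0.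
nra.
Qed.

(** If the ray from a has squared norm at most C, a is the last threshold; otherwise the next one is
    the b whose tent has squared norm exactly C, and the construction continues from b. *)
Lemma bumps_or_potential N a :
  (exists h, disjoint_bumps N a h) \/ exists Psi D, fitting_potential N a Psi D.
Proof.
elim: N a => [|N IH] a.
  left; exists (fun _ _ => 0); split=> // u v; rewrite big_ord0 sqr_ge0 //.
have [small|[b ab tC]] := exact_tent a.
  right; exists (fun x => (x - a) ^+ 2 / 2), (fun x => x - a); exists 1%N => //.
  by split; [exact: ray_potential|rewrite mul1r].
have [[h hb]|[Psi [D [n /andP[n0 nN] [pot sumD]]]]] := IH b.
  by left; exists (fun i => if i is j.+1 then h j else fun v => tent a b (f v)); exact: bumps_cons.
right; exists (fun x => if x <= b then tent_integral a b x else (b - a) ^+ 2 / 4 + (Psi x - Psi b)).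
exists (fun x => if x <= b then tent a b x else D x); exists n.+1.
  by apply/andP; split.
split; first by apply: potential_glue => //; exact: ltW.
have -> : n.+1%:R * C = C + n%:R * C by rewrite -add1n natrD mulrDl mul1r.
rewrite -{1}tC; apply: le_trans (lerD (lexx _) sumD).
rewrite /sqnorm (big_mkcond (fun v => a <= f v)) (big_mkcond (fun v => b <= f v)).
rewrite -big_split; apply: ler_sum => v _ /=.
have tpos : 0 <= wt v * tent a b (f v) ^+ 2 by rewrite mulr_ge0 ?sqr_ge0 // ltW.
have Dpos : 0 <= wt v * D (f v) ^+ 2 by rewrite mulr_ge0 ?sqr_ge0 // ltW.
case: (leP a (f v)) => av; case: (leP (f v) b) => vb; case: (leP b (f v)) => bv; lra.
Qed.

End Greedy.

(** * The improved Cheeger inequality for a one-dimensional embedding *)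

Lemma square_sum_disjoint (R : realFieldType) (J : finType) (P : pred J) (c x : J -> R) :
  (forall i j, i != j -> x i * x j = 0) ->
  (\sum_(j | P j) c j * x j) ^+ 2 = \sum_(j | P j) c j ^+ 2 * x j ^+ 2.
Proof.
move=> dx; rewrite expr2 mulr_suml; apply: eq_bigr => i Pi.
rewrite mulr_sumr (bigD1 i) //= big1 ?addr0 => [|j /andP[_ ji]]; first by ring.
have -> : c i * x i * (c j * x j) = c i * c j * (x i * x j) by ring.
by rewrite dx ?mulr0 // eq_sym.
Qed.

(** At most one x i and one y j are nonzero; when the two indices differ, the square of the
    difference of two terms costs the factor 2. *)
Lemma square_diff_disjoint (R : realFieldType) (J : finType) (c x y : J -> R) :
  (forall i j, i != j -> x i * x j = 0) -> (forall i j, i != j -> y i * y j = 0) ->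
  (\sum_j c j * x j - \sum_j c j * y j) ^+ 2 <=
  2 * \sum_j c j ^+ 2 * (x j - y j) ^+ 2.
Proof.
move=> dx dy.
have sq (p q : R) : (p - q) ^+ 2 <= 2 * (p ^+ 2 + q ^+ 2).
  by have := sqr_ge0 (p + q); nra.
have [i xi|x0] := pickP (fun i => x i != 0); last first.
  have x0' j : x j = 0 by apply/eqP; have := x0 j => /negbT; rewrite negbK.
  rewrite big1 => [|j _]; last by rewrite x0' mulr0.
  rewrite sub0r sqrrN (square_sum_disjoint predT _ dy).
  under [X in _ <= 2 * X]eq_bigr do rewrite x0' sub0r sqrrN.
  rewrite ler_peMl ?ler1n // sumr_ge0 // => j _.
  by rewrite mulr_ge0 ?sqr_ge0.
have xj j : j != i -> x j = 0.
  move=> ji; have := dx i j; rewrite eq_sym ji => /(_ isT) /eqP.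
  by rewrite mulf_eq0 (negbTE xi) => /eqP.
rewrite (bigD1 i) //= [X in _ + X - _]big1 => [|j ji]; last by rewrite xj // mulr0.
rewrite addr0 [X in _ - X](bigD1 i) //= opprD addrA -mulrBr.
apply: le_trans (sq _ _) _; rewrite ler_pM2l // (square_sum_disjoint _ _ dy).
rewrite [leRHS](bigD1 i) //= exprMn lerD2l; apply: ler_sum => j ji.
by rewrite xj // sub0r sqrrN.
Qed.

Section ImprovedCheeger.
Context {R : realType} {V : finType} (E : rel V) (wt : V -> R).
Hypothesis Erefl : reflexive E.
Hypothesis wt0 : forall v, 0 < wt v.

Lemma energy_sum_disjoint (a : V -> V -> R) (J : finType) (c : J -> R) (h : J -> V -> R) :
  (forall u v, 0 <= a u v) -> (forall i j v, i != j -> h i v * h j v = 0) ->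
  energy a (fun v => \sum_j c j * h j v) <= 2 * \sum_j c j ^+ 2 * energy a (h j).
Proof.
move=> a0 dh.
have -> : 2 * \sum_j c j ^+ 2 * energy a (h j) =
    2^-1 * \sum_u \sum_v a u v * (2 * \sum_j c j ^+ 2 * (h j u - h j v) ^+ 2).
  transitivity (2^-1 * \sum_j \sum_u \sum_v a u v * (2 * (c j ^+ 2 * (h j u - h j v) ^+ 2))).
    rewrite !mulr_sumr; apply: eq_bigr => j _; rewrite /energy !mulr_sumr.
    apply: eq_bigr => u _; rewrite !mulr_sumr; apply: eq_bigr => v _; ring.
  congr (_ * _); rewrite exchange_big; apply: eq_bigr => u _.
  rewrite exchange_big; apply: eq_bigr => v _ /=.
  by rewrite !mulr_sumr.
rewrite /energy ler_pM2l ?invr_gt0 //; apply: ler_sum => u _; apply: ler_sum => v _.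
by rewrite ler_wpM2l // square_diff_disjoint // => i j; exact: dh.
Qed.

(** The 2k bumps have total energy at most mu, so at least k of them have energy at most mu / k, for
    otherwise the rest would exceed the total. These k are the test functions. *)
Lemma bumps_eigenvalue_le (f : V -> R) (C mu a : R) k (h : nat -> V -> R) :
  (0 < k)%N -> 0 < C -> (forall b, feasible E wt b -> energy b f <= mu) ->
  disjoint_bumps wt f C (2 * k) a h ->
  reweighted_eigenvalue E wt k <= 2 * mu / (k%:R * C).
Proof.
move=> k0 C0 low [hC _ hd hl]; apply: (reweighted_le Erefl wt0) => A rA.
have fA := reweighting_feasible rA; set b := mx_fun A in fA *.
have [b0 _ _ _] := fA.
have kR : 0 < k%:R :> R by rewrite ltr0n.
have total : \sum_(i < 2 * k) energy b (h i) <= mu.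
  apply: le_trans (low b fA); rewrite /energy -mulr_sumr ler_pM2l ?invr_gt0 //.
  rewrite exchange_big; apply: ler_sum => u _.
  rewrite exchange_big; apply: ler_sum => v _ /=.
  rewrite -mulr_sumr ler_wpM2l //; apply: le_trans (hl u v) _.
  have sqle (s t : R) : `|s| <= `|t| -> s ^+ 2 <= t ^+ 2.
    move=> st; rewrite -[leLHS]real_normK ?num_real //.
    by rewrite -[leRHS]real_normK ?num_real // lerXn2r ?nnegrE.
  apply: sqle; rewrite ler_norml.
  have n1 := ler_norm (f u - f v); have n2 := ler_norm (f v - f u).
  rewrite (distrC (f v)) in n2; move: (`|f u - f v|) n1 n2 => B n1 n2.
  by case: (leP a (f u)) => hu; case: (leP a (f v)) => hv; apply/andP; split; lra.
pose I := [pred i : 'I_(2 * k) | energy b (h i) <= mu / k%:R].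
have kI : (k <= #|I|)%N.
  rewrite leqNgt; apply/negP => Ik.
  have kC : (k < #|[predC I]|)%N.
    move: (cardC I) Ik; rewrite [#|'I_(2 * k)|]card_ord.
    by move: #|I| #|[predC I]| => p q; lia.
  have : mu < \sum_(i < 2 * k) energy b (h i).
    have mu0 : 0 <= mu by apply: le_trans (low b fA); exact: energy_ge0.
    rewrite (bigID (mem I)) /= ltr_wpDl //.
      by apply: sumr_ge0 => i _; exact: energy_ge0.
    have /card_gt0P[i0 Ii0] : (0 < #|[predC I]|)%N by exact: leq_ltn_trans kC.
    apply: le_lt_trans (_ : \sum_(i | i \notin I) mu / k%:R < _).
      have -> : \sum_(i | i \notin I) mu / k%:R = mu * (#|[predC I]|%:R / k%:R).
        by rewrite sumr_const -[LHS]mulr_natr mulrAC mulrA.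
      by rewrite ler_peMr // ler_pdivlMr // mul1r ler_nat ltnW.
    have e i : i \notin I -> mu / k%:R < energy b (h i) by rewrite inE -ltNge.
    rewrite (bigD1 i0) //= [ltRHS](bigD1 i0) //=; apply: ltr_leD; first exact: e.
    by apply: ler_sum => i /andP[/e/ltW].
  by rewrite ltNge total.
pose g (i : 'I_k) : 'I_(2 * k) := enum_val (widen_ord kI i).
have gI i : energy b (h (g i)) <= mu / k%:R by have := enum_valP (widen_ord kI i).
have gd i j : i != j -> (g i : nat) != g j.
  by rewrite val_eqE (inj_eq enum_val_inj) -!val_eqE.
apply: (@kth_laplacian_le _ _ E _ wt0 A k (fun i => h (g i)) C) => // [i j|c].
  have [->|ij] := eqVneq i j.
    by rewrite mulr1 -(hC (g j)) //; apply: eq_bigr => v _; rewrite expr2.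
  by rewrite mulr0 big1 // => v _; rewrite hd ?mulr0 // gd.
apply: le_trans (energy_sum_disjoint _ _ _) _ => //.
  by move=> i j v ij; rewrite hd // gd.
have -> : 2 * mu / (k%:R * C) * (C * \sum_i c i ^+ 2) = 2 * (\sum_i c i ^+ 2 * (mu / k%:R)).
  by rewrite -mulr_suml; field; rewrite !gt_eqF.
by rewrite ler_pM2l //; apply: ler_sum => i _; rewrite ler_wpM2l ?sqr_ge0.
Qed.

Lemma sqnorm_le_shift (f : V -> R) (t : R) : \sum_v wt v * f v = 0 ->
  sqnorm wt f <= \sum_v wt v * (f v - t) ^+ 2.
Proof.
move=> f0.
have -> : \sum_v wt v * (f v - t) ^+ 2 =
    sqnorm wt f - 2 * t * (\sum_v wt v * f v) + \sum_v wt v * t ^+ 2.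
  rewrite /sqnorm mulr_sumr -sumrB -big_split; apply: eq_bigr => v _ /=; ring.
rewrite f0 mulr0 subr0 lerDl; apply: sumr_ge0 => v _.
by rewrite mulr_ge0 ?sqr_ge0 // ltW.
Qed.

(** Over a step of length x, [Psi] grows by at most x D + x^2, and x D <= t x^2 + D^2 / (2 t). The
    marginals of a turn the D terms into a weighted sum. *)
Lemma potential_pairing (a : V -> V -> R) (f : V -> R) (x0 : R) n Psi D (t : R) :
  feasible E wt a -> (0 < n)%N -> (forall v, x0 <= f v) -> potential x0 n Psi D -> 0 < t ->
  pairing a (fun u v => `|Psi (f u) - Psi (f v)|) <=
  2 * (1 + t) * energy a f + t^-1 * \sum_v wt v * D (f v) ^+ 2.
Proof.
move=> fa n0 xf [_ D0 PD] t0; have [a0 _ ar ac] := fa.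
have main u v : `|Psi (f u) - Psi (f v)| <=
    (1 + t) * (f u - f v) ^+ 2 + (D (f u) ^+ 2 + D (f v) ^+ 2) / (2 * t).
  wlog uv : u v / f u <= f v => [H|].
    have [|/ltW vu] := leP (f u) (f v); first exact: H.
    rewrite distrC (_ : (f u - f v) ^+ 2 = (f v - f u) ^+ 2); last by ring.
    by rewrite (addrC (D (f u) ^+ 2)); exact: H.
  have [h1 h2] := PD (f u) (f v) (xf u) uv.
  have P0 : 0 <= Psi (f v) - Psi (f u).
    rewrite -(pmulr_rge0 _ (_ : 0 < 4 * n%:R)) ?mulr_gt0 ?ltr0n //.
    exact: le_trans (sqr_ge0 _) h2.
  rewrite distrC ger0_norm //; apply: (le_trans h1).
  set x := f v - f u; have x0' : 0 <= x by rewrite subr_ge0.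
  have -> : (f u - f v) ^+ 2 = x ^+ 2 by rewrite /x; ring.
  have q1 : x * D (f u) <= t * x ^+ 2 + D (f u) ^+ 2 / (2 * t).
    rewrite -(ler_pM2l (_ : 0 < 2 * t)) ?mulr_gt0 //.
    have -> : 2 * t * (t * x ^+ 2 + D (f u) ^+ 2 / (2 * t)) =
      2 * (t * x) ^+ 2 + D (f u) ^+ 2 by field; rewrite gt_eqF.
    have := sqr_ge0 (t * x - D (f u)); have := sqr_ge0 (t * x); nra.
  have q2 : 0 <= D (f v) ^+ 2 / (2 * t).
    by rewrite divr_ge0 ?sqr_ge0 // mulr_ge0 // ltW.
  rewrite (mulrDl (D (f u) ^+ 2)); lra.
have e1 : \sum_u \sum_v a u v * D (f u) ^+ 2 = \sum_v wt v * D (f v) ^+ 2.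
  by apply: eq_bigr => u _; rewrite -mulr_suml ar.
have e2 : \sum_u \sum_v a u v * D (f v) ^+ 2 = \sum_v wt v * D (f v) ^+ 2.
  by rewrite exchange_big; apply: eq_bigr => u _; rewrite -mulr_suml ac.
apply: le_trans (_ : \sum_u \sum_v a u v * ((1 + t) * (f u - f v) ^+ 2 +
    (D (f u) ^+ 2 + D (f v) ^+ 2) / (2 * t)) <= _).
  by apply: ler_sum => u _; apply: ler_sum => v _; rewrite ler_wpM2l.
rewrite le_eqVlt; apply/orP; left; apply/eqP.
have -> : t^-1 * \sum_v wt v * D (f v) ^+ 2 = (2 * t)^-1 *
    (\sum_u \sum_v a u v * D (f u) ^+ 2 + \sum_u \sum_v a u v * D (f v) ^+ 2).
  by rewrite e1 e2; field; rewrite gt_eqF.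
have -> : 2 * (1 + t) * energy a f = (1 + t) * \sum_u \sum_v a u v * (f u - f v) ^+ 2.
  by rewrite /energy; field.
rewrite -big_split !mulr_sumr -big_split; apply: eq_bigr => u _ /=.
rewrite -big_split !mulr_sumr -big_split; apply: eq_bigr => v _ /=; ring.
Qed.

Theorem improved_cheeger (psi mu lambda : R) (f : V -> R) k :
  0 < psi -> expands E wt psi -> 0 < mu -> (0 < k)%N ->
  0 < lambda -> lambda <= 2 -> lambda <= reweighted_eigenvalue E wt k ->
  \sum_v wt v * f v = 0 -> 0 < sqnorm wt f ->
  (forall a, feasible E wt a -> energy a f <= mu * sqnorm wt f) ->
  psi <= 224 * k%:R * mu / Num.sqrt lambda.
Proof.
move=> psi0 ex mu0 k0 l0 l2 lk f0 N0 low.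
have [v0 _|V0] := pickP (@predT V); last first.
  by move: N0; rewrite /sqnorm big1 ?ltxx // => v; have := V0 v.
have kR : 0 < k%:R :> R by rewrite ltr0n.
set N := sqnorm wt f in N0 low.
(* With this C, 2k bumps would force the k-th reweighted eigenvalue down to lambda / 2. *)
pose C := 4 * (mu * N) / (k%:R * lambda).
have C0 : 0 < C by rewrite divr_gt0 ?mulr_gt0.
have [vm _ vmin] := @arg_minP _ _ _ v0 predT f isT.
have [[h hb]|[Psi [D [n /andP[n0 nk] [pot sumD]]]]] :=
    bumps_or_potential f wt0 C0 (2 * k) (f vm).
  have := bumps_eigenvalue_le k0 C0 low hb.
  have -> : 2 * (mu * N) / (k%:R * C) = lambda / 2.
    by rewrite /C; field; rewrite !gt_eqF.
  lra.
have xf v : f vm <= f v by exact: vmin.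
(* This t balances the two terms of [potential_pairing]. From lambda <= 2 follows t >= 2/3, hence 2
   (1 + t) <= 5 t, and the total constant is 5 + 8 = 13; taking 14 afterwards gives the strict
   inequality for duality. *)
pose t := (Num.sqrt lambda)^-1.
have s0 : 0 < Num.sqrt lambda by rewrite sqrtr_gt0.
have t0 : 0 < t by rewrite invr_gt0.
have tl : t ^+ 2 * lambda = 1.
  by rewrite /t exprVn sqr_sqrtr ?(ltW l0) // mulVf // gt_eqF.
have t23 : 2 / 3 <= t by nra.
have sumD' : \sum_v wt v * D (f v) ^+ 2 <= 8 * (mu * N) / lambda.
  move: sumD; rewrite (eq_bigl predT) => [sumD|v]; last by rewrite xf.
  apply: le_trans sumD _; apply: le_trans (_ : (2 * k)%:R * C <= _).
    by rewrite ler_pM2r // ler_nat.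
  rewrite le_eqVlt; apply/orP; left; apply/eqP.
  by rewrite natrM /C; field; rewrite !gt_eqF.
have bound a : feasible E wt a ->
    pairing a (fun u v => `|Psi (f u) - Psi (f v)|) <= 13 * (mu * N) * t.
  move=> fa; apply: le_trans (potential_pairing fa n0 xf pot t0) _.
  have := low a fa; move: (energy a f) => e el.
  have -> : t^-1 = lambda * t.
    by rewrite -[LHS]mul1r -tl; field; rewrite gt_eqF.
  have : lambda * t * (\sum_v wt v * D (f v) ^+ 2) <= t * (8 * (mu * N)).
    have -> : t * (8 * (mu * N)) = lambda * t * (8 * (mu * N) / lambda).
      by field; rewrite gt_eqF.
    by rewrite ler_pM2l // mulr_gt0.
  have : 2 * (1 + t) * e <= 2 * (1 + t) * (mu * N).
    by rewrite ler_wpM2l // mulr_ge0; lra.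
  have : 0 < mu * N by rewrite mulr_gt0.
  nra.
have m0 : 0 < mu * N * t by rewrite !mulr_gt0.
have [||v1 pv] := @vertex_poincare _ _ E wt Erefl wt0 psi _ (14 * (mu * N) * t)
    (fun v => Psi (f v)) v0 psi0 ex _ _ bound; first lra.
  by rewrite -!mulrA ltr_pM2r ?ltr_nat // mulrA.
(* At most 2k thresholds are in use, so 4 n <= 8 k in the lower growth bound of [Psi]. *)
have lower : N <= 8 * k%:R * \sum_v wt v * `|Psi (f v) - Psi (f v1)|.
  apply: le_trans (sqnorm_le_shift (f v1) f0) _; rewrite mulr_sumr; apply: ler_sum => v _.
  rewrite [leRHS]mulrCA ler_pM2l //.
  have [_ _ PD] := pot.
  have step u w : f u <= f w ->
      (f w - f u) ^+ 2 <= 8 * k%:R * `|Psi (f w) - Psi (f u)|.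
    move=> uw; have [_ h2] := PD (f u) (f w) (xf u) uw; apply: (le_trans h2).
    apply: le_trans (_ : 4 * n%:R * `|Psi (f w) - Psi (f u)| <= _).
      by rewrite ler_wpM2l ?ler_norm // mulr_ge0.
    rewrite ler_wpM2r //; have : n%:R <= (2 * k)%:R :> R by rewrite ler_nat.
    by rewrite natrM; lra.
  have [h|/ltW h] := leP (f v1) (f v); first exact: step.
  have -> : (f v - f v1) ^+ 2 = (f v1 - f v) ^+ 2 by ring.
  by rewrite distrC; exact: step.
rewrite -/t -(ler_pM2r N0); apply: le_trans (_ : psi * (8 * k%:R *
    \sum_v wt v * `|Psi (f v) - Psi (f v1)|) <= _).
  by rewrite ler_pM2l.
rewrite mulrCA; apply: le_trans (_ : 8 * k%:R * (2 * (14 * (mu * N) * t)) <= _).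
  by rewrite ler_pM2l ?mulr_gt0.
by rewrite le_eqVlt; apply/orP; left; apply/eqP; ring.
Qed.

End ImprovedCheeger.

(** * Spectral gap, expansion and asymmetric ratio *)

Section SpectralGap.
Context {R : realType} {V : finType} (E : rel V) (wt : V -> R).
Hypothesis Erefl : reflexive E.
Hypothesis wt0 : forall v, 0 < wt v.

Lemma pairing_le_capacity (a d : V -> V -> R) : feasible E wt a ->
  (forall u v, 0 <= d u v) -> pairing a d <= pairing (edge_capacity E wt) d.
Proof.
move=> fa d0; apply: ler_sum => u _; apply: ler_sum => v _.
by rewrite ler_wpM2r // feasible_le_capacity.
Qed.

(** If x had tiny energy under a0, its L1 variation would be tiny under every reweighting, as a0
    dominates all of them up to kappa. The Poincare inequality would then make x nearly constant,
    against mean zero. *)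
Lemma second_eigenvalue_gt0 (psi kappa : R) (a0 : V -> V -> R) : (1 < #|V|)%N ->
  0 < psi -> expands E wt psi -> feasible E wt a0 -> 0 < kappa ->
  (forall u v, kappa * edge_capacity E wt u v <= a0 u v) ->
  0 < reweighted_eigenvalue E wt 2.
Proof.
move=> n1 psi0 ex fa0 k0 ka.
have /card_gt0P[v0 _] : (0 < #|V|)%N by exact: ltn_trans n1.
pose W := \sum_v wt v.
have W0 : 0 <= W by apply: sumr_ge0 => v _; exact: ltW.
(* A lower bound on the weights turns L1 closeness to a constant into uniform closeness. *)
have [q [q0 qw]] : exists q, 0 < q /\ forall v, q ^+ 2 <= wt v.
  have [vm _ vmin] := @arg_minP _ _ _ v0 predT wt isT.
  exists (Num.min 1 (wt vm)); split=> [|v]; first by rewrite lt_min ltr01 wt0.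
  apply: le_trans (vmin v isT); set w := wt vm; have w0 : 0 < w := wt0 vm.
  by case: (leP 1 w) => h; nra.
(* The factor 1 + W comes from AM-GM at scale eta r in [a0d]; the rest makes every pairing at most
   psi q r / 8, so that the L1 distance to a constant is at most q r / 2. *)
pose eta := psi * kappa * q / (8 * (1 + W)).
have eta0 : 0 < eta by rewrite divr_gt0 ?mulr_gt0 //; lra.
apply: (lt_le_trans (_ : 0 < eta ^+ 2)); first by rewrite exprn_gt0.
apply: (reweighted_second_ge wt0 fa0 n1) => x x0; rewrite leNgt; apply/negP => small.
have [a00 _ ar _] := fa0.
have N0 : 0 < sqnorm wt x.
  have := le_lt_trans (energy_ge0 x a00) small.
  by rewrite pmulr_rgt0 // exprn_gt0.
pose r := Num.sqrt (sqnorm wt x).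
have r0 : 0 < r by rewrite sqrtr_gt0.
have rN : r ^+ 2 = sqnorm wt x by rewrite sqr_sqrtr // ltW.
have er0 : 0 < eta * r by rewrite mulr_gt0.
have a0d : pairing a0 (fun u v => `|x u - x v|) <= (1 + W) * (eta * r).
  apply: le_trans (_ : \sum_u \sum_v a0 u v *
      (((x u - x v) ^+ 2 / (eta * r) + eta * r) / 2) <= _).
    apply: ler_sum => u _; apply: ler_sum => v _; rewrite ler_wpM2l //.
    rewrite ler_pdivlMr // -(ler_pM2r er0) mulrDl divfK ?gt_eqF //.
    rewrite -[(x u - x v) ^+ 2]real_normK ?num_real //.
    by have := sqr_ge0 (`|x u - x v| - eta * r); nra.
  have -> : \sum_u \sum_v a0 u v * (((x u - x v) ^+ 2 / (eta * r) + eta * r) / 2) =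
      energy a0 x / (eta * r) + W * (eta * r) / 2.
    have -> : W * (eta * r) / 2 = \sum_u \sum_v a0 u v * (eta * r / 2).
      under eq_bigr do rewrite -mulr_suml ar.
      by rewrite -mulr_suml -/W; ring.
    rewrite /energy mulr_sumr mulr_suml -big_split; apply: eq_bigr => u _ /=.
    rewrite mulr_sumr mulr_suml -big_split; apply: eq_bigr => v _ /=.
    by field; rewrite !gt_eqF.
  have : energy a0 x / (eta * r) <= eta * r.
    by rewrite ler_pdivrMr // (le_trans (ltW small)) // -rN; lra.
  nra.
have bound a : feasible E wt a -> pairing a (fun u v => `|x u - x v|) <= psi * q * r / 8.
  move=> fa; apply: le_trans (pairing_le_capacity fa (fun _ _ => normr_ge0 _)) _.
  rewrite -(ler_pM2l k0); apply: le_trans (_ : pairing a0 (fun u v => `|x u - x v|) <= _).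
    rewrite mulr_sumr; apply: ler_sum => u _; rewrite mulr_sumr; apply: ler_sum => v _.
    by rewrite mulrA ler_wpM2r.
  apply: le_trans a0d _; rewrite le_eqVlt; apply/orP; left; apply/eqP.
  by rewrite /eta; field; rewrite gt_eqF //; lra.
have pqr : 0 < psi * q * r by rewrite !mulr_gt0.
have [||v1] := @vertex_poincare _ _ E wt Erefl wt0 psi _ (psi * q * r / 4) x v0 psi0 ex
  _ _ bound; [lra|lra|].
have -> : 2 * (psi * q * r / 4) = psi * (q * r / 2) by field.
rewrite ler_pM2l // => h.
have qy v : q ^+ 2 * `|x v - x v1| <= q * r / 2.
  apply: le_trans h; apply: le_trans (_ : wt v * `|x v - x v1| <= _).
    by rewrite ler_wpM2r.
  rewrite (bigD1 v) //= lerDl; apply: sumr_ge0 => u _.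
  by rewrite mulr_ge0 // ltW.
have : q ^+ 2 * \sum_v wt v * (x v - x v1) ^+ 2 <= (q * r / 2) * (q * r / 2).
  apply: le_trans (_ : (\sum_v wt v * `|x v - x v1|) * (q * r / 2) <= _); last first.
    by rewrite ler_pM2r // divr_gt0 // mulr_gt0.
  rewrite mulr_sumr mulr_suml; apply: ler_sum => v _.
  rewrite -[(x v - x v1) ^+ 2]real_normK ?num_real // mulrCA -mulrA ler_pM2l //.
  rewrite expr2 mulrA mulrC ler_wpM2l //.
have := sqnorm_le_shift wt0 (x v1) x0; rewrite -rN.
move: (\sum_v wt v * (x v - x v1) ^+ 2) => s rs qs.
have : q ^+ 2 * r ^+ 2 <= q ^+ 2 * s by rewrite ler_pM2l // exprn_gt0.
have : 0 < (q * r) ^+ 2 by rewrite exprn_gt0 // mulr_gt0.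
nra.
Qed.

End SpectralGap.

(** * Cuts as test functions, cut weights and the dominating reweighting *)

Section VertexExpansion.
Context {R : realType} {V : finType} (E : rel V) (wt : V -> R).
Hypothesis Erefl : reflexive E.
Hypothesis wt0 : forall v, 0 < wt v.
Implicit Types (S T : {set V}).

Lemma proper_cutC S : proper_cut S -> proper_cut (~: S).
Proof.
case=> S0 ST; split.
  by rewrite -(inj_eq (@finset.setC_inj V)) finset.setCK finset.setC0.
by rewrite -(inj_eq (@finset.setC_inj V)) finset.setCK finset.setCT.
Qed.

Lemma weight_gt0 S : S != finset.set0 -> 0 < weight wt S.
Proof.
case/set0Pn => v vS; rewrite /weight (bigD1 v) //= ltr_pwDl //.
by apply: sumr_ge0 => u _; exact: ltW.
Qed.

Lemma out_boundary_sub S : out_boundary E S \subset ~: S.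
Proof. by apply/fintype.subsetP => v; rewrite !inE => /andP[]. Qed.

Lemma min_weight_gt0 S : proper_cut S ->
  0 < Num.min (weight wt S) (weight wt (~: S)).
Proof.
by move=> cS; have [S0' _] := proper_cutC cS; case: cS => S0 _; rewrite lt_min !weight_gt0.
Qed.

Lemma set_expansion_ge0 S : 0 <= set_expansion E wt S.
Proof. by rewrite divr_ge0 // le_min !weight_ge0. Qed.

Lemma set_expansion_le1 S : proper_cut S -> set_expansion E wt S <= 1.
Proof.
move=> cS; rewrite ler_pdivrMr ?min_weight_gt0 // mul1r le_min.
rewrite !ge_min; apply/andP; split; apply/orP; [right|left].
  apply: weight_sub => //; apply: fintype.subset_trans (out_boundary_sub _) _.
  by rewrite finset.setCK.
by apply: weight_sub => //; exact: out_boundary_sub.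
Qed.

Lemma exists_proper_cut : (1 < #|V|)%N -> exists S, proper_cut S.
Proof.
move=> n1; have /card_gt0P[v _] : (0 < #|V|)%N by exact: ltn_trans n1.
exists [set v]%SET; split; first by apply/set0Pn; exists v; rewrite inE.
by apply: contraTneq n1 => e; rewrite -cardsT -e cards1.
Qed.

Lemma vertex_expansion_le S : proper_cut S ->
  vertex_expansion E wt <= set_expansion E wt S.
Proof.
move=> cS; apply: ge_inf; last by exists S.
by exists 0 => _ [T _ <-]; exact: set_expansion_ge0.
Qed.

Lemma le_vertex_expansion (t : R) : (1 < #|V|)%N ->
  (forall S, proper_cut S -> t <= set_expansion E wt S) ->
  t <= vertex_expansion E wt.
Proof.
move=> n1 H; apply: lb_le_inf.
  by have [S cS] := exists_proper_cut n1; exists (set_expansion E wt S), S.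
by move=> _ [S cS <-]; exact: H.
Qed.

Lemma vertex_expansion_expands : expands E wt (vertex_expansion E wt).
Proof.
move=> S; have [S0|S0] := eqVneq S finset.set0.
  by rewrite S0 {1}/weight big_set0 min_l ?weight_ge0 // mulr0 weight_ge0.
have [ST|ST] := eqVneq S [set: V]%SET.
  by rewrite ST finset.setCT {2}/weight big_set0 min_r ?weight_ge0 // mulr0 weight_ge0.
have cS : proper_cut S by [].
rewrite -ler_pdivlMr ?min_weight_gt0 //.
apply: le_trans (vertex_expansion_le cS) _.
by rewrite /set_expansion ler_pM2r ?invr_gt0 ?min_weight_gt0 // ge_min lexx.
Qed.

(** Flow out of S enters only boundary vertices, and each receives at most its own weight. *)
Lemma flow_feasible_le (a : V -> V -> R) S : feasible E wt a ->
  flow a S <= weight wt (out_boundary E S).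
Proof.
case=> a0 aE _ ac; rewrite /flow exchange_big /= (big_setID (out_boundary E S)) /=.
rewrite [X in _ + X]big1 ?addr0 => [|v]; last first.
  rewrite !inE => /andP[nb vS]; apply: big1 => u uS; apply: aE.
  apply: contraNN nb => uv; rewrite vS /=; apply/existsP; exists u.
  by rewrite uS.
rewrite (finset.setIidPr (out_boundary_sub S)); apply: ler_sum => v _.
by rewrite -(ac v) [leRHS](bigID [in S]) /= lerDl sumr_ge0.
Qed.

Lemma energy_two_values (a : V -> V -> R) S (s t : R) :
  energy a (fun v => if v \in S then s else t) =
  2^-1 * ((flow a S + flow a (~: S)) * (s - t) ^+ 2).
Proof.
have split_sum (g : V -> R) : \sum_v g v = \sum_(v in S) g v + \sum_(v in ~: S) g v.
  rewrite (bigID [in S]) /=; congr (_ + _).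
  by apply: eq_bigl => v; rewrite inE.
rewrite /energy split_sum mulrDl; congr (_ * (_ + _)).
  rewrite /flow mulr_suml; apply: eq_bigr => u uS; rewrite split_sum.
  rewrite big1 ?add0r => [|v vS]; last by rewrite uS vS subrr expr2 !mulr0.
  rewrite mulr_suml; apply: eq_bigr => v; rewrite inE => /negbTE vS.
  by rewrite uS vS.
rewrite /flow finset.setCK mulr_suml; apply: eq_bigr => u; rewrite inE => /negbTE uS.
rewrite split_sum addrC big1 ?add0r => [|v]; last first.
  by rewrite inE => /negbTE vS; rewrite uS vS subrr expr2 !mulr0.
rewrite mulr_suml; apply: eq_bigr => v vS; rewrite uS vS; ring.
Qed.

(** The normalized indicators of S and [~: S] span the test space. Equal marginals make the flow
    across the cut the same both ways, so both boundary weights bound it. *)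
Lemma reweighted_second_le S : proper_cut S ->
  reweighted_eigenvalue E wt 2 <= 2 * set_expansion E wt S.
Proof.
move=> cS; apply: (reweighted_le Erefl wt0) => A rA.
have fA := reweighting_feasible rA; set a := mx_fun A in fA *.
have [a0 aE ar ac] := fA.
have flowC : flow a S = flow a (~: S).
  apply/eqP; rewrite -subr_eq0 -net_flow big1 // => u _.
  by rewrite ar ac subrr.
have [[S0 _] [S0' _]] := (cS, proper_cutC cS).
have w0 := weight_gt0 S0; have w1 := weight_gt0 S0'.
pose T (i : 'I_2) := match nat_of_ord i with 0%N => S | _ => ~: S end.
have T0 i : 0 < weight wt (T i) by rewrite /T; case: (nat_of_ord i).
pose h (i : 'I_2) v : R := (v \in T i)%:R / Num.sqrt (weight wt (T i)).
have ortho i j : \sum_v wt v * (h i v * h j v) = 1 * (i == j)%:R.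
  have [<-|ij] := eqVneq i j.
    rewrite mulr1; transitivity (\sum_v wt v * (v \in T i)%:R / weight wt (T i)).
      apply: eq_bigr => v _; rewrite /h mulrACA -invfM -[Num.sqrt _ * _]expr2 sqr_sqrtr ?ltW //.
      by case: (v \in T i); rewrite ?mulr1 ?mulr0 ?mul0r ?mulr0 ?mul1r.
    rewrite -mulr_suml -weight_indicator; have -> : [set v | v \in T i]%SET = T i.
      by apply/setP => v; rewrite inE.
    by rewrite divff // gt_eqF.
  rewrite mulr0 big1 // => v _; rewrite /h mulrACA.
  suff -> : (v \in T i)%:R * (v \in T j)%:R = 0 :> R by rewrite mul0r mulr0.
  move: i j ij => [[|[|//]] Hi] [[|[|//]] Hj]; rewrite -val_eqE //= => _; rewrite /T /= inE;
    by case: (v \in S); rewrite ?mulr0 ?mul0r.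
apply: (@kth_laplacian_le _ _ E _ wt0 A 2 h 1) => // c.
pose s := c ord0 / Num.sqrt (weight wt S).
pose t := c (lift ord0 ord0) / Num.sqrt (weight wt (~: S)).
have -> : (fun v => \sum_i c i * h i v) = fun v => if v \in S then s else t.
  apply/funext => v; rewrite !big_ord_recl big_ord0 addr0 /h /T /= !inE.
  case: (v \in S) => /=; rewrite mul0r mulr0.
    by rewrite addr0 mul1r.
  by rewrite add0r mul1r.
rewrite energy_two_values -flowC !big_ord_recl big_ord0 addr0 mul1r.
have s2 : s ^+ 2 = c ord0 ^+ 2 / weight wt S.
  by rewrite /s expr_div_n sqr_sqrtr // ltW.
have t2 : t ^+ 2 = c (lift ord0 ord0) ^+ 2 / weight wt (~: S).
  by rewrite /t expr_div_n sqr_sqrtr // ltW.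
set m := Num.min (weight wt S) (weight wt (~: S)).
have m0 : 0 < m by rewrite lt_min w0.
have phi : flow a S <= Num.min (weight wt (out_boundary E S)) (weight wt (out_boundary E (~: S))).
  by rewrite le_min {2}flowC !flow_feasible_le.
have div_m (x w : R) : 0 < w -> m <= w -> x ^+ 2 / w <= x ^+ 2 / m.
  by move=> wp mw; rewrite ler_wpM2l ?sqr_ge0 // lef_pV2.
have s3 : s ^+ 2 <= c ord0 ^+ 2 / m by rewrite s2 div_m // ge_min lexx.
have t3 : t ^+ 2 <= c (lift ord0 ord0) ^+ 2 / m by rewrite t2 div_m // ge_min lexx orbT.
have -> : 2^-1 * ((flow a S + flow a S) * (s - t) ^+ 2) = flow a S * (s - t) ^+ 2 by field.
rewrite /set_expansion -/m; move: phi; set b := Num.min _ (weight wt (out_boundary _ _)) => phi.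
apply: le_trans (_ : b * (s - t) ^+ 2 <= _); first by rewrite ler_wpM2r ?sqr_ge0.
have b0 : 0 <= b by rewrite le_min !weight_ge0.
rewrite mulrA (mulrC 2) -!mulrA ler_wpM2l // mulrA mulrC -mulrA.
have := sqr_ge0 (s + t); lra.
Qed.

Lemma cut_weightE S : cut_weight E wt S = flow (edge_capacity E wt) S.
Proof.
apply: eq_bigr => u _; rewrite big_mkcondr; apply: eq_bigr => v _.
by rewrite /edge_capacity; case: (E u v); rewrite ?mul1r ?mul0r.
Qed.

Lemma total_degree_le v : (total_degree E v <= max_degree E)%N.
Proof. exact: leq_bigmax. Qed.

Lemma capacity_row_le u : \sum_v edge_capacity E wt u v <= (max_degree E)%:R * wt u.
Proof.
apply: le_trans (_ : \sum_(v | E u v) wt u <= _).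
  rewrite [leRHS]big_mkcond; apply: ler_sum => v _; rewrite /edge_capacity.
  by case: (E u v); rewrite ?mul1r ?mul0r // ge_min lexx.
rewrite sumr_const -[leLHS]mulr_natl ler_wpM2r ?(ltW (wt0 u)) // ler_nat.
apply: leq_trans _ (total_degree_le u); apply: leq_trans _ (leq_addl _ _).
exact/eq_leq/eq_card.
Qed.

Lemma capacity_column_le v : \sum_u edge_capacity E wt u v <= (max_degree E)%:R * wt v.
Proof.
apply: le_trans (_ : \sum_(u | E u v) wt v <= _).
  rewrite [leRHS]big_mkcond; apply: ler_sum => u _; rewrite /edge_capacity.
  by case: (E u v); rewrite ?mul1r ?mul0r // ge_min lexx orbT.
rewrite sumr_const -[leLHS]mulr_natl ler_wpM2r ?(ltW (wt0 v)) // ler_nat.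
apply: leq_trans _ (total_degree_le v); apply: leq_trans _ (leq_addr _ _).
exact/eq_leq/eq_card.
Qed.

Lemma cut_weight_le S :
  cut_weight E wt S <= (max_degree E)%:R * Num.min (weight wt S) (weight wt (~: S)).
Proof.
have part (T : {set V}) (g : V -> R) : (forall v, 0 <= g v) ->
    \sum_(v in T) g v <= \sum_v g v.
  move=> g0; rewrite [leRHS](bigID [in T]) /= lerDl.
  by apply: sumr_ge0.
rewrite cut_weightE minr_pMr // le_min; apply/andP; split; rewrite /flow.
  rewrite mulr_sumr; apply: ler_sum => u _; apply: le_trans (capacity_row_le u).
  by apply: part => v; exact: edge_capacity_ge0.
rewrite exchange_big mulr_sumr; apply: ler_sum => v _ /=.
apply: le_trans (capacity_column_le v).
by apply: part => u; exact: edge_capacity_ge0.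
Qed.

(* The cheaper endpoints of the edges leaving S form a vertex cover X of these
   edges of weight at most cut_weight S; deleting X from S leaves a set whose
   out-boundary lies in X. *)
Lemma cut_weight_ge S (psi : R) : 0 <= psi -> psi <= 1 -> expands E wt psi ->
  psi * Num.min (weight wt S) (weight wt (~: S)) <= 2 * cut_weight E wt S.
Proof.
move=> psi0 psi1 ex; rewrite cut_weightE; set phi := flow _ S.
pose X1 := [set u in S | [exists v, (v \notin S) && E u v && (wt u <= wt v)]]%SET.
pose X2 := [set v in ~: S | [exists u, (u \in S) && E u v && (wt v < wt u)]]%SET.
pose low u v : R := edge_capacity E wt u v * (wt u <= wt v)%R%:R.
pose high u v : R := edge_capacity E wt u v * (wt v < wt u)%R%:R.
have low0 u v : 0 <= low u v by rewrite mulr_ge0 ?edge_capacity_ge0.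
have high0 u v : 0 <= high u v by rewrite mulr_ge0 ?edge_capacity_ge0.
have phiE : phi = flow low S + flow high S.
  rewrite /phi /flow -big_split; apply: eq_bigr => u _.
  rewrite -big_split; apply: eq_bigr => v _ /=; rewrite /low /high.
  by rewrite ltNge; case: (wt u <= wt v); rewrite mulr1 mulr0 ?addr0 ?add0r.
have X1S : X1 \subset S by apply/fintype.subsetP => u; rewrite inE => /andP[].
have X2S : X2 \subset ~: S by apply/fintype.subsetP => u; rewrite inE => /andP[].
have w1 : weight wt X1 <= flow low S.
  rewrite /flow (big_setID X1) /= (finset.setIidPr X1S) -[leLHS]addr0 lerD //.
    apply: ler_sum => u; rewrite inE => /andP[uS /existsP[v /andP[/andP[vS uv] uvw]]].
    rewrite (bigD1 v) ?inE //= {1}/low {1}/edge_capacity uv uvw mul1r mulr1 min_l //.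
    by rewrite lerDl sumr_ge0.
  by apply: sumr_ge0 => u _; apply: sumr_ge0.
have w2 : weight wt X2 <= flow high S.
  rewrite /flow exchange_big (big_setID X2) /= (finset.setIidPr X2S) -[leLHS]addr0 lerD //.
    apply: ler_sum => v; rewrite inE => /andP[vS /existsP[u /andP[/andP[uS uv] uvw]]].
    rewrite (bigD1 u) //= {1}/high {1}/edge_capacity uv uvw mul1r mulr1 min_r ?(ltW uvw) //.
    by rewrite lerDl sumr_ge0.
  by apply: sumr_ge0 => u _; apply: sumr_ge0.
pose T := (S :\: X1)%SET.
have bT : weight wt (out_boundary E T) <= phi.
  rewrite phiE; apply: le_trans (lerD w1 w2).
  apply: le_trans (_ : weight wt (X1 :|: X2)%SET <= _).
    apply: weight_sub => //; apply/fintype.subsetP => v.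
    rewrite inE => /andP[vT /existsP[u /andP[uT uv]]].
    move: uT; rewrite finset.in_setD => /andP[uX uS].
    rewrite finset.in_setU; have [vS|vS] := boolP (v \in S).
      by move: vT; rewrite finset.in_setD vS andbT negbK => ->.
    apply/orP; right; rewrite inE finset.in_setC vS /=; apply/existsP; exists u.
    rewrite uS uv /= ltNge; apply: contraNN uX => uvw.
    rewrite inE uS /=; apply/existsP; exists v; by rewrite vS uv.
  rewrite /weight [leLHS](big_setID X1) /=.
  rewrite (finset.setIidPr (finset.subsetUl _ _)).
  rewrite lerD2l; apply: weight_sub => //; apply/fintype.subsetP => v.
  by rewrite finset.in_setD finset.in_setU => /andP[/negbTE ->].
have wT : weight wt T + weight wt X1 = weight wt S.
  rewrite [RHS]/weight (big_setID X1) /= (finset.setIidPr X1S) addrC.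
  by [].
have wTC : weight wt (~: S) <= weight wt (~: T).
  by apply: weight_sub => //; rewrite finset.setCS finset.subsetDl.
have hT := le_trans (ex T) bT.
have h2 : 0 <= flow high S by apply: sumr_ge0 => u _; apply: sumr_ge0.
have X10 := weight_ge0 wt0 X1.
(* If T is the lighter side, psi w(S) = psi w(T) + psi w(X1) <= 2 phi; otherwise psi w(~: S) <= psi
   w(~: T) <= phi. *)
move: hT wT wTC; case: (leP (weight wt T) (weight wt (~: T))) => hTC hT wT wTC.
  have : psi * Num.min (weight wt S) (weight wt (~: S)) <= psi * weight wt S.
    by rewrite ler_wpM2l // ge_min lexx.
  have : psi * weight wt X1 <= weight wt X1 by rewrite ler_piMl.
  by rewrite -wT mulrDr; lra.
have : psi * Num.min (weight wt S) (weight wt (~: S)) <= psi * weight wt (~: T).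
  by rewrite ler_wpM2l // ge_min wTC orbT.
have : 0 <= flow low S by apply: sumr_ge0 => u _; apply: sumr_ge0.
lra.
Qed.

Lemma cut_ratio_le S : proper_cut S ->
  cut_weight E wt S / cut_weight E wt (~: S) <= asymmetric_ratio E wt.
Proof.
move=> cS; apply: ub_le_sup; last by exists S.
exists (\sum_(T : {set V}) `|cut_weight E wt T / cut_weight E wt (~: T)|).
move=> _ [T _ <-]; rewrite (bigD1 T) //=; apply: le_trans (ler_norm _) _.
by rewrite lerDl sumr_ge0.
Qed.

Lemma max_degree_ge2 : (1 < #|V|)%N -> (2 <= max_degree E)%N.
Proof.
move=> n1; have /card_gt0P[v _] : (0 < #|V|)%N by exact: ltn_trans n1.
apply: leq_trans _ (total_degree_le v); rewrite /total_degree -[2%N]/(1 + 1)%N.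
by apply: leq_add; apply/card_gt0P; exists v; rewrite inE Erefl.
Qed.

Context (psi : R).
Hypothesis n1 : (1 < #|V|)%N.
Hypothesis psi0 : 0 < psi.
Hypothesis psi1 : psi <= 1.
Hypothesis psiE : expands E wt psi.
Local Notation Delta := ((max_degree E)%:R : R).
Local Notation alpha := (asymmetric_ratio E wt).

Lemma Delta_ge2 : 2 <= Delta.
Proof. by rewrite ler_nat max_degree_ge2. Qed.

Lemma cut_weight_gt0 S : proper_cut S -> 0 < cut_weight E wt S.
Proof.
move=> cS; have := cut_weight_ge S (ltW psi0) psi1 psiE.
have := min_weight_gt0 cS; set m := Num.min _ _ => m0 h.
have : 0 < psi * m by rewrite mulr_gt0.
lra.
Qed.

(** The ratios of S and [~: S] are reciprocal, so one of them is at least 1. *)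
Lemma asymmetric_ratio_ge1 : 1 <= alpha.
Proof.
have [S cS] := exists_proper_cut n1; have cS' := proper_cutC cS.
have := cut_ratio_le cS; have := cut_ratio_le cS'; rewrite finset.setCK.
have := cut_weight_gt0 cS; have := cut_weight_gt0 cS'.
move: (cut_weight E wt S) (cut_weight E wt (~: S)) => x y y0 x0.
rewrite !ler_pdivrMr // => h1 h2; rewrite leNgt; apply/negP => a1.
have : alpha * x < x by rewrite gtr_pMl.
have : alpha * y < y by rewrite gtr_pMl.
lra.
Qed.

(** With m the lighter of the two sides, the numerator is at most Delta m and the denominator at
    least psi m / 2. *)
Lemma asymmetric_ratio_le : alpha <= 2 * Delta / psi.
Proof.
apply: ge_sup.
  by have [S cS] := exists_proper_cut n1; eexists; exists S.
move=> _ [S cS <-]; have cS' := proper_cutC cS.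
rewrite ler_pdivrMr ?cut_weight_gt0 //.
apply: le_trans (cut_weight_le S) _.
have := cut_weight_ge (~: S) (ltW psi0) psi1 psiE.
rewrite finset.setCK minC; set m := Num.min _ _ => h.
have -> : 2 * Delta / psi * cut_weight E wt (~: S) =
  Delta * (2 * cut_weight E wt (~: S) / psi) by field; rewrite gt_eqF.
by rewrite ler_wpM2l // ler_pdivlMr // mulrC.
Qed.

(** Hoffman's theorem gives a circulation between the capacities and alpha times them. Its marginals
    are at most Delta alpha times the weights, so after scaling self-loops supply the remainder. *)
Lemma large_feasible : exists2 a, feasible E wt a &
  forall u v, (Delta * alpha)^-1 * edge_capacity E wt u v <= a u v.
Proof.
have a1 := asymmetric_ratio_ge1; have D2 := Delta_ge2.
have [S S0 ST|b [bw bc]] := @hoffman_circulation R V _ alpha (edge_capacity_ge0 E wt0) a1.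
  have cS : proper_cut S by [].
  rewrite -!cut_weightE -ler_pdivrMr ?cut_ratio_le //.
  exact/cut_weight_gt0/proper_cutC.
have Da : 0 < Delta * alpha by rewrite mulr_gt0 //; lra.
have b0 u v : 0 <= b u v.
  by have /andP[h _] := bw u v; apply: le_trans h; exact: edge_capacity_ge0.
have bout u : \sum_v b u v <= Delta * alpha * wt u.
  apply: le_trans (_ : alpha * \sum_v edge_capacity E wt u v <= _).
    by rewrite mulr_sumr; apply: ler_sum => v _; have /andP[] := bw u v.
  rewrite (mulrC Delta) -mulrA ler_wpM2l ?capacity_row_le //; lra.
pose r u := wt u - (Delta * alpha)^-1 * \sum_v b u v.
have r0 u : 0 <= r u by rewrite subr_ge0 mulrC ler_pdivrMr // mulrC.
exists (fun u v => (Delta * alpha)^-1 * b u v + r u * (u == v)%:R).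
  split=> [u v|u v uv|u|u].
  - by rewrite addr_ge0 // mulr_ge0 // invr_ge0 ltW.
  - have -> : (u == v) = false by apply: contraNF uv => /eqP ->; exact: Erefl.
    have /andP[_] := bw u v; rewrite /edge_capacity (negbTE uv) mul0r mulr0 => h.
    have -> : b u v = 0 by apply/eqP; rewrite eq_le h b0.
    by rewrite !mulr0 addr0.
  - rewrite big_split /= -mulr_sumr.
    under [X in _ + X]eq_bigr do rewrite eq_sym.
    by rewrite (sum_indicator (fun=> r u)) /r addrC subrK.
  - by rewrite big_split /= -mulr_sumr sum_indicator -bc /r addrC subrK.
move=> u v; rewrite -[leLHS]addr0 lerD ?mulr_ge0 //.
by rewrite ler_pM2l ?invr_gt0 //; have /andP[] := bw u v.
Qed.

End VertexExpansion.

(** * The three inequalities *)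

Lemma half_le_ln (R : realType) (x : R) : 2 <= x -> 1 / 2 <= ln x.
Proof.
move=> x2; rewrite -[1 / 2](@expRK R) ler_ln ?posrE ?expR_gt0 //; last lra.
apply: le_trans x2; have := expR_ge1Dx (- (1 / 2) : R).
rewrite expRN; have := expR_gt0 (1 / 2 : R); move: (expR (1 / 2)) => e e0 h.
have : (1 - 1 / 2) * e <= e^-1 * e by rewrite ler_pM2r //; lra.
by rewrite mulVf ?gt_eqF //; lra.
Qed.

Section MainInequalities.
Context {R : realType} {V : finType} (E : rel V) (wt : V -> R) (k : nat).
Hypothesis Erefl : reflexive E.
Hypothesis wt0 : forall v, 0 < wt v.
Hypothesis kn : (2 <= k <= #|V|)%N.
Local Notation psi := (vertex_expansion E wt).
Local Notation alpha := (asymmetric_ratio E wt).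
Local Notation Delta := ((max_degree E)%:R : R).
Local Notation lambda := (reweighted_eigenvalue E wt).

Let n1 : (1 < #|V|)%N.
Proof. by case/andP: kn => k2 /(leq_trans k2). Qed.

Lemma second_le_expansion : lambda 2%N <= 2 * psi.
Proof.
rewrite mulrC -ler_pdivrMr //; apply: le_vertex_expansion => // S cS.
by rewrite ler_pdivrMr // mulrC; exact: reweighted_second_le.
Qed.

Lemma second_ge0 : 0 <= lambda 2%N.
Proof.
apply: (reweighted_second_ge wt0 (loops_feasible Erefl wt0) n1) => x _.
rewrite mul0r; apply: energy_ge0.
by case: (loops_feasible Erefl wt0).
Qed.

Lemma expansion_ge0 : 0 <= psi.
Proof. by apply: le_vertex_expansion => // S _; exact: set_expansion_ge0. Qed.

Lemma expansion_le1 : psi <= 1.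
Proof.
have [S cS] := exists_proper_cut n1.
exact: le_trans (vertex_expansion_le E wt0 cS) (set_expansion_le1 E wt0 cS).
Qed.

Lemma reweighted_le2 : lambda k <= 2.
Proof.
apply: (reweighted_le Erefl wt0) => A rA.
apply: (kth_laplacian_le2 wt0 (reweighting_feasible rA)).
by case/andP: kn => k2 ->; rewrite (leq_trans _ k2).
Qed.

Hypothesis psi0 : 0 < psi.

Lemma degree_ratio_ge2 : 2 <= Delta * alpha.
Proof.
have D2 : 2 <= Delta := Delta_ge2 Erefl n1.
have := asymmetric_ratio_ge1 wt0 n1 psi0 expansion_le1 (vertex_expansion_expands E wt0).
by nra.
Qed.

Lemma eigenvalue_gt0 : 0 < lambda 2%N.
Proof.
have ex := vertex_expansion_expands E wt0.
have [a fa ka] := large_feasible Erefl wt0 n1 psi0 expansion_le1 ex.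
apply: (second_eigenvalue_gt0 Erefl wt0 n1 psi0 ex fa _ ka).
by rewrite invr_gt0; have := degree_ratio_ge2; lra.
Qed.

Lemma expansion_le_eigenvalues :
  psi <= 224 * 2112 * 2 * (k%:R * ln (Delta * alpha) * lambda 2%N / Num.sqrt (lambda k)).
Proof.
have ex := vertex_expansion_expands E wt0.
have [a fa ka] := large_feasible Erefl wt0 n1 psi0 expansion_le1 ex.
have Da := degree_ratio_ge2; have l0 := eigenvalue_gt0.
have [k2 kV] := andP kn.
have lk : 0 < lambda k by apply: lt_le_trans l0 (reweighted_mono Erefl wt0 _ _).
(* The embedding exists for any value above the second eigenvalue; positivity allows twice that
   eigenvalue. *)
have [|f [fmean flow]] := @minimax_embedding _ _ E wt Erefl wt0 (2 * lambda 2%N) n1.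
  lra.
set L := ln (Delta * alpha).
have L1 : 1 / 2 <= L by exact: half_le_ln.
have Lk : expR (- L) <= (Delta * alpha)^-1.
  by rewrite expRN lnK // posrE; lra.
have [|z [zmean z0 zlow]] := dimension_reduction wt0 fa ka L1 Lk _ fmean flow; first lra.
have mu0 : 0 < 2112 * L * (2 * lambda 2%N).
  have p1 : 0 < 2112 :> R by rewrite ltr0n.
  have p2 : 0 < L by lra.
  have p3 : 0 < 2 * lambda 2%N by lra.
  exact: mulr_gt0 (mulr_gt0 p1 p2) p3.
have := improved_cheeger Erefl wt0 psi0 ex mu0 (ltnW k2) lk reweighted_le2 (lexx _)
  zmean z0 zlow.
move=> h; apply: le_trans h _; rewrite le_eqVlt; apply/orP; left; apply/eqP; ring.
Qed.

(** With x = Delta / psi, the bound on alpha gives Delta alpha <= 2 Delta x <= 2 x^2 <= x^3, as x >=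
    Delta and x >= 2. *)
Lemma ln_ratio_le : ln (Delta * alpha) <= 3 * ln (Delta / psi).
Proof.
have D2 : 2 <= Delta := Delta_ge2 Erefl n1.
have Dp : 2 <= Delta / psi.
  by rewrite ler_pdivlMr //; have := expansion_le1; have := psi0; nra.
have -> : 3 * ln (Delta / psi) = ln ((Delta / psi) ^+ 3).
  by rewrite lnXn ?mulr_natl //; lra.
have Da := degree_ratio_ge2.
rewrite ler_ln ?posrE ?exprn_gt0 //; [|lra|lra].
have al := asymmetric_ratio_le wt0 n1 psi0 expansion_le1 (vertex_expansion_expands E wt0).
apply: le_trans (_ : Delta * (2 * Delta / psi) <= _).
  by rewrite ler_wpM2l //; lra.
have p1 : Delta <= Delta / psi.
  by rewrite ler_pdivlMr //; have := expansion_le1; have := psi0; nra.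
have -> : Delta * (2 * Delta / psi) = 2 * Delta * (Delta / psi) by ring.
move: Delta (Delta / psi) D2 Dp p1 => d x d2 x2 dx.
have h : d * x <= x * x by rewrite ler_wpM2r //; lra.
have : 0 <= (x - 2) * (x * x) by rewrite !mulr_ge0; lra.
rewrite !exprS expr0; lra.
Qed.

End MainInequalities.

Theorem theorem4p5 (R : realType) :
  exists c1 c2 c3 : R, [/\ 0 < c1, 0 < c2, 0 < c3 &
    forall (V : finType) (E : rel V) (wt : V -> R) (k : nat),
      reflexive E -> (forall v, 0 < wt v) -> (2 <= k <= #|V|)%N ->
      let psi := vertex_expansion E wt in
      let alpha := asymmetric_ratio E wt in
      let Delta := (max_degree E)%:R : R in
      let lambda := reweighted_eigenvalue E wt in
      let middle := k%:R `^ (3 / 2) * ln (Delta * alpha) * lambda 2%N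
                    / Num.sqrt (lambda k) in
      let right := k%:R `^ (3 / 2) * ln (Delta / psi) * lambda 2%N
                   / Num.sqrt (lambda k) in
      [/\ lambda 2%N <= c1 * psi, psi <= c2 * middle & middle <= c3 * right]].
Proof.
have cpos : 0 < 224 * 2112 * 2 :> R.
  have p1 : 0 < 224 :> R by rewrite ltr0n.
  have p2 : 0 < 2112 :> R by rewrite ltr0n.
  exact: mulr_gt0 (mulr_gt0 p1 p2) (ltr0Sn _ 1).
exists 2, (224 * 2112 * 2), 3; split=> [| | |V E wt k Erefl wt0 kn psi alpha Delta lambda middle right].
- by rewrite ltr0n.
- exact: cpos.
- by rewrite ltr0n.
have l2 : lambda 2%N <= 2 * psi := second_le_expansion Erefl wt0 kn.
have l0 : 0 <= lambda 2%N := second_ge0 Erefl wt0 kn.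
have psi_ge0 : 0 <= psi := expansion_ge0 E wt0 kn.
(* If psi = 0, the first inequality forces the second eigenvalue to be 0, and [middle] and [right]
   vanish whatever values the logarithms take. *)
have [psi0|psi_neq0] := eqVneq psi 0.
  have lz : lambda 2%N = 0 by lra.
  by rewrite /middle /right lz !mulr0 !mul0r !mulr0 psi0.
have psi_gt0 : 0 < psi by rewrite lt_neqAle eq_sym psi_neq0.
have k1 : 1 <= k%:R :> R by rewrite ler1n; case/andP: kn => /ltnW.
(* [expansion_le_eigenvalues] has the factor k, which is at most k^(3/2). *)
have k0 : k%:R <= k%:R `^ (3 / 2) :> R.
  rewrite -[leLHS]powRr1 ?ler_powR ?ler0n //; lra.
have L0 : 0 <= ln (Delta * alpha).
  by have := half_le_ln (degree_ratio_ge2 Erefl wt0 kn psi_gt0); rewrite -/Delta; lra.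
split=> //.
  apply: le_trans (expansion_le_eigenvalues Erefl wt0 kn psi_gt0) _.
  rewrite ler_pM2l; last exact: cpos.
  rewrite /middle ler_wpM2r ?invr_ge0 ?sqrtr_ge0 // ler_wpM2r //.
  by rewrite ler_wpM2r.
rewrite /middle /right !mulrA ler_wpM2r ?invr_ge0 ?sqrtr_ge0 // ler_wpM2r //.
rewrite -[leRHS]mulrA [leRHS]mulrCA ler_wpM2l ?powR_ge0 //.
exact: (ln_ratio_le Erefl wt0 kn psi_gt0).
Qed.
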